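(* Let $\Bbbk$ be a commutative ring with unit. (i) For every XC-algebra $(A,R,\kappa)$ over $\Bbbk$, the category of elements $\mathcal{E}(A)$ (open version, constructed in the context) is a strict open-traced monoidal category, whose objects are the non-negative integers, whose only morphisms are endomorphisms, and with $\mathrm{End}_{\mathcal{E}(A)}(n)\subset A^{\otimes n}\times\mathfrak{S}_n$ (set-theoretical inclusion). (ii) For every traced XC-algebra $(A,R,\kappa,\mathrm{tr})$ over $\Bbbk$, the category of elements $\mathcal{E}(A)$ (traced version, constructed in the context) is a strict traced monoidal category, whose objects are the non-negative integers, whose only morphisms are endomorphisms, and with $\mathrm{End}_{\mathcal{E}(A)}(n)\subset A^{\otimes n}\times\mathfrak{S}_n$ (set-theoretical inclusion).
   Context: XC-algebras. An XC-algebra over $\Bbbk$ is a $\Bbbk$-algebra $A$ with invertible elements $R=\sum_i\alpha_i\otimes\beta_i\in A\otimes A$ (with inverse $R^{-1}=\sum_i\bar\alpha_i\otimes\bar\beta_i$) and $\kappa\in A$ such that (XC0) $R^{\pm1}=(\kappa\otimes\kappa)R^{\pm1}(\kappa^{-1}\otimes\kappa^{-1})$; (XC1f) $\sum_i\beta_i\kappa\alpha_i=\sum_i\alpha_i\kappa^{-1}\beta_i$; (XC2c) $1\otimes\kappa^{-1}=\sum_{i,j}\alpha_i\bar\alpha_j\otimes\bar\beta_j\kappa^{-1}\beta_i$; (XC2d) $\kappa\otimes1=\sum_{i,j}\bar\alpha_j\kappa\alpha_i\otimes\beta_i\bar\beta_j$; (XC3) $R_{12}R_{13}R_{23}=R_{23}R_{13}R_{12}$.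 Put $\nu:=\sum_i\alpha_i\kappa^{-1}\beta_i$. A traced XC-algebra is an XC-algebra together with a $\Bbbk$-linear map $\mathrm{tr}:A\to\Bbbk$ with $\mathrm{tr}(ab)=\mathrm{tr}(ba)$. Monoids. For $\sigma\in\mathfrak{S}_n$ let $\sigma_*(x_1\otimes\cdots\otimes x_n)=x_{\sigma^{-1}(1)}\otimes\cdots\otimes x_{\sigma^{-1}(n)}$. The set $A^{\otimes n}\times\mathfrak{S}_n$ is a monoid with $(u,\sigma)(v,\tau)=(\tau^{-1}_*(u)\cdot v,\sigma\tau)$ and unit $(1\otimes\cdots\otimes1,\mathrm{id})$; for $n=0$ it is read as $\Bbbk$ under multiplication. Let $s_i=(i,i+1)$ and $\hat R_i=(1\otimes\cdots\otimes R\otimes\cdots\otimes1,s_i)$, $1\le i<n$, with $R$ in factors $i,i+1$; it is invertible with inverse $(1\otimes\cdots\otimes R^{-1}_{21}\otimes\cdots\otimes1,s_i)$. Let $\mathcal{J}_n$ be the submonoid generated by the unit and all $\hat R_i^{\pm1}$. Closure maps (open version). A permutation in $\mathfrak{S}_{n+m}$ is $(n,m)$-admissible if it has no cycle of length $\le m$ (fixed points included) consisting only of elements of $\{n+1,\dots,n+m\}$. Let $\mathcal{F}_{n,m}$ be the set of $(u,\sigma)\in A^{\otimes n+m}\times\mathfrak{S}_{n+m}$ with $\sigma$ $(n,m)$-admissible. Define $\varphi_{n,m}:\mathcal{F}_{n,m}\to A^{\otimes n}\times\mathfrak{S}_n$ by: $\varphi_{n,0}$ is the natural inclusion; for $(u,\sigma)=(\sum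 x_1\otimes\cdots\otimes x_{n+1},\sigma)\in\mathcal{F}_{n,1}$ and $j=\sigma^{-1}(n+1)\ne n+1$, $\varphi_{n,1}(u,\sigma)=(\sum x_1\otimes\cdots\otimes x_{j-1}\otimes x_{n+1}\kappa x_j\otimes x_{j+1}\otimes\cdots\otimes x_n,\widehat\sigma)$, where $\widehat\sigma(j)=\sigma(n+1)$ and $\widehat\sigma(i)=\sigma(i)$ for $i\ne j$, $i\le n$; and $\varphi_{n,m}=\varphi_{n,m-1}\circ\varphi_{n+m-1,1}$ for $m>1$. For $n>0$ let $\mathcal{I}_n$ be the smallest submonoid of $A^{\otimes n}\times\mathfrak{S}_n$ containing $\varphi_{n,m}(\mathcal{J}_{n+m}\cap\mathcal{F}_{n,m})$ for all $m\ge0$; for $n=0$ set $\mathcal{I}_0:=\Bbbk$ with its multiplicative monoid structure. Closure maps (traced version). $\varphi_{n,m}:A^{\otimes n+m}\times\mathfrak{S}_{n+m}\to A^{\otimes n}\times\mathfrak{S}_n$ is defined by the same recursion ($\varphi_{n,0}$ being the identity), using the same formula for $\varphi_{n,1}(u,\sigma)$ if $\sigma(n+1)\neq n+1$, and $\varphi_{n,1}(u,\sigma)=(\sum\mathrm{tr}(\kappa x_{n+1})\,x_1\otimes\cdots\otimes x_n,\sigma|_{\{1,\dots,n\}})$ if $\sigma(n+1)=n+1$. For $n>0$, $\mathcal{I}_n$ is the smallest submonoid of $A^{\otimes n}\times\mathfrak{S}_n$ containing $\varphi_{n,m}(\mathcal{J}_{n+m})$ for all $m\ge0$; again $\mathcal{I}_0:=\Bbbk$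 with its multiplicative monoid structure. The category $\mathcal{E}(A)$ (either version). Objects: integers $n\ge0$; $\mathrm{End}(n)=\mathcal{I}_n$ with composition the monoid product; no morphisms between different objects. Monoidal product: addition on objects and $(u,\sigma)\otimes(v,\xi)=(u\otimes v,\sigma\otimes\xi)$ on morphisms, $\sigma\otimes\xi$ being the block permutation; tensoring $(u,\sigma)$ with $\lambda\in\mathcal{I}_0=\Bbbk$ (on either side) gives $(\lambda u,\sigma)$, and on $\mathcal{I}_0\times\mathcal{I}_0$ the product is multiplication in $\Bbbk$. Braiding: $\tau_{0,0}=1$, $\tau_{1,0}=\tau_{0,1}=(1,\mathrm{id})$, $\tau_{1,1}=(R,(12))$, and the remaining $\tau_{n,m}$ are those forced inductively by the braiding axioms. Twist: $\theta_0=1$, $\theta_1=(\nu,\mathrm{id})$, and $\theta_n$ for $n>1$ is forced inductively by $\theta_{p+q}=(\theta_p\otimes\theta_q)\tau_{q,p}\tau_{p,q}$. In the open version, the structure functor $P:\mathcal{E}(A)\to\mathfrak{S}$ is the identity on objects and projects $(u,\sigma)\mapsto\sigma$ on morphisms, and the open trace of an $(n,n,m)$-admissible $f\in\mathrm{End}(n+m)$ is $\mathrm{tr}_{n,n}^m(f)=\varphi_{n,m}(f)$. In the traced version, $\mathrm{tr}_{n,n}^m(f)=\varphi_{n,m}(f)$ for all $f\in\mathrm{End}(n+m)$. Target notions. $\mathfrak{S}$ is the strict balanced monoidal category with objects $n\ge0$, $\mathrm{End}(n)=\mathfrak{S}_n$, no other morphisms, block product, braiding $\tau_{n,m}:i\mapsto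 i+m\pmod{n+m}$ and identity twist. A strict traced monoidal category is a strict balanced monoidal category $\mathcal{C}$ (unit $\mathbf{1}$, braiding $\tau$, twist $\theta$) with maps $\mathrm{tr}_{X,Y}^U:\mathrm{Hom}(X\otimes U,Y\otimes U)\to\mathrm{Hom}(X,Y)$, natural in $X,Y$ ($\mathrm{tr}((v\otimes\mathrm{id})f(u\otimes\mathrm{id}))=v\,\mathrm{tr}(f)\,u$) and in $U$ ($\mathrm{tr}^U((\mathrm{id}\otimes u)f)=\mathrm{tr}^V(f(\mathrm{id}\otimes u))$ for $f:X\otimes U\to Y\otimes V$, $u:V\to U$), such that: (1) $\mathrm{tr}^{\mathbf1}_{X,Y}(f)=f$; (2) $\mathrm{tr}_{X,Y}^{U\otimes V}(g)=\mathrm{tr}_{X,Y}^U(\mathrm{tr}_{X\otimes U,Y\otimes U}^V(g))$; (3) for $f:X_1\otimes U\to Y_1\otimes U$ and $g:X_2\to Y_2$, $\mathrm{tr}^U(f)\otimes g=\mathrm{tr}^U((\mathrm{id}\otimes\tau^{-1}_{Y_2,U})(f\otimes g)(\mathrm{id}\otimes\tau_{X_2,U}))=\mathrm{tr}^U((\mathrm{id}\otimes\tau_{U,Y_2})(f\otimes g)(\mathrm{id}\otimes\tau^{-1}_{U,X_2}))$; (4) $\mathrm{tr}_{U,U}^U(\tau_{U,U}^{\pm1})=\theta_U^{\pm1}$. A strict open-traced monoidal category is a strict balanced monoidal category $\mathcal{C}$ with a strict monoidal functor $P:\mathcal{C}\to\mathfrak{S}$ preserving braiding and twist, and maps $\mathrm{tr}_{X,Y}^U$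 with values in $\mathrm{Hom}(X,Y)$ defined only on the $(X,Y,U)$-admissible morphisms (those $f:X\otimes U\to Y\otimes U$ with $P(f)$ being $(P(X),P(U))$-admissible), satisfying the same naturality and axioms (1)--(4) for admissible morphisms ($g$ being $(X,Y,U\otimes V)$-admissible in (2), and $f$ admissible and $g$ arbitrary in (3)).
   Formalization: As stated, I_n (n>0) need not be stable under tensoring with I_0 = k (k=A=Z, R=κ=1), so the formal theorem takes I_n, for all n≥0, generated by the closures and the scalars c·1 with c in an arbitrary subset K of k; K=k gives End(0)=k. *)

(* Defs.v *)
From HB Require Import structures.
From mathcomp Require Import all_boot all_order all_fingroup all_algebra.
From mathcomp Require Import generic_quotient boolp zify.

Set Implicit Arguments.
Unset Strict Implicit.
Unset Printing Implicit Defensive.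

Import GRing.Theory.
Local Open Scope ring_scope.
Local Open Scope quotient_scope.

(* The library's algType requires 1 != 0; the algebras below may be zero. *)
Record kalgebra (k : comPzRingType) := KAlgebra {
  kmod : lmodType k;
  kmul : kmod -> kmod -> kmod;
  kone : kmod;
  kmulA : associative kmul;
  kmul1x : left_id kone kmul;
  kmulx1 : right_id kone kmul;
  kmul_linl : forall c x y z, kmul (c *: x + y) z = c *: kmul x z + kmul y z;
  kmul_linr : forall c x y z, kmul x (c *: y + z) = c *: kmul x y + kmul x z
}.

Definition kcar (k : comPzRingType) (A : kalgebra k) : Type := kmod A.
Coercion kcar : kalgebra >-> Sortclass.

Section KAlgebraTheory.
Variables (k : comPzRingType) (A : kalgebra k).

HB.instance Definition _ := GRing.Lmodule.copy (kcar A) (kmod A).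

Fact kmulDl : left_distributive (@kmul k A) +%R.
Proof. by move=> x y z; have := kmul_linl 1 x y z; rewrite !scale1r. Qed.
Fact kmulDr : right_distributive (@kmul k A) +%R.
Proof. by move=> x y z; have := kmul_linr 1 x y z; rewrite !scale1r. Qed.

HB.instance Definition _ := GRing.Zmodule_isPzRing.Build (kcar A)
  (@kmulA k A) (@kmul1x k A) (@kmulx1 k A) kmulDl kmulDr.

Lemma kscalerAl (c : k) (x y : A) : c *: (x * y) = (c *: x) * y.
Proof.
have := kmul_linl c x 0 y; rewrite !addr0 [kmul 0 y](mul0r (y : A)) addr0.
exact: esym.
Qed.
Lemma kscalerAr (c : k) (x y : A) : c *: (x * y) = x * (c *: y).
Proof.
have := kmul_linr c x y 0; rewrite !addr0 [kmul x 0](mulr0 (x : A)) addr0.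
exact: esym.
Qed.

End KAlgebraTheory.

Section OfAlgType.
Variables (k : comPzRingType) (A : algType k).
Fact alg_linl (c : k) (x y z : A) : (c *: x + y) * z = c *: (x * z) + y * z.
Proof. by rewrite mulrDl scalerAl. Qed.
Fact alg_linr (c : k) (x y z : A) : x * (c *: y + z) = c *: (x * y) + x * z.
Proof. by rewrite mulrDr scalerAr. Qed.
Definition kalgebra_of_alg : kalgebra k :=
  KAlgebra (@mulrA A) (@mul1r A) (@mulr1 A) alg_linl alg_linr.
End OfAlgType.

Section TensorPower.
Context {k : comPzRingType}.

Section Module.
Variable A : kalgebra k.

Definition upd n (x : {ffun 'I_n -> A}) (i : 'I_n) (a : A) : {ffun 'I_n -> A} :=
  [ffun j => if j == i then a else x j].

Definition multilinear n (M : lmodType k) (f : {ffun 'I_n -> A} -> M) :=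
  forall x i c a b, f (upd x i (c *: a + b)) = c *: f (upd x i a) + f (upd x i b).

(* The n-th tensor power over k is the quotient of the formal sums
   \sum c (x_1, ..., x_n) by the congruence tens_rel; for n = 0 there is exactly
   one tuple and the quotient is k (see tpow0_bij). *)
Definition fsum n := seq (k * {ffun 'I_n -> A}).

Inductive tens_rel n : fsum n -> fsum n -> Prop :=
| TensRefl s : tens_rel s s
| TensSym s t : tens_rel s t -> tens_rel t s
| TensTrans s t u : tens_rel s t -> tens_rel t u -> tens_rel s u
| TensCat s s' t t' :
    tens_rel s s' -> tens_rel t t' -> tens_rel (s ++ t) (s' ++ t')
| TensCatC s t : tens_rel (s ++ t) (t ++ s)
| TensCoef0 x : tens_rel [:: (0, x)] [::]
| TensCoefD c d x : tens_rel [:: (c + d, x)] [:: (c, x); (d, x)]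
| TensLin d x i c a b :
    tens_rel [:: (d, upd x i (c *: a + b))]
             [:: (d * c, upd x i a); (d, upd x i b)].

Definition tens_eq n : rel (fsum n) := fun s t => `[< tens_rel s t >].

Fact tens_eq_refl n : reflexive (@tens_eq n).
Proof. by move=> s; apply/asboolP; apply: TensRefl. Qed.
Fact tens_eq_sym n : symmetric (@tens_eq n).
Proof. by move=> s t; apply/asboolP/asboolP; apply: TensSym. Qed.
Fact tens_eq_trans n : transitive (@tens_eq n).
Proof.
by move=> t s u /asboolP st /asboolP tu; apply/asboolP; apply: TensTrans tu.
Qed.

Canonical tens_equiv n :=
  EquivRel (@tens_eq n) (@tens_eq_refl n) (@tens_eq_sym n) (@tens_eq_trans n).

Definition tpow n := {eq_quot (@tens_equiv n)}.
HB.instance Definition _ n := Choice.on (tpow n).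
HB.instance Definition _ n := EqQuotient.on (tpow n).

End Module.

Section ModuleTheory.
Variables (A : kalgebra k) (n : nat).
Implicit Types (s t : fsum A n) (u v w : tpow A n).

Local Notation pi := (\pi_(tpow A n)%qT).

Lemma tens_piP s t : tens_rel s t <-> pi s = pi t.
Proof.
by split=> [st|/eqmodP /asboolP //]; apply/eqmodP; apply/asboolP.
Qed.

Definition tscale_fsum (c : k) s : fsum A n := [seq (c * p.1, p.2) | p <- s].

Lemma tscale_rel c s t : tens_rel s t -> tens_rel (tscale_fsum c s) (tscale_fsum c t).
Proof.
elim=> {s t} /=.
- by move=> s; apply: TensRefl.
- by move=> s t _; apply: TensSym.
- by move=> s t u _ st _; apply: TensTrans.
- by move=> s s' t t' _ h1 _ h2; rewrite /tscale_fsum !map_cat; apply: TensCat.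
- by move=> s t; rewrite /tscale_fsum !map_cat; apply: TensCatC.
- by move=> x; rewrite mulr0; apply: TensCoef0.
- by move=> a b x; rewrite mulrDr; apply: TensCoefD.
- by move=> d x i c' a b; rewrite mulrA; apply: TensLin.
Qed.

Definition tadd u v : tpow A n := pi (repr u ++ repr v).
Definition tscale c u : tpow A n := pi (tscale_fsum c (repr u)).
Definition topp u : tpow A n := tscale (-1) u.

Lemma pi_repr_rel s : tens_rel (repr (pi s)) s.
Proof. by apply/tens_piP; rewrite reprK. Qed.

Lemma taddE s t : tadd (pi s) (pi t) = pi (s ++ t).
Proof. by apply/tens_piP; apply: TensCat; apply: pi_repr_rel. Qed.
Lemma tscaleE c s : tscale c (pi s) = pi (tscale_fsum c s).
Proof. by apply/tens_piP; apply: tscale_rel; apply: pi_repr_rel. Qed.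

Lemma pi_ex u : exists s, u = pi s.
Proof. by exists (repr u); rewrite reprK. Qed.

Fact taddA : associative tadd.
Proof.
move=> u v w; case: (pi_ex u) (pi_ex v) (pi_ex w) => s -> [t ->] [r ->].
by rewrite (taddE t r) (taddE s t) !taddE catA.
Qed.
Fact taddC : commutative tadd.
Proof.
move=> u v; case: (pi_ex u) (pi_ex v) => s -> [t ->].
by rewrite (taddE s t) (taddE t s); apply/tens_piP; apply: TensCatC.
Qed.
Fact tadd0 : left_id (pi [::]) tadd.
Proof. by move=> u; case: (pi_ex u) => s ->; rewrite taddE. Qed.

Lemma tscaleDl_sub s a b :
  tens_rel (tscale_fsum (a + b) s) (tscale_fsum a s ++ tscale_fsum b s).
Proof.
elim: s => [|[c x] s IH] /=; first exact: TensRefl.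
apply: (@TensTrans _ _ _ ([:: (a * c, x); (b * c, x)] ++
         (tscale_fsum a s ++ tscale_fsum b s))).
  rewrite mulrDl -[_ :: _]/([:: (a * c + b * c, x)] ++ _).
  by apply: TensCat IH; apply: TensCoefD.
apply: (@TensCat _ _ [:: _] [:: _]); first exact: TensRefl.
rewrite -cat1s -[(b * c, x) :: tscale_fsum b s]cat1s !catA.
by apply: TensCat; [exact: TensCatC|exact: TensRefl].
Qed.

Lemma tscale0_sub s : tens_rel (tscale_fsum 0 s) [::].
Proof.
elim: s => [|[c x] s IH] /=; first exact: TensRefl.
rewrite mul0r; apply: (@TensCat _ _ [:: _] [::] _ [::]) => //.
exact: TensCoef0.
Qed.

Fact tscaleDl u : {morph tscale^~ u : a b / a + b >-> tadd a b}.
Proof.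
move=> a b /=; case: (pi_ex u) => s ->.
rewrite (tscaleE a) (tscaleE b) tscaleE taddE; apply/tens_piP.
exact: tscaleDl_sub.
Qed.
Fact tscale0 u : tscale 0 u = pi [::].
Proof. by case: (pi_ex u) => s ->; rewrite tscaleE; apply/tens_piP/tscale0_sub. Qed.
Fact tscale1 : left_id 1 tscale.
Proof.
move=> u; case: (pi_ex u) => s ->; rewrite tscaleE /tscale_fsum; congr (pi _).
by rewrite -[RHS]map_id; apply: eq_map => -[c x] /=; rewrite mul1r.
Qed.
Fact tscaleA a b u : tscale a (tscale b u) = tscale (a * b) u.
Proof.
case: (pi_ex u) => s ->.
rewrite (tscaleE b) !tscaleE /tscale_fsum -map_comp; congr (pi _).
by apply: eq_map => -[c x] /=; rewrite mulrA.
Qed.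
Fact tscaleDr : right_distributive tscale tadd.
Proof.
move=> a u v; case: (pi_ex u) (pi_ex v) => s -> [t ->].
rewrite (tscaleE a s) (tscaleE a t) (taddE s t) tscaleE taddE.
by rewrite /tscale_fsum map_cat.
Qed.
Fact taddN : left_inverse (pi [::]) topp tadd.
Proof.
by move=> u; rewrite -[X in tadd _ X]tscale1 -tscaleDl addNr tscale0.
Qed.

HB.instance Definition _ := GRing.isZmodule.Build (tpow A n)
  taddA taddC tadd0 taddN.
HB.instance Definition _ := GRing.Zmodule_isLmodule.Build k (tpow A n)
  tscaleA tscale1 tscaleDr tscaleDl.

(* x_1 (x) ... (x) x_n *)
Definition pure (x : {ffun 'I_n -> A}) : tpow A n := pi [:: (1, x)].

(* teval f u = \sum f(x_1, ..., x_n) for u = \sum x_1 (x) ... (x) x_n.  It is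
   computed on a chosen representative, and is the linear map induced by f, hence
   independent of the choice, whenever f is multilinear: see teval_linear and
   teval_pure. *)
Definition teval (M : lmodType k) (f : {ffun 'I_n -> A} -> M) u : M :=
  \sum_(p <- repr u) p.1 *: f p.2.

Section Eval.
Variables (M : lmodType k) (f : {ffun 'I_n -> A} -> M).
Hypothesis lin_f : multilinear f.

Lemma teval_rel s t : tens_rel s t ->
  \sum_(p <- s) p.1 *: f p.2 = \sum_(p <- t) p.1 *: f p.2.
Proof.
elim=> {s t} //.
- by move=> s t u _ -> _ ->.
- by move=> s s' t t' _ h1 _ h2; rewrite !big_cat /= h1 h2.
- by move=> s t; rewrite !big_cat /= addrC.
- by move=> x; rewrite big_seq1 big_nil scale0r.
- by move=> c d x; rewrite !big_cons !big_nil !addr0 /= scalerDl.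
- by move=> d x i c a b; rewrite !big_cons !big_nil !addr0 /= lin_f scalerDr scalerA.
Qed.

Lemma teval_pi s : teval f (pi s) = \sum_(p <- s) p.1 *: f p.2.
Proof. by rewrite /teval; apply: teval_rel; apply: pi_repr_rel. Qed.

Lemma teval_pure x : teval f (pure x) = f x.
Proof. by rewrite teval_pi big_seq1 scale1r. Qed.

Lemma teval_linear : linear (teval f).
Proof.
move=> c u v; rewrite -[u]reprK -[v]reprK.
rewrite [c *: _ + _](_ : _ = pi (tscale_fsum c (repr u) ++ repr v)); last first.
  by rewrite -taddE -tscaleE.
rewrite !teval_pi big_cat /= big_map scaler_sumr; congr (_ + _).
by apply: eq_bigr => p _; rewrite scalerA.
Qed.

End Eval.

Lemma pi_sum s : pi s = \sum_(p <- s) p.1 *: pure p.2.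
Proof.
elim: s => [|[c x] s IH]; first by rewrite big_nil.
rewrite big_cons -IH /= -[RHS]/(tadd (tscale c _) _) tscaleE taddE /=.
by rewrite mulr1.
Qed.

Lemma tpow_ind (P : tpow A n -> Prop) :
  P 0 -> (forall c x u, P u -> P (c *: pure x + u)) -> forall u, P u.
Proof.
move=> P0 PD u; rewrite -[u]reprK pi_sum.
by elim: (repr u) => [|p s IH]; rewrite ?big_nil ?big_cons //; apply: PD.
Qed.

Lemma pure_multilinear : multilinear pure.
Proof.
move=> x i c a b; rewrite -[RHS]/(tadd (tscale c _) _) tscaleE taddE /=.
by apply/tens_piP; rewrite mulr1 -[c in X in tens_rel _ X]mul1r; apply: TensLin.
Qed.

Lemma linear_tpow_ext (M : lmodType k) (f g : tpow A n -> M) :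
  linear f -> linear g -> (forall x, f (pure x) = g (pure x)) -> f =1 g.
Proof.
move=> lf lg fg; have f0 : f 0 = 0.
  by have := lf (-1) 0 0; rewrite !scaleN1r oppr0 addr0 addNr.
have g0 : g 0 = 0.
  by have := lg (-1) 0 0; rewrite !scaleN1r oppr0 addr0 addNr.
by elim/tpow_ind => [|c x u IH]; rewrite ?f0 ?g0 // lf lg fg IH.
Qed.

End ModuleTheory.

Section Bilinear.
Variables (A : kalgebra k) (n m : nat) (M : lmodType k).
Variable F : {ffun 'I_n -> A} -> {ffun 'I_m -> A} -> M.

(* \sum F (x_1, ..., x_n) (y_1, ..., y_m) for u = \sum x_1 (x) ... (x) x_n and
   v = \sum y_1 (x) ... (x) y_m. *)
Definition teval2 (u : tpow A n) (v : tpow A m) : M :=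
  teval (fun x => teval (F x) v) u.

Hypothesis lin_l : forall y, multilinear (F^~ y).
Hypothesis lin_r : forall x, multilinear (F x).

Lemma teval_multilinear v : multilinear (fun x => teval (F x) v).
Proof.
move=> x i c a b; rewrite /teval scaler_sumr -big_split /=.
apply: eq_bigr => p _; rewrite lin_l scalerDr !scalerA; congr (_ + _).
by rewrite mulrC.
Qed.

Lemma teval2_pure x y : teval2 (pure x) (pure y) = F x y.
Proof.
by rewrite /teval2 teval_pure ?teval_pure //; apply: teval_multilinear.
Qed.

Lemma teval2_linl v : linear (teval2^~ v).
Proof. by apply: teval_linear; apply: teval_multilinear. Qed.

Lemma teval2_linr u : linear (teval2 u).
Proof.
move=> c v w; rewrite /teval2 /teval -/(teval _).
rewrite scaler_sumr -big_split /=; apply: eq_bigr => p _.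
rewrite -!/(teval _ _) teval_linear // scalerDr !scalerA; congr (_ + _).
by rewrite mulrC.
Qed.

End Bilinear.

Section Algebra.
Variables (A : kalgebra k).

Section Product.
Variable n : nat.
Implicit Types u v w : tpow A n.

Definition pmul (x y : {ffun 'I_n -> A}) : tpow A n :=
  pure [ffun i => x i * y i].

Fact pmul_linl y : multilinear (pmul^~ y).
Proof.
move=> x i c a b; rewrite /pmul.
have E z : [ffun j => upd x i z j * y j] = upd [ffun j => x j * y j] i (z * y i).
  by apply/ffunP => j; rewrite !ffunE; case: eqP => [->|].
by rewrite !E mulrDl -kscalerAl pure_multilinear.
Qed.
Fact pmul_linr x : multilinear (pmul x).
Proof.
move=> y i c a b; rewrite /pmul.
have E z : [ffun j => x j * upd y i z j] = upd [ffun j => x j * y j] i (x i * z).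
  by apply/ffunP => j; rewrite !ffunE; case: eqP => [->|].
by rewrite !E mulrDr -kscalerAr pure_multilinear.
Qed.

Definition tmul : tpow A n -> tpow A n -> tpow A n := teval2 pmul.
Definition tone : tpow A n := pure [ffun=> 1].

Lemma tmul_pure x y : tmul (pure x) (pure y) = pure [ffun i => x i * y i].
Proof. exact: (teval2_pure pmul_linl pmul_linr). Qed.
Lemma tmul_linl v : linear (tmul^~ v).
Proof. exact: (teval2_linl pmul_linl). Qed.
Lemma tmul_linr u : linear (tmul u).
Proof. exact: (teval2_linr pmul_linr). Qed.

Fact tmulA : associative tmul.
Proof.
move=> u v w; move: u; apply: linear_tpow_ext.
- by move=> c u u'; rewrite tmul_linl.
- by move=> c u u'; rewrite !tmul_linl.
move=> x; move: v; apply: linear_tpow_ext.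
- by move=> c u u'; rewrite tmul_linl tmul_linr.
- by move=> c u u'; rewrite tmul_linr tmul_linl.
move=> y; move: w; apply: linear_tpow_ext.
- by move=> c u u'; rewrite !tmul_linr.
- by move=> c u u'; rewrite tmul_linr.
by move=> z; rewrite !tmul_pure; congr pure; apply/ffunP => i; rewrite !ffunE mulrA.
Qed.
Fact tmul1x : left_id tone tmul.
Proof.
apply: linear_tpow_ext => //; first exact: tmul_linr.
by move=> x; rewrite tmul_pure; congr pure; apply/ffunP => i; rewrite !ffunE mul1r.
Qed.
Fact tmulx1 : right_id tone tmul.
Proof.
apply: (linear_tpow_ext (f := tmul^~ tone)) => //; first exact: tmul_linl.
by move=> x; rewrite tmul_pure; congr pure; apply/ffunP => i; rewrite !ffunE mulr1.
Qed.
Fact tmulDl : left_distributive tmul +%R.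
Proof. by move=> u v w; have := tmul_linl w 1 u v; rewrite !scale1r. Qed.
Fact tmulDr : right_distributive tmul +%R.
Proof. by move=> u v w; have := tmul_linr u 1 v w; rewrite !scale1r. Qed.

HB.instance Definition _ := GRing.Zmodule_isPzRing.Build (tpow A n)
  tmulA tmul1x tmulx1 tmulDl tmulDr.

End Product.

(* A^{(x) 0} is k *)
Lemma tpow0_bij : bijective (fun c : k => c *: (1 : tpow A 0)).
Proof.
have lin : multilinear (fun _ : {ffun 'I_0 -> A} => 1 : k^o) by move=> x [].
have eval1 : teval (fun _ : {ffun 'I_0 -> A} => 1 : k^o) (1 : tpow A 0) = 1.
  exact: teval_pure.
have pure1 (x : {ffun 'I_0 -> A}) : pure x = 1 by congr pure; apply/ffunP => -[].
exists (teval (fun _ => 1 : k^o)) => [c|u].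
  have := teval_linear lin c 1 0; rewrite addr0 eval1 => ->.
  have := teval_linear lin 0 0 0; rewrite !scale0r !addr0 => E.
  rewrite (_ : teval _ 0 = 0); first by rewrite addr0 /GRing.scale /= mulr1.
  have := teval_linear lin (-1) 0 0.
  by rewrite scaler0 addr0 scaleN1r addNr.
elim/tpow_ind: u => [|c x u IH].
  have := teval_linear lin (-1) 0 0.
  by rewrite scaler0 addr0 scaleN1r addNr => ->; rewrite scale0r.
rewrite teval_linear // teval_pure // scalerDl IH pure1; congr (_ + _).
by rewrite /GRing.scale /= mulr1.
Qed.

(* x_1 (x) ... (x) x_n |-> x_{s(1)} (x) ... (x) x_{s(n)}, i.e. (s^-1)_* *)
Definition tact n (s : 'S_n) (u : tpow A n) : tpow A n :=
  teval (fun x => pure [ffun i => x (s i)]) u.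

Lemma tact_multilinear n (s : 'S_n) :
  multilinear (fun x : {ffun 'I_n -> A} => pure [ffun i => x (s i)]).
Proof.
move=> x i c a b.
have E z : [ffun j => upd x i z (s j)] = upd [ffun j => x (s j)] (s^-1%g i) z.
  by apply/ffunP => j; rewrite !ffunE -(inj_eq (@perm_inj _ s) j) permKV.
by rewrite !E pure_multilinear.
Qed.

Definition pcat n m (x : {ffun 'I_n -> A}) (y : {ffun 'I_m -> A}) :
    {ffun 'I_(n + m) -> A} :=
  [ffun i => match split i with inl j => x j | inr j => y j end].

Lemma pcat_updl n m (x : {ffun 'I_n -> A}) (y : {ffun 'I_m -> A}) i z :
  pcat (upd x i z) y = upd (pcat x y) (lshift m i) z.
Proof.
by apply/ffunP => l; rewrite !ffunE; case: split_ordP => j ->;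
  rewrite ?ffunE eq_shift.
Qed.
Lemma pcat_updr n m (x : {ffun 'I_n -> A}) (y : {ffun 'I_m -> A}) i z :
  pcat x (upd y i z) = upd (pcat x y) (rshift n i) z.
Proof.
by apply/ffunP => l; rewrite !ffunE; case: split_ordP => j ->;
  rewrite ?ffunE eq_shift.
Qed.

Definition ttens n m (u : tpow A n) (v : tpow A m) : tpow A (n + m) :=
  teval2 (fun x y => pure (pcat x y)) u v.

Fact ttens_linl_sub n m (y : {ffun 'I_m -> A}) :
  multilinear (fun x : {ffun 'I_n -> A} => pure (pcat x y)).
Proof. by move=> x i c a b; rewrite !pcat_updl pure_multilinear. Qed.
Fact ttens_linr_sub n m (x : {ffun 'I_n -> A}) :
  multilinear (fun y : {ffun 'I_m -> A} => pure (pcat x y)).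
Proof. by move=> y i c a b; rewrite !pcat_updr pure_multilinear. Qed.

Lemma ttens_pure n m (x : {ffun 'I_n -> A}) (y : {ffun 'I_m -> A}) :
  ttens (pure x) (pure y) = pure (pcat x y).
Proof. exact: (teval2_pure (@ttens_linl_sub n m) (@ttens_linr_sub n m)). Qed.
Lemma ttens_linl n m (v : tpow A m) : linear (@ttens n m ^~ v).
Proof. exact: (teval2_linl (@ttens_linl_sub n m)). Qed.
Lemma ttens_linr n m (u : tpow A n) : linear (@ttens n m u).
Proof. exact: (teval2_linr (@ttens_linr_sub n m)). Qed.

(* tensoring with an element of A^{(x) 0} = k is scaling *)
Lemma ttens_scalarl n (c : k) (u : tpow A n) : ttens (c *: (1 : tpow A 0)) u = c *: u.
Proof.
have lin0 v : ttens (0 : tpow A 0) v = 0 :> tpow A n.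
  have := ttens_linl v (-1) (0 : tpow A 0) 0.
  by rewrite scaler0 addr0 scaleN1r addNr.
have E v : ttens (1 : tpow A 0) v = v :> tpow A n.
  move: v; apply: linear_tpow_ext => //; first exact: (@ttens_linr 0 n).
  move=> x; rewrite ttens_pure; congr pure; apply/ffunP => i; rewrite ffunE.
  by case: split_ordP => -[] // j lj ->; congr (x _); apply: val_inj.
by have /= := ttens_linl u c (1 : tpow A 0) 0; rewrite addr0 lin0 addr0 E.
Qed.
Lemma ttens_scalarr n (c : k) (u : tpow A n) :
  ecast p (tpow A p) (addn0 n) (ttens u (c *: (1 : tpow A 0))) = c *: u.
Proof.
have castl p (e : (n + 0 = p)%N) : linear (fun v => ecast p (tpow A p) e v).
  by case: p / e.
have cast0 p (e : (n + 0 = p)%N) : ecast p (tpow A p) e 0 = 0.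
  by case: p / e.
have lin0 v : ttens v (0 : tpow A 0) = 0.
  have := ttens_linr v (-1) (0 : tpow A 0) 0.
  by rewrite scaler0 addr0 scaleN1r addNr.
have E v : ecast p (tpow A p) (addn0 n) (ttens v (1 : tpow A 0)) = v.
  move: v; apply: linear_tpow_ext => //.
    by move=> d v w; rewrite (@ttens_linl n 0) castl.
  move=> x; rewrite ttens_pure.
  have castp p (e : (n + 0 = p)%N) (z : {ffun 'I_(n + 0) -> A}) :
     ecast p (tpow A p) e (pure z) = pure [ffun i => z (cast_ord (esym e) i)].
    case: p / e => /=; congr pure; apply/ffunP => i; rewrite ffunE; congr (z _).
    exact: val_inj.
  rewrite castp; congr pure; apply/ffunP => i; rewrite !ffunE.
  case: split_ordP => -[j lj] //= /(congr1 val) /= E.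
  by congr (x _); apply: val_inj.
have := ttens_linr u c (1 : tpow A 0) 0; rewrite addr0 lin0 addr0 => ->.
by rewrite -[c *: ttens _ _]addr0 castl E cast0 addr0.
Qed.

End Algebra.
End TensorPower.

(* Strict balanced monoidal categories.  The objects Ob, the hom-sets Hom, the
   unit I and the product T of objects are parameters; strictness on morphisms
   is expressed by transport along the equalities of objects. *)
Section Categories.
Variables (Ob : Type) (Hom : Ob -> Ob -> Type).

Definition castH X X' Y Y' (eX : X = X') (eY : Y = Y') (f : Hom X Y) :
    Hom X' Y' :=
  ecast Z (Hom X' Z) eY (ecast Z (Hom Z Y) eX f).

Record category := Category {
  idm : forall X, Hom X X;
  comp : forall X Y Z, Hom Y Z -> Hom X Y -> Hom X Z;
  comp1m : forall X Y (f : Hom X Y), comp (idm Y) f = f;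
  compm1 : forall X Y (f : Hom X Y), comp f (idm X) = f;
  compA : forall X Y Z W (h : Hom Z W) (g : Hom Y Z) (f : Hom X Y),
    comp h (comp g f) = comp (comp h g) f
}.
Arguments comp c {X Y Z} g f.

Variables (I : Ob) (T : Ob -> Ob -> Ob).

Record monoidal := Monoidal {
  mon_cat :> category;
  tensm : forall X X' Y Y', Hom X Y -> Hom X' Y' -> Hom (T X X') (T Y Y');
  tensA : forall X Y Z, T X (T Y Z) = T (T X Y) Z;
  tensIo : forall X, T I X = X;
  tensoI : forall X, T X I = X;
  tensm_id : forall X Y, tensm (idm mon_cat X) (idm mon_cat Y) = idm mon_cat (T X Y);
  tensm_comp : forall X Y Z X' Y' Z'
      (g : Hom Y Z) (f : Hom X Y) (g' : Hom Y' Z') (f' : Hom X' Y'),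
    tensm (comp mon_cat g f) (comp mon_cat g' f')
      = comp mon_cat (tensm g g') (tensm f f');
  tensmA : forall X Y Z X' Y' Z' (f : Hom X X') (g : Hom Y Y') (h : Hom Z Z'),
    castH (tensA X Y Z) (tensA X' Y' Z') (tensm f (tensm g h))
      = tensm (tensm f g) h;
  tens1m : forall X Y (f : Hom X Y),
    castH (tensIo X) (tensIo Y) (tensm (idm mon_cat I) f) = f;
  tensm1 : forall X Y (f : Hom X Y),
    castH (tensoI X) (tensoI Y) (tensm f (idm mon_cat I)) = f
}.
Arguments tensm m {X X' Y Y'} f g.

Record balanced := Balanced {
  bal_mon :> monoidal;
  braid : forall X Y, Hom (T X Y) (T Y X);
  braidV : forall X Y, Hom (T Y X) (T X Y);
  braidK : forall X Y, comp bal_mon (braidV X Y) (braid X Y) = idm bal_mon (T X Y);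
  braidVK : forall X Y, comp bal_mon (braid X Y) (braidV X Y) = idm bal_mon (T Y X);
  braid_nat : forall X X' Y Y' (f : Hom X X') (g : Hom Y Y'),
    comp bal_mon (braid X' Y') (tensm bal_mon f g)
      = comp bal_mon (tensm bal_mon g f) (braid X Y);
  braid_tensl : forall X Y Z,
    castH (esym (tensA bal_mon X Y Z)) (tensA bal_mon Z X Y) (braid (T X Y) Z)
      = comp bal_mon (tensm bal_mon (braid X Z) (idm bal_mon Y))
          (castH erefl (tensA bal_mon X Z Y)
             (tensm bal_mon (idm bal_mon X) (braid Y Z)));
  braid_tensr : forall X Y Z,
    castH (tensA bal_mon X Y Z) (esym (tensA bal_mon Y Z X)) (braid X (T Y Z))
      = comp bal_mon (tensm bal_mon (idm bal_mon Y) (braid X Z))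
          (castH erefl (esym (tensA bal_mon Y X Z))
             (tensm bal_mon (braid X Y) (idm bal_mon Z)));
  twist : forall X, Hom X X;
  twistV : forall X, Hom X X;
  twistK : forall X, comp bal_mon (twistV X) (twist X) = idm bal_mon X;
  twistVK : forall X, comp bal_mon (twist X) (twistV X) = idm bal_mon X;
  twist_nat : forall X Y (f : Hom X Y),
    comp bal_mon (twist Y) f = comp bal_mon f (twist X);
  twist_tens : forall X Y,
    twist (T X Y) = comp bal_mon (tensm bal_mon (twist X) (twist Y))
                      (comp bal_mon (braid Y X) (braid X Y))
}.

(* superpose_i C f g are the right-hand sides, before taking the trace, of the
   superposing axioms: (id (x) tau^-1_{Y2,U}) (f (x) g) (id (x) tau_{X2,U}) and
   (id (x) tau_{U,Y2}) (f (x) g) (id (x) tau^-1_{U,X2}). *)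
Section Superpose.
Variables (C : balanced) (X1 Y1 X2 Y2 U : Ob).
Variables (f : Hom (T X1 U) (T Y1 U)) (g : Hom X2 Y2).

Definition superpose_mid : Hom (T X1 (T U X2)) (T Y1 (T U Y2)) :=
  castH (esym (tensA C X1 U X2)) (esym (tensA C Y1 U Y2)) (tensm C f g).

Definition superpose1 : Hom (T (T X1 X2) U) (T (T Y1 Y2) U) :=
  castH (tensA C X1 X2 U) (tensA C Y1 Y2 U)
    (comp C (tensm C (idm C Y1) (braidV C Y2 U))
       (comp C superpose_mid (tensm C (idm C X1) (braid C X2 U)))).

Definition superpose2 : Hom (T (T X1 X2) U) (T (T Y1 Y2) U) :=
  castH (tensA C X1 X2 U) (tensA C Y1 Y2 U)
    (comp C (tensm C (idm C Y1) (braid C U Y2))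
       (comp C superpose_mid (tensm C (idm C X1) (braidV C U X2)))).
End Superpose.

Record traced := Traced {
  trc_bal :> balanced;
  trc : forall X Y U, Hom (T X U) (T Y U) -> Hom X Y;
  trc_nat : forall X X' Y Y' U (u : Hom X' X) (v : Hom Y Y')
      (f : Hom (T X U) (T Y U)),
    trc (comp trc_bal (tensm trc_bal v (idm trc_bal U))
           (comp trc_bal f (tensm trc_bal u (idm trc_bal U))))
      = comp trc_bal v (comp trc_bal (trc f) u);
  trc_slide : forall X Y U V (u : Hom V U) (f : Hom (T X U) (T Y V)),
    trc (comp trc_bal (tensm trc_bal (idm trc_bal Y) u) f)
      = trc (comp trc_bal f (tensm trc_bal (idm trc_bal X) u));
  trc_unit : forall X Y (f : Hom (T X I) (T Y I)),
    trc f = castH (tensoI trc_bal X) (tensoI trc_bal Y) f;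
  trc_tens : forall X Y U V (g : Hom (T X (T U V)) (T Y (T U V))),
    trc g = trc (trc (castH (tensA trc_bal X U V) (tensA trc_bal Y U V) g));
  trc_superpose1 : forall X1 Y1 X2 Y2 U (f : Hom (T X1 U) (T Y1 U)) (g : Hom X2 Y2),
    tensm trc_bal (trc f) g = trc (superpose1 trc_bal f g);
  trc_superpose2 : forall X1 Y1 X2 Y2 U (f : Hom (T X1 U) (T Y1 U)) (g : Hom X2 Y2),
    tensm trc_bal (trc f) g = trc (superpose2 trc_bal f g);
  trc_braid : forall U, trc (braid trc_bal U U) = twist trc_bal U;
  trc_braidV : forall U, trc (braidV trc_bal U U) = twistV trc_bal U
}.

End Categories.

Arguments comp {Ob Hom} c {X Y Z} g f.
Arguments tensm {Ob Hom I T} m {X X' Y Y'} f g.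
Arguments trc {Ob Hom I T} t {X Y U} f.

(* Strict monoidal functors preserving braiding and twist. *)
Record balanced_functor (Ob Ob' : Type)
    (Hom : Ob -> Ob -> Type) (Hom' : Ob' -> Ob' -> Type)
    (I : Ob) (I' : Ob') (T : Ob -> Ob -> Ob) (T' : Ob' -> Ob' -> Ob')
    (C : balanced Hom I T) (D : balanced Hom' I' T') (F : Ob -> Ob') :=
  BalancedFunctor {
  fmor : forall X Y, Hom X Y -> Hom' (F X) (F Y);
  fun_unit : F I = I';
  fun_tens : forall X Y, F (T X Y) = T' (F X) (F Y);
  fmor_id : forall X, fmor (idm C X) = idm D (F X);
  fmor_comp : forall X Y Z (g : Hom Y Z) (f : Hom X Y),
    fmor (comp C g f) = comp D (fmor g) (fmor f);
  fmor_tens : forall X X' Y Y' (f : Hom X Y) (g : Hom X' Y'),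
    castH (fun_tens X X') (fun_tens Y Y') (fmor (tensm C f g))
      = tensm D (fmor f) (fmor g);
  fmor_braid : forall X Y,
    castH (fun_tens X Y) (fun_tens Y X) (fmor (braid C X Y))
      = braid D (F X) (F Y);
  fmor_twist : forall X, fmor (twist C X) = twist D (F X)
}.
Arguments fmor {Ob Ob' Hom Hom' I I' T T' C D F} b {X Y} f.

(* The category of symmetric groups.  In the library (s * t)%g is "s, then t". *)
Section Permutations.
Local Open Scope nat_scope.

Definition block_fun n m (s : 'S_n) (t : 'S_m) (i : 'I_(n + m)) : 'I_(n + m) :=
  match split i with inl j => lshift m (s j) | inr j => rshift n (t j) end.
Fact block_fun_inj n m (s : 'S_n) (t : 'S_m) : injective (block_fun s t).
Proof.
apply: (can_inj (g := block_fun s^-1%g t^-1%g)) => i; rewrite /block_fun.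
case: (split_ordP i) => j ->; case: split_ordP => l /eqP.
- by rewrite eq_shift => /eqP <-; rewrite permK.
- by rewrite eq_shift.
- by rewrite eq_shift.
- by rewrite eq_shift => /eqP <-; rewrite permK.
Qed.
Definition block n m (s : 'S_n) (t : 'S_m) : 'S_(n + m) :=
  perm (@block_fun_inj n m s t).

(* i |-> i + m mod n + m *)
Definition swap_fun n m (i : 'I_(n + m)) : 'I_(n + m) :=
  cast_ord (addnC m n)
    (match split i with inl j => rshift m j | inr j => lshift n j end).
Fact swap_fun_inj n m : injective (@swap_fun n m).
Proof.
apply: (can_inj (g := fun i => match split (cast_ord (addnC n m) i) with
  inl j => rshift n j | inr j => lshift m j end)) => i.
rewrite /swap_fun cast_ord_comp cast_ord_id.
case: (split_ordP i) => j ->;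
  case: split_ordP => l /eqP; rewrite eq_shift //; by move/eqP->.
Qed.
Definition swap n m : 'S_(n + m) := perm (@swap_fun_inj n m).

Definition symHom (n m : nat) : Type := {s : 'S_n | n = m}.

Definition sym_id n : symHom n n := exist _ 1%g erefl.
Definition sym_comp n m p (g : symHom m p) (f : symHom n m) : symHom n p :=
  exist _ (sval f * cast_perm (esym (svalP f)) (sval g))%g
    (etrans (svalP f) (svalP g)).
Definition sym_tens n n' m m' (f : symHom n m) (g : symHom n' m') :
    symHom (n + n') (m + m') :=
  exist _ (block (sval f) (sval g)) (congr2 addn (svalP f) (svalP g)).
Definition sym_braid n m : symHom (n + m) (m + n) :=
  exist _ (swap n m) (addnC n m).
Definition sym_braidV n m : symHom (m + n) (n + m) :=
  exist _ (swap m n) (addnC m n).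

(* s, as a function on nat that fixes every i >= n *)
Definition perm_nat n (s : 'S_n) (i : nat) : nat := if insub i is Some j then s j else i.

Lemma pnE n (s : 'S_n) (i : 'I_n) : perm_nat s i = s i.
Proof. by rewrite /perm_nat valK. Qed.
Lemma pn_out n (s : 'S_n) i : n <= i -> perm_nat s i = i.
Proof. by move=> le; rewrite /perm_nat insubF // ltnNge le. Qed.
Lemma pn_lt n (s : 'S_n) i : (perm_nat s i < n) = (i < n).
Proof.
case: (ltnP i n) => [lt|le]; last by rewrite pn_out // ltnNge le.
by rewrite -[i]/(val (Ordinal lt)) pnE ltn_ord.
Qed.
Lemma pn_inj n (s t : 'S_n) : perm_nat s =1 perm_nat t -> s = t.
Proof.
by move=> st; apply/permP => i; apply: val_inj; rewrite /= -!pnE st.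
Qed.
Lemma pn1 n i : perm_nat (1%g : 'S_n) i = i.
Proof.
case: (ltnP i n) => [lt|le]; last by rewrite pn_out.
by rewrite -[i in LHS]/(val (Ordinal lt)) pnE perm1.
Qed.
Lemma pnM n (s t : 'S_n) i : perm_nat (s * t)%g i = perm_nat t (perm_nat s i).
Proof.
case: (ltnP i n) => [lt|le]; last by rewrite !pn_out.
by rewrite -[i]/(val (Ordinal lt)) !pnE permM.
Qed.
Lemma pn_cast n m (e : n = m) (s : 'S_n) : perm_nat (cast_perm e s) =1 perm_nat s.
Proof. by case: m / e => i; rewrite cast_perm_id. Qed.
Lemma pn_block n m (s : 'S_n) (t : 'S_m) i :
  perm_nat (block s t) i = if i < n then perm_nat s i else n + perm_nat t (i - n).
Proof.
case: (ltnP i (n + m)) => [lt|le]; last first.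
  have nle : n <= i by apply: leq_trans le; apply: leq_addr.
  by rewrite !pn_out ?[i < n]ltnNge ?nle //= ?subnKC // leq_subRL.
rewrite -[i in LHS]/(val (Ordinal lt)) pnE permE /block_fun.
case: split_ordP => j /(congr1 val) /= ->.
  by rewrite ltn_ord pnE.
by rewrite ltnNge leq_addr /= addKn pnE.
Qed.
Lemma pn_swap n m i : perm_nat (swap n m) i =
  if i < n then i + m else if i < n + m then i - n else i.
Proof.
case: (ltnP i (n + m)) => [lt|le]; last first.
  have nle : n <= i by apply: leq_trans le; apply: leq_addr.
  by rewrite pn_out // ltnNge nle.
rewrite -[i in LHS]/(val (Ordinal lt)) pnE permE /swap_fun /=.
case: split_ordP => j /(congr1 val) /= ->.
  by rewrite ltn_ord addnC.
by rewrite ltnNge leq_addr /= addKn.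
Qed.

Lemma symHom_eq n m (f g : symHom n m) : perm_nat (sval f) =1 perm_nat (sval g) -> f = g.
Proof.
case: f g => s e [t e'] /= /pn_inj st; subst t; congr exist; exact: eq_irrelevance.
Qed.
Lemma pn_castH n n' m m' (e : n = n') (e' : m = m') (f : symHom n m) :
  perm_nat (sval (castH e e' f)) =1 perm_nat (sval f).
Proof. by case: n' / e; case: m' / e'. Qed.
Lemma pn_comp n m p (g : symHom m p) (f : symHom n m) i :
  perm_nat (sval (sym_comp g f)) i = perm_nat (sval g) (perm_nat (sval f) i).
Proof. by rewrite pnM pn_cast. Qed.

Definition pnlt n (s : 'S_n) i (lt : i < n) : perm_nat s i < n :=
  etrans (pn_lt s i) lt.

Definition sym_category : category symHom.
Proof.
refine (@Category _ _ sym_id sym_comp _ _ _).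
- by move=> n m f; apply: symHom_eq => i; rewrite pn_comp pn1.
- by move=> n m f; apply: symHom_eq => i; rewrite pn_comp pn1.
- by move=> n m p q h g f; apply: symHom_eq => i; rewrite !pn_comp.
Defined.

Definition sym_monoidal : monoidal symHom 0 addn.
Proof.
refine (@Monoidal _ _ _ _ sym_category sym_tens addnA add0n addn0 _ _ _ _ _).
- move=> n m; apply: symHom_eq => i /=; rewrite pn_block !pn1.
  by case: ltnP => // le; rewrite subnKC.
- move=> n m p n' m' p' g f g' f'; apply: symHom_eq => i.
  rewrite pn_comp /= !pn_block !pnM !pn_cast.
  case: f => f /= enm; move: g; case: m / enm => g.
  case: (ltnP i n) => [lt|le]; first by rewrite pn_lt lt.
  by rewrite ltnNge leq_addr addKn.
- move=> n m p n' m' p' f g h; apply: symHom_eq => i.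
  rewrite pn_castH /= !pn_block.
  case: (ltnP i n) => [lt|le]; first by rewrite ltn_addr.
  by rewrite ltn_subLR //; case: ltnP => //; rewrite subnDA addnA.
- move=> n m f; apply: symHom_eq => i; rewrite pn_castH /= pn_block /= subn0.
  by rewrite add0n.
- move=> n m f; apply: symHom_eq => i; rewrite pn_castH /= pn_block pn1.
  by case: ltnP => // le; rewrite subnKC // pn_out.
Defined.

Lemma swapK n m i : perm_nat (swap m n) (perm_nat (swap n m) i) = i.
Proof.
rewrite !pn_swap; case: (ltnP i n) => ?; case: (ltnP i (n + m)) => ?;
  by do ?[case: ltnP => ?]; lia.
Qed.

Definition sym_balanced : balanced symHom 0 addn.
Proof.
refine (@Balanced _ _ _ _ sym_monoidal sym_braid sym_braidV _ _ _ _ _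
  sym_id sym_id _ _ _ _).
- by move=> n m; apply: symHom_eq => i; rewrite pn_comp /= swapK pn1.
- by move=> n m; apply: symHom_eq => i; rewrite pn_comp /= swapK pn1.
- move=> n n' m m' [s e] [t e']; case: n' / e; case: m' / e'.
  apply: symHom_eq => i; rewrite !pn_comp /= !pn_swap !pn_block.
  have [slt sge] := (@pn_lt n s i, @pn_out n s i).
  have [tlt tge] := (@pn_lt m t (i - n), @pn_out m t (i - n)).
  have [tge' sge'] := (@pn_out m t i, @pn_out n s (i - m)).
  case: (ltnP i n) => [lt|le].
    by rewrite slt lt addnK; case: ltnP => ?; lia.
  rewrite [n + _ < n]ltnNge leq_addr /= ltn_add2l tlt addKn.
  case: (ltnP i (n + m)) => [lt|le2].
    have lt' : i - n < m by lia.
    by rewrite lt'.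
  have le' : m <= i - n by lia.
  by rewrite ltnNge le' /= ltnNge (leq_trans _ le2) ?leq_addl //= sge' ?tge //; lia.
- move=> n m p; apply: symHom_eq => i.
  rewrite pn_castH !pn_comp pn_castH /= !pn_block !pn1 !pn_swap.
  case: (ltnP i n) => ?; case: (ltnP i (n + m)) => ?;
    case: (ltnP i (n + m + p)) => ?; case: (ltnP (i - n) m) => ?;
    case: (ltnP (i - n) (m + p)) => ?; by do ?[case: ltnP => ?]; lia.
- move=> n m p; apply: symHom_eq => i.
  rewrite pn_castH !pn_comp pn_castH /= !pn_block !pn1 !pn_swap.
  case: (ltnP i n) => ?; case: (ltnP i (n + m)) => ?;
    case: (ltnP i (n + m + p)) => ?; case: (ltnP (i - n) m) => ?;
    case: (ltnP (i - n) (m + p)) => ?; by do ?[case: ltnP => ?]; lia.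
- by move=> n; apply: symHom_eq => i; rewrite pn_comp !pn1.
- by move=> n; apply: symHom_eq => i; rewrite pn_comp !pn1.
- by move=> n m f; apply: symHom_eq => i; rewrite !pn_comp !pn1.
- move=> n m; apply: symHom_eq => i; rewrite !pn_comp /= swapK pn_block !pn1.
  by case: ltnP => // le; rewrite subnKC.
Defined.

End Permutations.

(* No cycle of s of length at most m, fixed points included, consists only of
   elements of {n, ..., n + m - 1} (numbering from 0). *)
Definition admissible n m (s : 'S_(n + m)) : bool :=
  [forall c in porbits s,
     ~~ ((c \subset [set rshift n j | j : 'I_m]) && (#|c| <= m)%N)].

Section OpenTraced.
Variables (Ob : Type) (Hom : Ob -> Ob -> Type).
Variables (I : Ob) (T : Ob -> Ob -> Ob) (P0 : Ob -> nat).

Definition admissible_hom (C : balanced Hom I T)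
    (P : balanced_functor C sym_balanced P0) X Y U
    (f : Hom (T X U) (T Y U)) : bool :=
  admissible (cast_perm (fun_tens P X U) (sval (fmor P f))).

(* The open trace is a partial operation; None means undefined.  Hence
   otr_slide says that both sides are undefined or both are defined and equal,
   and the other axioms include that their right-hand sides are defined. *)
Record open_traced := OpenTraced {
  otr_bal :> balanced Hom I T;
  otr_fun : balanced_functor otr_bal sym_balanced P0;
  otr : forall X Y U, Hom (T X U) (T Y U) -> option (Hom X Y);
  otr_dom : forall X Y U (f : Hom (T X U) (T Y U)),
    isSome (otr f) = admissible_hom otr_fun f;
  otr_nat : forall X X' Y Y' U (u : Hom X' X) (v : Hom Y Y')
      (f : Hom (T X U) (T Y U)),
    admissible_hom otr_fun f ->
    otr (comp otr_bal (tensm otr_bal v (idm otr_bal U))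
           (comp otr_bal f (tensm otr_bal u (idm otr_bal U))))
      = omap (fun h => comp otr_bal v (comp otr_bal h u)) (otr f);
  otr_slide : forall X Y U V (u : Hom V U) (f : Hom (T X U) (T Y V)),
    otr (comp otr_bal (tensm otr_bal (idm otr_bal Y) u) f)
      = otr (comp otr_bal f (tensm otr_bal (idm otr_bal X) u));
  otr_unit : forall X Y (f : Hom (T X I) (T Y I)),
    otr f = Some (castH (tensoI otr_bal X) (tensoI otr_bal Y) f);
  otr_tens : forall X Y U V (g : Hom (T X (T U V)) (T Y (T U V))),
    admissible_hom otr_fun g ->
    otr g = obind (@otr X Y U)
              (otr (castH (tensA otr_bal X U V) (tensA otr_bal Y U V) g));
  otr_superpose1 : forall X1 Y1 X2 Y2 U (f : Hom (T X1 U) (T Y1 U)) (g : Hom X2 Y2),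
    admissible_hom otr_fun f ->
    omap (fun h => tensm otr_bal h g) (otr f) = otr (superpose1 otr_bal f g);
  otr_superpose2 : forall X1 Y1 X2 Y2 U (f : Hom (T X1 U) (T Y1 U)) (g : Hom X2 Y2),
    admissible_hom otr_fun f ->
    omap (fun h => tensm otr_bal h g) (otr f) = otr (superpose2 otr_bal f g);
  otr_braid : forall U, otr (braid otr_bal U U) = Some (twist otr_bal U);
  otr_braidV : forall U, otr (braidV otr_bal U U) = Some (twistV otr_bal U)
}.
End OpenTraced.
Arguments otr {Ob Hom I T P0} o {X Y U} f.

Section XCAlgebras.
Variables (k : comPzRingType) (A : kalgebra k).

Definition pair2 (a b : A) : {ffun 'I_2 -> A} :=
  [ffun i => if i == ord0 then a else b].

(* a (x) b *)
Definition pure2 (a b : A) : tpow A 2 := pure (pair2 a b).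

(* \sum f a b for u = \sum a (x) b *)
Definition tsum2 (M : lmodType k) (f : A -> A -> M) (u : tpow A 2) : M :=
  teval (fun x => f (x ord0) (x ord_max)) u.

Lemma tsum2_pure2 (M : lmodType k) (f : A -> A -> M) :
  (forall b, linear (f^~ b)) -> (forall a, linear (f a)) ->
  linear (tsum2 f) /\ forall a b, tsum2 f (pure2 a b) = f a b.
Proof.
move=> fl fr.
have lin : multilinear (fun x : {ffun 'I_2 -> A} => f (x ord0) (x ord_max)).
  move=> x i c a b; rewrite !ffunE.
  by case: i => -[|[|//]] hi; rewrite -!val_eqE /= ?fl ?fr.
split; first exact: teval_linear.
by move=> a b; rewrite /tsum2 teval_pure // !ffunE.
Qed.

(* u |-> u_{ij}: u in the tensor factors i and j, and 1 elsewhere *)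
Definition embed2 n (i j : 'I_n) (u : tpow A 2) : tpow A n :=
  tsum2 (fun a b => pure [ffun l => if l == i then a else if l == j then b else 1]) u.

Lemma embed2_pure2 n (i j : 'I_n) : i != j ->
  linear (embed2 i j) /\ forall a b, embed2 i j (pure2 a b) =
    pure [ffun l => if l == i then a else if l == j then b else 1].
Proof.
move=> ij; apply: tsum2_pure2 => [b|a] c y z.
  have E w : [ffun l => if l == i then w else if l == j then b else 1] =
     upd [ffun l => if l == j then b else 1] i w.
    by apply/ffunP => l; rewrite !ffunE.
  by rewrite !E pure_multilinear.
have E w : [ffun l => if l == i then a else if l == j then w else 1] =
    upd [ffun l => if l == i then a else 1] j w.
  apply/ffunP => l; rewrite !ffunE; case: (l =P i) => // ->.
  by rewrite (negbTE ij).
by rewrite !E pure_multilinear.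
Qed.

Record XCalgebra := XCAlgebra {
  xcR : tpow A 2;
  xcRV : tpow A 2;
  xck : A;
  xckV : A;
  xcRK : xcR * xcRV = 1;
  xcRVK : xcRV * xcR = 1;
  xckK : xck * xckV = 1;
  xckVK : xckV * xck = 1;
  XC0 : xcR = pure2 xck xck * xcR * pure2 xckV xckV;
  XC0V : xcRV = pure2 xck xck * xcRV * pure2 xckV xckV;
  XC1f : tsum2 (fun a b => b * xck * a) xcR = tsum2 (fun a b => a * xckV * b) xcR;
  XC2c : pure2 1 xckV =
    tsum2 (fun a b => tsum2 (fun a' b' => pure2 (a * a') (b' * xckV * b)) xcRV) xcR;
  XC2d : pure2 xck 1 =
    tsum2 (fun a b => tsum2 (fun a' b' => pure2 (a' * xck * a) (b * b')) xcRV) xcR;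
  XC3 : let R12 : tpow A 3 := embed2 ord0 (inord 1) xcR in
        let R13 : tpow A 3 := embed2 ord0 ord_max xcR in
        let R23 : tpow A 3 := embed2 (inord 1) ord_max xcR in
        R12 * R13 * R23 = R23 * R13 * R12
}.

Definition xcnu (X : XCalgebra) : A := tsum2 (fun a b => a * xckV X * b) (xcR X).

Record traced_XCalgebra := TracedXCAlgebra {
  txc :> XCalgebra;
  xctr : {linear A -> k^o};
  xctrC : forall a b : A, xctr (a * b) = xctr (b * a)
}.

(* The monoid A^{(x) n} x S_n.  The product s t of permutations is "t, then s",
   hence (t * s)%g in the library; for n = 0 the monoid is k. *)
Definition amb (n : nat) : Type := (tpow A n * 'S_n)%type.
Definition amb1 n : amb n := (1, 1%g).
Definition ambM n (f g : amb n) : amb n :=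
  (tact g.2 f.1 * g.1, (g.2 * f.2)%g).
Definition amb_tens n m (f : amb n) (g : amb m) : amb (n + m) :=
  (ttens f.1 g.1, block f.2 g.2).
Definition amb_cast n m (e : n = m) (f : amb n) : amb m := ecast p (amb p) e f.

Inductive submonoid n (S : amb n -> Prop) : amb n -> Prop :=
| submonoid_gen f : S f -> submonoid S f
| submonoid_1 : submonoid S (amb1 n)
| submonoid_M f g : submonoid S f -> submonoid S g -> submonoid S (ambM f g).

(* \hat R_i and its inverse *)
Definition braid_gen (X : XCalgebra) n (f : amb n) : Prop :=
  exists i j : 'I_n, j = i.+1 :> nat /\
    (f = (embed2 i j (xcR X), tperm i j) \/ f = (embed2 j i (xcRV X), tperm i j)).

Definition Jmon (X : XCalgebra) n : amb n -> Prop := submonoid (@braid_gen X n).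

(* The permutation of {1, ..., n} obtained from s by removing n + 1 from its cycle;
   the value in the last resort is never used. *)
Definition cut_fun n (s : 'S_n.+1) (i : 'I_n) : 'I_n :=
  odflt (odflt i (unlift ord_max (s ord_max)))
        (unlift ord_max (s (lift ord_max i))).
Fact cut_fun_inj n (s : 'S_n.+1) : injective (cut_fun s).
Proof.
have P (i : 'I_n) : lift ord_max (cut_fun s i) =
    if s (lift ord_max i) == ord_max then s ord_max else s (lift ord_max i).
  rewrite /cut_fun; case: (unliftP ord_max (s (lift ord_max i))) => [j ->|E] /=.
    by rewrite eq_sym (negbTE (neq_lift _ _)).
  rewrite E eqxx; case: (unliftP ord_max (s ord_max)) => [j -> //|E'].
  by have := neq_lift ord_max i; rewrite -(inj_eq (@perm_inj _ s)) E E' eqxx.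
move=> i j /(congr1 (lift ord_max)); rewrite !P.
have N l : (s ord_max == s (lift ord_max l)) = false.
  by rewrite (inj_eq perm_inj) (negbTE (neq_lift _ _)).
case: eqP => Ei; case: eqP => Ej E.
- by apply: (@lift_inj _ ord_max); apply: (@perm_inj _ s); rewrite Ei Ej.
- by have := N j; rewrite E eqxx.
- by have := N i; rewrite E eqxx.
- by apply: (@lift_inj _ ord_max); apply: (@perm_inj _ s).
Qed.
Definition cut n (s : 'S_n.+1) : 'S_n := perm (@cut_fun_inj n s).

(* x_1 (x) ... (x) x_{n+1} |->
   x_1 (x) ... (x) x_{n+1} kappa x_j (x) ... (x) x_n where s j = n + 1 *)
Definition close_pure (X : XCalgebra) n (s : 'S_n.+1) (x : {ffun 'I_n.+1 -> A}) :
    tpow A n :=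
  pure [ffun i => if s (lift ord_max i) == ord_max
                  then x ord_max * xck X * x (lift ord_max i)
                  else x (lift ord_max i)].

Lemma close_multilinear (X : XCalgebra) n (s : 'S_n.+1) :
  s ord_max != ord_max -> multilinear (close_pure X s).
Proof.
move=> sn; have [j sj] : exists j, s (lift ord_max j) = ord_max.
  case: (unliftP ord_max ((s^-1)%g ord_max)) => [j E|E].
    by exists j; rewrite -E permKV.
  by case/eqP: sn; rewrite -{1}E permKV.
have sjE l : (s (lift ord_max l) == ord_max) = (l == j).
  by rewrite -[X in _ == X]sj (inj_eq perm_inj) (inj_eq (@lift_inj _ _)).
have E x i l z : upd x i z (lift ord_max l) =
    if lift ord_max l == i then z else x (lift ord_max l).
  by rewrite ffunE.
move=> x i c a b; rewrite /close_pure.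
case: (unliftP ord_max i) => [p ->|->].
  pose F (z : A) := if p == j then x ord_max * xck X * z else z.
  have Fl : F (c *: a + b) = c *: F a + F b.
    by rewrite /F; case: eqP => // _; rewrite mulrDr kscalerAr.
  pose y : {ffun 'I_n -> A} := [ffun l => if l == j
     then x ord_max * xck X * x (lift ord_max l) else x (lift ord_max l)].
  have Y z : [ffun i0 => if s (lift ord_max i0) == ord_max
      then upd x (lift ord_max p) z ord_max * xck X
             * upd x (lift ord_max p) z (lift ord_max i0)
      else upd x (lift ord_max p) z (lift ord_max i0)] = upd y p (F z).
    apply/ffunP => l; rewrite !ffunE sjE (inj_eq (@lift_inj _ _)) (negbTE (neq_lift _ _)).
    by rewrite /F; case: (l =P p) => [->|].
  by rewrite !Y Fl pure_multilinear.
pose F (z : A) := z * xck X * x (lift ord_max j).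
have Fl : F (c *: a + b) = c *: F a + F b.
  by rewrite /F !mulrDl -!kscalerAl.
pose y : {ffun 'I_n -> A} := [ffun l => x (lift ord_max l)].
have Y z : [ffun i0 => if s (lift ord_max i0) == ord_max
    then upd x ord_max z ord_max * xck X * upd x ord_max z (lift ord_max i0)
    else upd x ord_max z (lift ord_max i0)] = upd y j (F z).
  apply/ffunP => l; rewrite !ffunE sjE eqxx [lift _ _ == _]eq_sym (negbTE (neq_lift _ _)).
  by rewrite /F; case: (l =P j) => [->|].
by rewrite !Y Fl pure_multilinear.
Qed.

Definition close (X : XCalgebra) n (f : amb n.+1) : amb n :=
  (teval (close_pure X f.2) f.1, cut f.2).

Definition open_phi1 (X : XCalgebra) n (f : amb n.+1) : option (amb n) :=
  if f.2 ord_max == ord_max then None else Some (close X f).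

(* the open closure maps, None meaning undefined *)
Fixpoint open_phi (X : XCalgebra) n m : amb (n + m) -> option (amb n) :=
  match m with
  | 0%N => fun f => Some (amb_cast (addn0 n) f)
  | m'.+1 => fun f =>
      obind (@open_phi X n m') (open_phi1 X (amb_cast (addnS n m') f))
  end.

(* x_1 (x) ... (x) x_{n+1} |-> tr (kappa x_{n+1}) x_1 (x) ... (x) x_n *)
Definition loop_pure (X : traced_XCalgebra) n (x : {ffun 'I_n.+1 -> A}) : tpow A n :=
  (xctr X (xck X * x ord_max) : k) *: pure [ffun i : 'I_n => x (lift ord_max i)].

Lemma loop_multilinear (X : traced_XCalgebra) n : multilinear (@loop_pure X n).
Proof.
move=> x i c a b; rewrite /loop_pure !ffunE.
case: (unliftP ord_max i) => [p ->|->].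
  pose y : {ffun 'I_n -> A} := [ffun l => x (lift ord_max l)].
  have Y z : [ffun l : 'I_n => upd x (lift ord_max p) z (lift ord_max l)] = upd y p z.
    by apply/ffunP => l; rewrite !ffunE (inj_eq (@lift_inj _ _)).
  rewrite !Y (negbTE (neq_lift _ _)) pure_multilinear scalerDr !scalerA.
  by rewrite [c * _]mulrC.
have Y z : [ffun l : 'I_n => upd x ord_max z (lift ord_max l)] =
    [ffun l => x (lift ord_max l)].
  by apply/ffunP => l; rewrite !ffunE eq_sym (negbTE (neq_lift _ _)).
by rewrite !Y eqxx mulrDr -kscalerAr linearP scalerDl scalerA.
Qed.

Definition traced_phi1 (X : traced_XCalgebra) n (f : amb n.+1) : amb n :=
  if f.2 ord_max == ord_max then (teval (@loop_pure X n) f.1, cut f.2)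
  else close X f.

Fixpoint traced_phi (X : traced_XCalgebra) n m : amb (n + m) -> amb n :=
  match m with
  | 0%N => fun f => amb_cast (addn0 n) f
  | m'.+1 => fun f => traced_phi X (traced_phi1 X (amb_cast (addnS n m') f))
  end.

(* The endomorphism monoids, for all n >= 0, with scalars K adjoined.  Since c in
   End(0) acts on End(n) by the tensor product, which is scaling, the closures
   alone cannot generate End(n) when End(0) is all of k: for k = A = Z, R = 1 and
   kappa = 1 they generate the trivial monoid for n = 1.  Taking all scalars for
   K gives End(0) = k (open_I0, traced_I0); taking none gives, for every n, the
   submonoid generated by the closures only. *)
Definition scalar_gen (K : k -> Prop) n (f : amb n) : Prop :=
  exists2 c, K c & f = (c *: (1 : tpow A n), 1%g).

Definition open_I (K : k -> Prop) (X : XCalgebra) n : amb n -> Prop :=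
  submonoid (fun g => scalar_gen K g \/
    exists m (f : amb (n + m)),
      [/\ Jmon X f, admissible f.2 & open_phi X f = Some g]).

Definition traced_I (K : k -> Prop) (X : traced_XCalgebra) n : amb n -> Prop :=
  submonoid (fun g => scalar_gen K g \/
    exists m (f : amb (n + m)), Jmon X f /\ traced_phi X f = g).

(* With K everything, the endomorphisms of 0 are all of k. *)
Lemma submonoid0 (S : amb 0 -> Prop) :
  (forall f, scalar_gen (fun _ => True) f -> S f) -> forall f, submonoid S f.
Proof.
move=> SS [u s]; apply: submonoid_gen; apply: SS.
have [g _ gK] := tpow0_bij A; exists (g u) => //; rewrite gK; congr pair.
by apply/permP => -[].
Qed.
Lemma open_I0 (X : XCalgebra) (f : amb 0) : open_I (fun _ => True) X f.
Proof. by apply: submonoid0 => g ?; left. Qed.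
Lemma traced_I0 (X : traced_XCalgebra) (f : amb 0) : traced_I (fun _ => True) X f.
Proof. by apply: submonoid0 => g ?; left. Qed.

(* Every morphism is an endomorphism, and is an element of A^{(x) n} x S_n. *)
Definition elemHom (E : forall n, amb n -> Prop) (n m : nat) : Type :=
  {f : amb n | n = m /\ E n f}.

(* Only the values on the generating objects are prescribed: the other components
   of the braiding and the twist are forced by braid_tensl, braid_tensr and
   twist_tens. *)
Record elements_balanced (X : XCalgebra) (E : forall n, amb n -> Prop)
    (C : balanced (elemHom E) 0%N addn) : Prop := ElementsBalanced {
  elem_id : forall n, sval (idm C n) = amb1 n;
  elem_comp : forall n (f g : elemHom E n n),
    sval (comp C f g) = ambM (sval f) (sval g);
  elem_tens : forall n m (f : elemHom E n n) (g : elemHom E m m),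
    sval (tensm C f g) = amb_tens (sval f) (sval g);
  elem_braid00 : sval (braid C 0%N 0%N) = amb1 0;
  elem_braid10 : sval (braid C 1%N 0%N) = amb1 1;
  elem_braid01 : sval (braid C 0%N 1%N) = amb1 1;
  elem_braid11 : sval (braid C 1%N 1%N) = (xcR X, tperm ord0 ord_max) :> amb 2;
  elem_twist0 : sval (twist C 0%N) = amb1 0;
  elem_twist1 : sval (twist C 1%N) = (pure [ffun=> xcnu X], 1%g)
}.

Definition open_elements (X : XCalgebra) (E : forall n, amb n -> Prop)
    (C : open_traced (elemHom E) 0%N addn id) : Prop :=
  [/\ elements_balanced X C,
      forall n m (f : elemHom E n m), sval (fmor (otr_fun C) f) = (sval f).2
    & forall n m (f : elemHom E (n + m) (n + m)),
        omap sval (otr C f) =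
          if admissible (sval f).2 then open_phi X (sval f) else None].

Definition traced_elements (X : traced_XCalgebra) (E : forall n, amb n -> Prop)
    (C : traced (elemHom E) 0%N addn) : Prop :=
  elements_balanced X C /\
  forall n m (f : elemHom E (n + m) (n + m)),
    sval (trc C f) = traced_phi X (sval f).

End XCAlgebras.

(* Main.v *)
(* Closing a strand means joining its two ends, with kappa inserted.  On pure
   tensors this can be computed, which gives the axioms of a symmetric partial
   trace for one strand: it is a bimodule map, it commutes with adding strands,
   beads and transpositions slide around the closed strands.  The braiding is
   the transposition decorated with R, and (XC0), (XC2d) say exactly that the
   decorations cancel when a strand is passed over or under a closing one; this
   is the superposing axiom for one strand, and the general one follows by
   induction.  Together with the Yang-Baxter relation (XC3), superposing makes
   the braiding natural with respect to closures of braids.  The twist of n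
   strands is the closure of the last n strands of the braiding of n and n
   strands.  Its naturality and its value on a sum come from naturality of the
   braiding and sliding, and it is inverse to the closure of the inverse
   braiding since this holds for n = 1, by (XC1f) and (XC2d).
   A product of two closures is a closure, by superposing, so that the
   endomorphisms are the scalar multiples of closures of braids and are
   therefore stable under closure.
   The open version is the restriction to admissible permutations of the traced
   one with the zero trace. *)
Require Import Defs.
From HB Require Import structures.
From mathcomp Require Import all_boot all_order all_fingroup all_algebra.
From mathcomp Require Import boolp zify.

Set Implicit Arguments.
Unset Strict Implicit.
Unset Printing Implicit Defensive.

Import GRing.Theory.
Local Open Scope ring_scope.

(** * Placing an element on some of the strands *)

(** The obstacle is bookkeeping: the monoids on n + (m + p) and on n + m + p strands are different
    types, and the strict axioms compare them by transport. Everything is therefore expressed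
    through [emb N p], which places an element among N strands and contains transport as the case p
    = 0. Factors of tensors and points of permutations are indexed by nat, so that identities are
    settled on pure tensors by arithmetic. Crossings carry a sign [e], so that a statement about the
    braiding is proved together with the one about its inverse. Two properties of endomorphisms are
    retained: [natural] (passing through block braidings) and [slides] (moving around closed
    strands). Both hold for crossings and scalars and are stable under products and closures, hence
    hold for all endomorphisms. Both versions of the category come from one construction, in which a
    predicate on permutations says when strands may be closed. It is always true in the traced
    version; in the open version it says that no orbit stays among the closed strands. *)

Section PermNat.
Local Open Scope nat_scope.

Lemma pn_eq n (s t : 'S_n) :
  (forall i, i < n -> perm_nat s i = perm_nat t i) -> s = t.
Proof.
move=> st; apply: pn_inj => i; case: (ltnP i n) => [/st //|le].
by rewrite !pn_out.
Qed.

Lemma pn_injP n (s : 'S_n) : injective (perm_nat s).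
Proof.
by move=> i j /(congr1 (perm_nat (s^-1)%g)); rewrite -!pnM mulgV !pn1.
Qed.

(* meaningful only if h permutes {0, ..., N - 1} *)
Definition permN N (h : nat -> nat) : 'S_N :=
  insubd (1%g : 'S_N) [ffun i : 'I_N => insubd i (h i)].

Lemma pn_permN N (h : nat -> nat) : (forall i, i < N -> h i < N) ->
  (forall i j, i < N -> j < N -> h i = h j -> i = j) ->
  forall i, i < N -> perm_nat (permN N h) i = h i.
Proof.
move=> hN hI i iN; rewrite -[i in LHS]/(val (Ordinal iN)) pnE.
have inj : injectiveb [ffun i : 'I_N => insubd i (h i)].
  apply/injectiveP => a b; rewrite !ffunE => /(congr1 val).
  by rewrite !val_insubd !hN // => /hI e; apply: val_inj; apply: e.
have -> j : (permN N h) j = insubd j (h j).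
  by rewrite -pvalE -[pval _]/(val _) /permN val_insubd inj ffunE.
by rewrite val_insubd hN.
Qed.

Definition elift N p n (s : 'S_n) : 'S_N :=
  permN N (fun i => if p <= i then p + perm_nat s (i - p) else i).

Lemma pn_elift N p n (s : 'S_n) i : p + n <= N ->
  perm_nat (elift N p s) i = if p <= i then p + perm_nat s (i - p) else i.
Proof.
move=> le; case: (ltnP i N) => [lt|ge]; last first.
  by rewrite pn_out //; case: leqP => // pi; rewrite pn_out; lia.
move: i lt; apply: pn_permN => [i iN|i j iN jN].
  case: (leqP p i) => // pi; case: (ltnP (i - p) n) => lt; last by rewrite pn_out //;
    lia.
  by have := pnlt s lt; lia.
case: leqP => pi; case: leqP => pj; try lia.
by move/addnI/pn_injP; lia.
Qed.

Lemma pn_tperm01 i : perm_nat (tperm (ord0 : 'I_2) ord_max) i =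
  if i == 0 then 1 else if i == 1 then 0 else i.
Proof.
case: i => [|[|i]]; last by rewrite pn_out.
- by rewrite -[0 in LHS]/(val (ord0 : 'I_2)) pnE tpermL.
- by rewrite -[1 in LHS]/(val (ord_max : 'I_2)) pnE tpermR.
Qed.

Lemma pn_max n (s : 'S_n.+1) : (s ord_max == ord_max) = (perm_nat s n == n).
Proof. by rewrite -[n in perm_nat s n]/(val (@ord_max n)) pnE -val_eqE. Qed.

Lemma pn_cut n (s : 'S_n.+1) i : i < n ->
  perm_nat (cut s) i = if perm_nat s i == n then perm_nat s n else perm_nat s i.
Proof.
move=> lt; rewrite -[i in LHS]/(val (Ordinal lt)) pnE permE /cut_fun.
have E : i = lift ord_max (Ordinal lt) :> nat by rewrite lift_max.
have := pnE s (lift ord_max (Ordinal lt)); rewrite -E => ->.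
case: (unliftP ord_max (s (lift ord_max _))) => [j ->|E1].
  by rewrite lift_max ltn_eqF.
rewrite E1 eqxx -[n in perm_nat s n]/(val (@ord_max n)) pnE.
case: (unliftP ord_max (s ord_max)) => [j ->|E2].
  by rewrite lift_max.
by have := neq_lift ord_max (Ordinal lt); rewrite -(inj_eq (@perm_inj _ s)) E1 E2 eqxx.
Qed.

End PermNat.

Section Ambient.
Variables (k : comPzRingType) (A : kalgebra k).
Implicit Types (c : k) (a b : A).

Lemma tmul_linDl n (c : k) (u u' v : tpow A n) :
  (c *: u + u') * v = c *: (u * v) + u' * v.
Proof. exact: (@tmul_linl _ A n v c u u'). Qed.
Lemma tmul_linDr n (c : k) (u v v' : tpow A n) :
  u * (c *: v + v') = c *: (u * v) + u * v'.
Proof. exact: (@tmul_linr _ A n u c v v'). Qed.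
Lemma tscalerAl n (c : k) (u v : tpow A n) : c *: u * v = c *: (u * v).
Proof. by have := tmul_linDl c u 0 v; rewrite mul0r !addr0. Qed.
Lemma tscalerAr n (c : k) (u v : tpow A n) : u * (c *: v) = c *: (u * v).
Proof. by have := tmul_linDr c u v 0; rewrite mulr0 !addr0. Qed.

(** Indexing by nat makes moving strands an arithmetic operation on indices, without casts between
    ordinal types. *)
Definition ptens n (x : nat -> A) : tpow A n := pure [ffun i : 'I_n => x i].
(* the factors of a pure tensor indexed by nat, and 1 from n on *)
Definition xget n (x : {ffun 'I_n -> A}) (i : nat) : A := oapp x 1 (insub i).

Lemma xgetE n (x : {ffun 'I_n -> A}) (i : 'I_n) : xget x i = x i.
Proof. by rewrite /xget valK. Qed.
Lemma pure_ptens n (x : {ffun 'I_n -> A}) : pure x = ptens n (xget x).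
Proof. by congr pure; apply/ffunP => i; rewrite !ffunE xgetE. Qed.
Lemma xget_ptens n (x : nat -> A) i : xget [ffun i : 'I_n =>
  x i] i = if (i < n)%N then x i else 1.
Proof. by rewrite /xget; case: insubP => [j -> <-|/negbTE -> //] /=; rewrite ffunE. Qed.
Lemma eq_ptens n (x y : nat -> A) : (forall i,
  (i < n)%N -> x i = y i) -> ptens n x = ptens n y.
Proof. by move=> xy; congr pure; apply/ffunP => i; rewrite !ffunE xy. Qed.
Lemma ptens1 n : ptens n (fun _ => 1) = 1.
Proof. by congr pure; apply/ffunP => i; rewrite !ffunE. Qed.
Lemma ptensM n x y : ptens n x * ptens n y = ptens n (fun i => x i * y i).
Proof.
rewrite /ptens [LHS]tmul_pure; congr pure; apply/ffunP => i; rewrite !ffunE //.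
Qed.

Lemma tact_linear n (s : 'S_n) : linear (@tact k A n s).
Proof. exact: teval_linear (@tact_multilinear _ A n s). Qed.
Lemma tact_ptens n (s : 'S_n) x : tact s (ptens n x) = ptens n (fun i =>
  x (perm_nat s i)).
Proof.
rewrite /ptens /tact teval_pure; last exact: tact_multilinear.
by congr pure; apply/ffunP => i; rewrite !ffunE pnE.
Qed.

(** With the value 0 out of range the map is linear without a side condition, so linearity goals
    never ask where the strands lie. *)
Definition tlift N p n (u : tpow A n) : tpow A N :=
  if (p + n <= N)%N then
    teval (fun x => ptens N (fun i => if (p <= i)%N then xget x (i - p) else 1)) u
  else 0.

Lemma tlift_sub N p n : (p + n <= N)%N -> multilinear (fun x : {ffun 'I_n -> A} =>
  ptens N (fun i => if (p <= i)%N then xget x (i - p) else 1)).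
Proof.
move=> le x i c a b; have lt : (p + i < N)%N by have := ltn_ord i; lia.
pose y := [ffun j : 'I_N => if (p <= j)%N then xget x (j - p) else 1].
have E z : ptens N (fun j => if (p <= j)%N then xget (upd x i z) (j - p) else 1)
    = pure (upd y (Ordinal lt) z).
  congr pure; apply/ffunP => j; rewrite !ffunE -val_eqE /=.
  case: leqP => pj; last by case: eqP => //; lia.
  rewrite /xget; case: insubP => [l lj El|].
    rewrite /= ffunE -val_eqE /= El;
      have -> // : (j - p == i)%N = (j == p + i :> nat)%N.
    by apply/eqP/eqP; lia.
  by rewrite -leqNgt => nj /=; case: eqP => // jE; have := ltn_ord i; lia.
by rewrite !E pure_multilinear.
Qed.

Lemma tlift_linear N p n : linear (@tlift N p n).
Proof.
rewrite /tlift; case le: (p + n <= N)%N; last by move=> c u v /=; rewrite scaler0 addr0.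
exact: teval_linear (tlift_sub le).
Qed.

Lemma tlift_ptens N p n x : (p + n <= N)%N -> tlift N p (ptens n x) =
  ptens N (fun i => if (p <= i < p + n)%N then x (i - p)%N else 1).
Proof.
move=> le; rewrite /tlift le teval_pure; last exact: tlift_sub.
rewrite /=; apply: eq_ptens => i iN; case: (leqP p i) => //= pi.
by rewrite xget_ptens ltn_subLR.
Qed.

(* f on the strands p, ..., p + n - 1 among N, and 0 if these do not exist.  For
   p = 0 and n = N this is transport along n = N, so that no cast is needed. *)
Definition emb N p n (f : amb A n) : amb A N := (tlift N p f.1, elift N p f.2).

(* Identities between such F and G need only be checked on pure tensors. *)
Definition lin_fst (M : lmodType k) N (F : M -> amb A N) :=
  linear (fun u => (F u).1) /\ (forall u v, (F u).2 = (F v).2).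

Lemma amb_ext n N (F G : amb A n -> amb A N) :
  (forall s, lin_fst (fun u : tpow A n => F (u, s))) ->
  (forall s, lin_fst (fun u : tpow A n => G (u, s))) ->
  (forall x s, F (ptens n x, s) = G (ptens n x, s)) -> F =1 G.
Proof.
move=> linF linG FG [u s]; have [F1 F2] := linF s; have [G1 G2] := linG s.
rewrite [LHS]surjective_pairing [RHS]surjective_pairing; congr pair.
  by move: u; apply: linear_tpow_ext => // x; rewrite pure_ptens FG.
(* The permutation does not depend on the tensor, so it may be compared at the tensor 1. *)
by rewrite (F2 u (ptens n (fun _ => 1))) (G2 u (ptens n (fun _ => 1))) FG.
Qed.

Section LinFst.
Variables (M : lmodType k) (N : nat) (F : M -> amb A N).

Lemma lin_fst_pair (T : M -> tpow A N) (s : 'S_N) : linear T ->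
  lin_fst (fun u => (T u, s)).
Proof. by []. Qed.
Hypothesis linF : lin_fst F.
Lemma lin_fst_mull g : lin_fst (fun f => ambM (F f) g).
Proof.
have [F1 F2] := linF; split=> [c u v|u v] /=; last by rewrite (F2 u v).
by rewrite F1 tact_linear tmul_linDl.
Qed.
(** Constancy of the permutation enters linearity here: in the product it acts on the tensor of
    [g]. *)
Lemma lin_fst_mulr g : lin_fst (fun f => ambM g (F f)).
Proof.
have [F1 F2] := linF; split=> [c u v|u v] /=; last by rewrite (F2 u v).
by rewrite F1 tmul_linDr (F2 (c *: u + v) 0) (F2 u 0) (F2 v 0).
Qed.
Lemma lin_fst_emb P p : lin_fst (fun f => emb P p (F f)).
Proof.
have [F1 F2] := linF; split=> [c u v|u v] /=; last by rewrite (F2 u v).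
by rewrite F1 tlift_linear.
Qed.
End LinFst.

Definition ambZ n (c : k) (f : amb A n) : amb A n := (c *: f.1, f.2).

Lemma ambME n x y (s t : 'S_n) : ambM (ptens n x, s) (ptens n y, t) =
  (ptens n (fun i => x (perm_nat t i) * y i), (t * s)%g).
Proof. by rewrite /ambM /= tact_ptens ptensM. Qed.
Lemma embE N p n x (s : 'S_n) : (p + n <= N)%N -> emb N p (ptens n x, s) =
  (ptens N (fun i => if (p <= i < p + n)%N then x (i - p)%N else 1), elift N p s).
Proof. by move=> le; rewrite /emb /= tlift_ptens. Qed.
Lemma amb1E n : amb1 A n = (ptens n (fun _ => 1), 1%g).
Proof. by rewrite ptens1. Qed.
Lemma amb_eq n x y (s t : 'S_n) :
  (forall i, (i < n)%N -> x i = y i) ->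
  (forall i, (i < n)%N -> perm_nat s i = perm_nat t i) -> (ptens n x,
    s) = (ptens n y, t).
Proof. by move=> xy st; rewrite (eq_ptens xy) (pn_eq st). Qed.

End Ambient.

Ltac lin_fst := repeat first
  [ apply: lin_fst_mull | apply: lin_fst_mulr | apply: lin_fst_emb
  | by apply: lin_fst_pair | move=> ? ].

(** * Calculus of embeddings *)

Section AmbientTheory.
Variables (k : comPzRingType) (A : kalgebra k).
Local Notation amb := (amb A).
Local Infix "**" := (@ambM k A _) (at level 40, left associativity).

Lemma ambA n (f g h : amb n) : f ** (g ** h) = f ** g ** h.
Proof.
move: f; apply: amb_ext; try by lin_fst.
move=> x s; move: g; apply: amb_ext; try by lin_fst.
move=> y t; move: h; apply: amb_ext; try by lin_fst.
move=> z r; rewrite !ambME; apply: amb_eq => i lt; last by rewrite !pnM.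
by rewrite pnM mulrA.
Qed.
Lemma amb1m n (f : amb n) : amb1 A n ** f = f.
Proof.
move: f; apply: amb_ext; try by lin_fst.
move=> x s; rewrite amb1E !ambME; apply: amb_eq => i lt; last by rewrite !pnM pn1.
by rewrite mul1r.
Qed.
Lemma ambm1 n (f : amb n) : f ** amb1 A n = f.
Proof.
move: f; apply: amb_ext; try by lin_fst.
move=> x s; rewrite amb1E !ambME; apply: amb_eq => i lt; last by rewrite !pnM pn1.
by rewrite mulr1 pn1.
Qed.

Lemma embM N p n (f g : amb n) : (p + n <= N)%N ->
  emb N p (f ** g) = emb N p f ** emb N p g.
Proof.
move=> le; move: f; apply: amb_ext; try by lin_fst.
move=> x s; move: g; apply: amb_ext; try by lin_fst.
move=> y t; rewrite !(ambME, embE) //; apply: amb_eq => i lt; last first.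
  rewrite !pnM !pn_elift // !pnM; case: (leqP p i) => pi //=; last by rewrite leqNgt pi.
  by rewrite leq_addr addKn.
rewrite pn_elift //; case: (leqP p i) => pi //=; last by rewrite leqNgt pi /= mul1r.
rewrite leq_addr addKn ltn_add2l pn_lt ltn_subLR //.
by case: ltnP; rewrite ?mulr1.
Qed.

Lemma emb1 N p n : (p + n <= N)%N -> emb N p (amb1 A n) = amb1 A N.
Proof.
move=> le; rewrite !amb1E embE //; apply: amb_eq => i lt; first by case: ifP.
by rewrite pn_elift // !pn1; case: leqP => //; lia.
Qed.

Lemma emb_emb N q M p n (f : amb n) : (p + n <= M)%N -> (q + M <= N)%N ->
  emb N q (emb M p f) = emb N (q + p) f.
Proof.
move=> le1 le2; have le3 : (q + p + n <= N)%N by lia.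
move: f; apply: amb_ext; try by lin_fst.
move=> x s; rewrite !embE //; apply: amb_eq => i lt; last first.
  by rewrite !pn_elift // subnDA; do ?case: ifP => ?; lia.
by rewrite subnDA; do ?case: ifP => ?; try lia.
Qed.

Lemma emb_id n (f : amb n) : emb n 0 f = f.
Proof.
move: f; apply: amb_ext; try by lin_fst.
move=> x s; rewrite embE //; apply: amb_eq => i lt; first by rewrite lt subn0.
by rewrite pn_elift // subn0.
Qed.

Lemma emb_comm N p q n m (f : amb n) (g : amb m) :
  (p + n <= q)%N -> (q + m <= N)%N ->
  emb N p f ** emb N q g = emb N q g ** emb N p f.
Proof.
move=> le1 le2; have le3 : (p + n <= N)%N by lia.
move: f; apply: amb_ext; try by lin_fst.
move=> x s; move: g; apply: amb_ext; try by lin_fst.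
move=> y t; rewrite !(ambME, embE) //; apply: amb_eq => i lt; last first.
  rewrite !pnM !pn_elift //; case: (leqP q i) => qi.
    rewrite (@pn_out _ s (i - p)); last lia.
    have -> : (if p <= i then p + (i - p) else i)%N = i by case: ifP => ?; lia.
    by rewrite (pn_out s); do ?case: ifP => ?; lia.
  case: (ltnP (i - p) n) => h; last by rewrite pn_out //; do ?case: ifP => ?; lia.
  by have := pnlt s h; do ?case: ifP => ?; lia.
rewrite !pn_elift //.
case: (leqP q i) => qi.
  rewrite (_ : (p <= q + _)%N); last lia.
  rewrite (_ : (p <= i)%N); last lia.
  rewrite (pn_out s); last lia.
  rewrite subnKC; last lia.
  rewrite qi /= !(ltnNge _ (p + n)) (_ : (p + n <= i)%N); last lia.
  rewrite (_ : (p + n <= q + _)%N) ?mul1r ?mulr1 //; lia.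
rewrite /= mulr1; case: (ltnP (i - p) n) => h; last first.
  rewrite pn_out //; have -> : (if p <= i then p + (i - p) else i)%N = i by case: ifP
    => ?; lia.
  by rewrite (leqNgt q) qi mul1r.
by have lt' := pnlt s h; case: (leqP p i) => pi; do ?case: ifP => ?;
  rewrite ?mul1r //; lia.
Qed.

(** Reduces the monoidal structure to products inside a single tensor power; the two factors commute
    since they sit on disjoint strands. *)
Lemma amb_tensE n m (f : amb n) (g : amb m) :
  amb_tens f g = emb (n + m) 0 f ** emb (n + m) n g.
Proof.
have l1 (g' : amb m) : forall s, lin_fst (fun u => @amb_tens k A n m (u, s) g').
  by split=> // c u v; rewrite /= ttens_linl.
have l2 (f' : amb n) : forall s, lin_fst (fun u => @amb_tens k A n m f' (u, s)).
  by split=> // c u v; rewrite /= ttens_linr.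
move: f; apply: amb_ext; try by [lin_fst | exact: l1].
move=> x s; move: g; apply: amb_ext; try by [lin_fst | exact: l2].
move=> y t; rewrite !(embE, ambME) ?leq_addr // /amb_tens /= /ptens ttens_pure.
congr pair.
  congr pure; apply/ffunP => i; rewrite !ffunE pn_elift //.
  case: split_ordP => j -> /=; rewrite ffunE.
    by rewrite (leqNgt n j) (ltn_ord j) /= add0n (ltn_ord j) subn0 mulr1.
  rewrite leq_addr ltn_add2l (ltn_ord j) add0n addKn.
  by rewrite (ltnNge _ n) leq_addr mul1r.
apply: pn_eq => i lt; rewrite pn_block pnM !pn_elift //= ?leq_addr // !subn0 add0n.
case: (leqP n i) => le //=.
by rewrite [RHS]pn_out // leq_addr.
Qed.

Lemma amb_castE n m (e : n = m) (f : amb n) : amb_cast e f = emb m 0 f.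
Proof. by case: m / e; rewrite emb_id. Qed.

Lemma linearZ0 (U V : lmodType k) (F : U -> V) c u : linear F -> F (c *: u) = c *: F u.
Proof.
move=> lF; have := lF c u 0; rewrite addr0 => ->.
have -> : F 0 = 0; last by rewrite addr0.
by have := lF (-1) 0 0; rewrite !scaleN1r oppr0 addr0 addNr.
Qed.
Lemma ambZl n c (f g : amb n) : ambZ c f ** g = ambZ c (f ** g).
Proof. by rewrite /ambM /ambZ /= (linearZ0 _ _ (@tact_linear _ _ _ _)) tscalerAl. Qed.
Lemma ambZr n c (f g : amb n) : f ** ambZ c g = ambZ c (f ** g).
Proof. by rewrite /ambM /ambZ /= tscalerAr. Qed.
Lemma embZ N p n c (f : amb n) : emb N p (ambZ c f) = ambZ c (emb N p f).
Proof. by rewrite /emb /ambZ /= (linearZ0 _ _ (@tlift_linear _ _ _ _ _)). Qed.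

End AmbientTheory.

(** * Closing one strand *)

Section ClosureLinear.
Variables (k : comPzRingType) (A : kalgebra k) (X : traced_XCalgebra A).
Local Notation amb := (amb A).
Local Infix "**" := (@ambM k A _) (at level 40, left associativity).
Local Notation phi1 := (@traced_phi1 k A X _).
Local Notation "'κ'" := (xck X).

(** Which closure formula applies depends on the permutation alone, and this is constant, so a
    single linear formula is in force. *)
Lemma lin_fst_phi1 (M : lmodType k) N (F : M -> amb N.+1) : lin_fst F ->
  lin_fst (fun f => phi1 (F f)).
Proof.
move=> [F1 F2]; split=> [c u v|u v]; rewrite /traced_phi1.
  rewrite (F2 (c *: u + v) 0) (F2 u 0) (F2 v 0) F1.
  case: (boolP (_ == _)) => /= h;
    first exact: (teval_linear (@loop_multilinear _ _ X N)).
  rewrite (F2 (c *: u + v) 0) (F2 u 0) (F2 v 0) F1.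
  exact: (teval_linear (close_multilinear X h)).
by rewrite (F2 u v); case: ifP => //= _; rewrite (F2 u v).
Qed.

Lemma phi1_ptens n x (s : 'S_n.+1) : phi1 (ptens n.+1 x, s) =
  if perm_nat s n == n then @ambZ k A n (xctr X (κ * x n)) (ptens n x, cut s)
  else (ptens n (fun i => if perm_nat s i == n then x n * κ * x i else x i), cut s).
Proof.
rewrite /traced_phi1 /= pn_max; case: ifP => h.
  rewrite /ambZ /ptens teval_pure; last exact: loop_multilinear.
  rewrite /loop_pure ffunE /=; congr (_ *: pure _, _).
  by apply/ffunP => i; rewrite !ffunE lift_max.
rewrite /close /ptens /= teval_pure; last by apply: close_multilinear; rewrite pn_max h.
rewrite /close_pure; congr (pure _, _).
apply/ffunP => i; rewrite !ffunE lift_max -(lift_max i) pnE.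
by rewrite -val_eqE.
Qed.

Lemma phi1Z n c (f : amb n.+1) : phi1 (ambZ c f) = ambZ c (phi1 f).
Proof.
case: f => u s.
have [h1 h2] := lin_fst_phi1 (lin_fst_pair s (T := @id (tpow A n.+1)) (fun _ _ _ =>
  erefl)).
rewrite [LHS]surjective_pairing /ambZ /= (h2 _ u); congr pair.
exact: linearZ0 c u h1.
Qed.

End ClosureLinear.

Ltac lin_phi := repeat first
  [ apply: lin_fst_phi1 | apply: lin_fst_mull | apply: lin_fst_mulr | apply: lin_fst_emb
  | by apply: lin_fst_pair | move=> ? ].

Section Closure.
Variables (k : comPzRingType) (A : kalgebra k) (X : traced_XCalgebra A).
Local Notation amb := (amb A).
Local Infix "**" := (@ambM k A _) (at level 40, left associativity).
Local Notation phi1 := (@traced_phi1 k A X _).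
Local Notation "'κ'" := (xck X).

Lemma phi1_natl n (u : amb n) (f : amb n.+1) :
  phi1 (emb n.+1 0 u ** f) = u ** phi1 f.
Proof.
have le : (0 + n <= n.+1)%N by lia.
move: u; apply: amb_ext; try by lin_phi.
move=> x s; move: f; apply: amb_ext; try by lin_phi.
move=> y t; rewrite !(embE, ambME, phi1_ptens) // pnM pn_elift //= subn0 add0n.
have Es i : (perm_nat s i == n) = (i == n).
  by rewrite -[RHS](inj_eq (@pn_injP _ s)) (@pn_out _ s n).
have Tlt i : (i < n)%N -> (perm_nat t i < n.+1)%N.
  by move=> lt; apply: pnlt; lia.
rewrite Es; case: ifP => /eqP h.
  have NE i : (i < n)%N -> (perm_nat t i == n) = false.
    by move=> lt; apply/eqP => e; have := pn_injP (etrans e (esym h)); lia.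
  rewrite ambZr ambME h ltnn mul1r; congr ambZ; apply: amb_eq => i lt.
    rewrite pn_cut // NE // subn0 add0n.
    have -> // : (perm_nat t i < n)%N.
    by have := Tlt _ lt; have := NE _ lt; lia.
  by rewrite pnM !pn_cut // ?pnM ?pn_elift //= ?subn0 ?add0n NE // Es NE.
rewrite ambME; apply: amb_eq => i lt; last first.
  rewrite pnM !pn_cut // ?pnM ?pn_elift //= ?subn0 ?add0n Es.
  by case: ifP.
rewrite pn_cut // pnM pn_elift //= !add0n !subn0 Es.
have nlt : (perm_nat t n < n)%N.
  by have : (perm_nat t n < n.+1)%N by [apply: pnlt]; lia.
rewrite nlt; case: eqP => e; first by rewrite e ltnn mul1r !mulrA.
have -> // : (perm_nat t i < n)%N.
by have := Tlt i lt; lia.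
Qed.

Lemma phi1_natr n (u : amb n) (f : amb n.+1) :
  phi1 (f ** emb n.+1 0 u) = phi1 f ** u.
Proof.
have le : (0 + n <= n.+1)%N by lia.
move: u; apply: amb_ext; try by lin_phi.
move=> y t; move: f; apply: amb_ext; try by lin_phi.
move=> x s; rewrite !(embE, ambME, phi1_ptens) // pnM pn_elift //= subn0 add0n.
have tlt i : (i < n)%N -> (perm_nat t i < n)%N by apply: pnlt.
have tn : perm_nat t n = n by apply: pn_out.
rewrite tn; case: ifP => /eqP h.
  rewrite ambZl ambME ltnn mulr1; congr ambZ; apply: amb_eq => i lt.
    by rewrite pn_elift //= lt !subn0.
  by rewrite pnM !pn_cut ?tlt // ?pnM ?pn_elift //= ?subn0 ?add0n ?tn.
rewrite ambME; apply: amb_eq => i lt; last first.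
  by rewrite pnM !pn_cut ?tlt // ?pnM ?pn_elift //= ?subn0 ?add0n ?tn.
rewrite pnM pn_elift //= !add0n !subn0 ltnn lt mulr1.
by case: ifP => // _; rewrite mulrA.
Qed.

(** Strands are added on the left, away from the closing one. Adding them on the right is
    superposing and requires crossings. *)
Lemma phi1_emb p N n (f : amb n.+1) : (p + n = N)%N ->
  phi1 (emb N.+1 p f) = emb N p (phi1 f).
Proof.
move=> e; have le : (p + n.+1 <= N.+1)%N by lia.
have le' : (p + n <= N)%N by lia.
move: f; apply: amb_ext; try by lin_phi.
move=> x s; rewrite !(embE, phi1_ptens) // pn_elift //.
have pN : (p <= N)%N by lia.
have Nn : (N - p = n)%N by lia.
have E i : (p + i == N)%N = (i == n) by apply/eqP/eqP; lia.
rewrite pN Nn E /= ; have -> : (N < p + n.+1)%N by lia.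
have Slt : (perm_nat s n < n.+1)%N by apply: pnlt.
case: ifP => /eqP h.
  rewrite embZ embE //; congr ambZ; apply: amb_eq => i lt.
    by do ?case: ifP => ?; try lia.
  rewrite pn_cut // !pn_elift // pN Nn.
  case: (leqP p i) => pi; last by case: eqP => // ?; lia.
  by rewrite pn_cut ?E; [case: ifP|lia].
rewrite embE //; apply: amb_eq => i lt; last first.
  rewrite pn_cut // !pn_elift // pN Nn.
  case: (leqP p i) => pi; last by case: eqP => // ?; lia.
  by rewrite pn_cut ?E; [case: ifP|lia].
rewrite pn_elift //; case: (leqP p i) => pi /=; last first.
  by rewrite ltn_eqF //; lia.
have -> : (i < p + n)%N by lia.
have -> : (i < p + n.+1)%N by lia.
by rewrite E.
Qed.

(** The transposition without R. It separates the permutation of a crossing from its beads. *)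
Definition swp N i : amb N := emb N i (1 : tpow A 2, tperm ord0 ord_max).

Definition bead N i (a : A) : amb N := (ptens N (fun j =>
  if j == i then a else 1), 1%g).

Definition nswap i j : nat := if j == i then i.+1 else if j == i.+1 then i else j.

Lemma swpE N i : (i + 2 <= N)%N -> exists2 s : 'S_N, perm_nat s =1 nswap i &
   swp N i = (ptens N (fun _ => 1), s).
Proof.
move=> le; exists (elift N i (tperm (ord0 : 'I_2) ord_max)).
  move=> j; rewrite pn_elift // pn_tperm01 /nswap.
  by do ?case: ifP => ?; lia.
by rewrite /swp -ptens1 embE //; apply: amb_eq => // j lt; case: ifP.
Qed.

(** A bead travelling around the closed strand passes its κ and comes back conjugated. When the
    strand closes up to a loop, this is cyclicity of the trace. *)
Lemma phi1_bead n a b (f : amb n.+1) : b * κ = κ * a ->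
  phi1 (bead n.+1 n a ** f) = phi1 (f ** bead n.+1 n b).
Proof.
move=> ab; move: f; apply: amb_ext; try by lin_phi.
move=> x s; rewrite !(ambME, phi1_ptens) mulg1 mul1g pn1.
case: ifP => /eqP h.
  rewrite h eqxx (_ : xctr X _ = xctr X (κ * (x n * b))).
    congr ambZ; apply: amb_eq => // i lt.
    rewrite [i == n](introF eqP (_ : i <> n)) ?mulr1; last lia.
    rewrite pn1; case: eqP => e; last by rewrite mul1r.
    by have := pn_injP (etrans e (esym h)); lia.
  by rewrite mulrA -ab -mulrA xctrC -!mulrA xctrC -mulrA.
apply: amb_eq => // i lt.
rewrite eqxx [i == n](introF eqP (_ : i <> n)) ?mulr1; last lia.
rewrite pn1 (introF eqP h) mul1r; case: eqP => e; last by rewrite mul1r.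
by rewrite -!mulrA (mulrA κ) -ab -!mulrA.
Qed.

(** Superposing without decorations: after the conjugation strand N is a straight open strand beside
    the closing one, and only the beads of the crossings remain to be treated. *)
Lemma phi1_swp N (f : amb N.+1) :
  phi1 (swp N.+2 N ** emb N.+2 0 f ** swp N.+2 N) = emb N.+1 0 (phi1 f).
Proof.
have [|w wE ->] := @swpE N.+2 N; first lia.
have le : (0 + N.+1 <= N.+2)%N by lia.
have le' : (0 + N <= N.+1)%N by lia.
move: f; apply: amb_ext; try by lin_phi.
move=> x s; rewrite !(embE, ambME, phi1_ptens) //.
have slt i : (i < N.+1)%N -> (perm_nat s i < N.+1)%N by apply: pnlt.
have sn : perm_nat s N.+1 = N.+1 by apply: pn_out.
have W1 : nswap N N.+1 = N by rewrite /nswap eqxx; case: eqP; lia.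
have W2 : nswap N N = N.+1 by rewrite /nswap eqxx.
have W3 i : (i < N)%N -> nswap N i = i by rewrite /nswap; do ?case: eqP => ?; lia.
set P := perm_nat (w * (elift N.+2 0 s * w))%g.
have PE i : P i = nswap N (perm_nat s (nswap N i)).
  by rewrite /P !pnM !wE pn_elift //= add0n subn0.
have P1 : P N.+1 = if perm_nat s N == N then N.+1 else perm_nat s N.
  by rewrite PE W1 /nswap; have h' := slt N (ltnSn N); do ?case: ifP => ?; lia.
have P2 i : (i < N)%N -> P i = if perm_nat s i == N then N.+1 else perm_nat s i.
  move=> lt; rewrite PE (W3 i lt) /nswap;
    have h' : (perm_nat s i < N.+1)%N by apply: slt; lia.
  by do ?case: ifP => ?; lia.
have P3 : P N = N by rewrite PE W2 sn.
have PC i : (i < N.+1)%N -> perm_nat (cut (w * (elift N.+2 0 s * w))) i =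
    perm_nat (elift N.+1 0 (cut s)) i.
  move=> lt; rewrite pn_cut // pn_elift //= -/P add0n subn0.
  case: (ltnP i N) => iN; last first.
    by rewrite (_ : i = N) ?P3 ?pn_out //; [case: eqP; lia|lia].
  rewrite P1 P2 // pn_cut //; have h' : (perm_nat s i < N.+1)%N by apply: slt.
  have := @pn_injP _ s i N; case: (perm_nat s i =P N) => e;
    case: (perm_nat s N =P N) => e';
    rewrite ?eqxx //; do ?case: eqP => //; lia.
have B i : (if (0 <= perm_nat w i < 0 + N.+1)%N then x (perm_nat w i - 0)%N else 1) =
   if (i < N)%N then x i else if i == N.+1 then x N else 1.
  rewrite wE add0n subn0 /nswap; case: (ltngtP i N) => iN.
  - by rewrite ltn_eqF // (_ : (i < N.+1)%N) //; lia.
  - by case: eqP => e; [rewrite ltnSn|have -> : (i < N.+1)%N = false by lia].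
  - by rewrite iN ltnn ltn_eqF.
rewrite P1 B ltnNge leqnSn /= eqxx mulr1 mul1r.
case: (perm_nat s N =P N) => h; rewrite ?eqxx.
  rewrite embZ embE //; congr ambZ; apply: amb_eq => // i lt.
  by rewrite mul1r mulr1 B /= add0n subn0 [i == _]ltn_eqF.
have slN : (perm_nat s N < N)%N by have h' := slt N (ltnSn N); lia.
rewrite ltn_eqF ?embE //; last lia.
apply: amb_eq => // i lt; rewrite -/P !mul1r !mulr1 B /= add0n subn0 [i == _]ltn_eqF //.
case: (ltnP i N) => iN; last by rewrite (_ : i = N) ?P3 ?ltn_eqF //; lia.
rewrite P2 //; have h' : (perm_nat s i < N.+1)%N by apply: slt.
by case: (perm_nat s i =P N) => e; rewrite ?eqxx // ltn_eqF.
Qed.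

Lemma phi1_phi1_swp N (f : amb N.+2) :
  phi1 (phi1 (swp N.+2 N ** f)) = phi1 (phi1 (f ** swp N.+2 N)).
Proof.
have [|w wE ->] := @swpE N.+2 N; first lia.
move: f; apply: amb_ext; try by lin_phi.
move=> x t; rewrite !ambME.
have W1 : nswap N N.+1 = N by rewrite /nswap eqxx; case: eqP; lia.
have W2 : nswap N N = N.+1 by rewrite /nswap eqxx.
have W3 i : (i < N)%N -> nswap N i = i by rewrite /nswap; do ?case: eqP => ?; lia.
have W0 : ((N == N.+1) = false) * ((N.+1 == N) = false) by split; apply/eqP; lia.
rewrite (_ : ptens N.+2 _ = ptens N.+2 x); last by apply: eq_ptens => i _;
  rewrite mul1r.
rewrite (_ : ptens N.+2 (fun i => _ * 1) = ptens N.+2 (fun i => x (nswap N i)));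
  last first.
  by apply: eq_ptens => i _; rewrite mulr1 wE.
set L := (t * w)%g; set R := (w * t)%g; set T := perm_nat t.
have LE i : perm_nat L i = nswap N (T i) by rewrite pnM wE.
have RE i : perm_nat R i = T (nswap N i) by rewrite pnM wE.
have tri i : (i < N.+2)%N -> T i = N \/ T i = N.+1 \/
    [/\ (T i == N) = false, (T i == N.+1) = false, (T i < N)%N & nswap N (T i) = T i].
  move=> /(pnlt t); rewrite -/T => lt.
  case: (T i =P N) => [|n1]; first by left.
  case: (T i =P N.+1) => [|n2]; [by right; left|right; right].
  by split; [| |lia|apply: W3; lia].
have TI i j : T i = T j -> i = j by apply: (@pn_injP _ t).
have P : forall i, (i < N)%N -> perm_nat (cut (cut L)) i = perm_nat (cut (cut R)) i.
  move=> i lt; have lt1 : (i < N.+1)%N by lia.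
  have iN : (i == N) = false by apply/eqP; lia.
  rewrite !pn_cut // !LE !RE W1 W2 (W3 i lt).
  have [/TI|h] : T i = T N \/ T i <> T N by lia.
    lia.
  have [/TI|h'] : T i = T N.+1 \/ T i <> T N.+1 by lia.
    lia.
  have h2 : T N <> T N.+1 by move/TI; lia.
  case: (tri i) => [|eC|[eC|[c1 c2 c3 c4]]]; first lia;
  case: (tri N) => [|eA|[eA|[a1 a2 a3 a4]]]; try lia;
  case: (tri N.+1) => [|eB|[eB|[b1 b2 b3 b4]]]; try lia;
  do ?[rewrite ?eA ?eB ?eC ?W1 ?W2 ?c4 ?a4 ?b4 ?W0 ?eqxx ?c1 ?c2 ?a1 ?a2 ?b1 ?b2] => //.
(* Each of the two closed strands continues into itself, the other one or an open one. *)
have [T12 lN] : T N <> T N.+1 /\ (N < N.+2)%N by split; [move/TI; lia|lia].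
case: (tri N) => // [eA|[eA|[a1 a2 a3 a4]]];
case: (tri N.+1) => // [eB|[eB|[b1 b2 b3 b4]]]; try (by case: T12; rewrite ?eA ?eB);
rewrite !phi1_ptens !LE !RE; do ?rewrite ?W1 ?W2 ?eA ?eB ?b4 ?a4 ?W0 ?eqxx ?a1 ?a2
  ?b1 ?b2;
rewrite ?phi1Z ?phi1_ptens; do ?(rewrite pn_cut; last lia); rewrite ?LE ?RE;
  do ?rewrite ?W1 ?W2 ?eA ?eB ?b4 ?a4 ?W0 ?eqxx ?a1 ?a2 ?b1 ?b2.
(* The two closed strands form one loop, read from two starting points: cyclicity of the trace. *)
1: rewrite (_ : xctr X (κ * (x N * κ * x N.+1)) = xctr X (κ * (x N.+1 * κ * x N)));
  last first.
1: by rewrite -[x N * _ * _]mulrA [κ * (_ * (κ * _))]mulrA xctrC !mulrA.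
(* Two separate loops, closed in opposite orders: their scalars commute. *)
3: rewrite [LHS](_ : _ = @ambZ k A N (xctr X (κ * x N)) (@ambZ k A N (xctr X (κ * x
  N.+1)) (ptens N x, cut (cut L)))); last first.
3: by rewrite /ambZ /= !scalerA mulrC.
all: do ?congr ambZ; apply: amb_eq => i lt; last exact: P.
all: have lt1 : (i < N.+1)%N by lia.
all: have lt2 : (i < N.+2)%N by lia.
all: have iN : (i == N) = false by apply/eqP; lia.
all: have TiN e : T i = e -> T N = e -> False by move=> u v; have := TI i N; lia.
all: have TiN1 e : T i = e -> T N.+1 = e -> False by move=> u v; have := TI i N.+1; lia.
all: rewrite ?pn_cut // ?LE ?RE ?W1 ?W2 (W3 i lt) //.
all: case: (tri i lt2) => [eC|[eC|[c1 c2 c3 c4]]];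
  try (by [case: (TiN _ eC) | case: (TiN1 _ eC)]);
  do ?rewrite ?eC ?eA ?eB ?W1 ?W2 ?c4 ?a4 ?b4 ?W0 ?eqxx ?c1 ?c2 ?a1 ?a2 ?b1 ?b2;
    rewrite ?mulrA //.
Qed.

End Closure.

(** * Crossings *)

Section Crossings.
Variables (k : comPzRingType) (A : kalgebra k) (X : traced_XCalgebra A).
Local Notation amb := (amb A).
Local Infix "**" := (@ambM k A _) (at level 40, left associativity).
Local Notation phi1 := (@traced_phi1 k A X _).
Local Notation "'κ'" := (xck X).
Local Notation κV := (xckV X).
Local Notation sw := (tperm ord0 ord_max : 'S_2).

Lemma pure2_ptens (a b : A) : pure2 a b = ptens 2 (fun i => if i == 0%N then a else b).
Proof. by congr pure; apply/ffunP => i; rewrite !ffunE -val_eqE. Qed.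

Lemma tpow2_ext (M : lmodType k) (F G : tpow A 2 -> M) : linear F -> linear G ->
  (forall a b, F (pure2 a b) = G (pure2 a b)) -> F =1 G.
Proof.
move=> lF lG FG; apply: linear_tpow_ext => // x.
suff -> : pure x = pure2 (x ord0) (x ord_max) by [].
congr pure; apply/ffunP => i; rewrite !ffunE; case: eqP => [-> //|ne].
by congr (x _); apply: val_inj; case: i ne => -[|[|i]] // lt []; apply: val_inj.
Qed.

Lemma tens2_ext N (F G : tpow A 2 -> amb N) : lin_fst F -> lin_fst G ->
  (forall a b, F (pure2 a b) = G (pure2 a b)) -> F =1 G.
Proof.
move=> [F1 F2] [G1 G2] FG u.
rewrite [LHS]surjective_pairing [RHS]surjective_pairing; congr pair.
  by move: u; apply: tpow2_ext => // a b; rewrite FG.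
by rewrite (F2 u (pure2 1 1)) (G2 u (pure2 1 1)) FG.
Qed.

Lemma tact1 n (u : tpow A n) : tact 1%g u = u.
Proof.
move: u; apply: linear_tpow_ext => //; first exact: tact_linear.
by move=> x; rewrite pure_ptens tact_ptens; apply: eq_ptens => i _; rewrite pn1.
Qed.
Lemma tactM n (s : 'S_n) (u v : tpow A n) : tact s (u * v) = tact s u * tact s v.
Proof.
move: u; apply: linear_tpow_ext => [c u u'|c u u'|x].
- by rewrite tmul_linDl tact_linear.
- by rewrite tact_linear tmul_linDl.
move: v; apply: linear_tpow_ext => [c u u'|c u u'|y].
- by rewrite tmul_linDr tact_linear.
- by rewrite tact_linear tmul_linDr.
by rewrite !pure_ptens ptensM !tact_ptens ptensM.
Qed.
Lemma tact1r n (s : 'S_n) : tact s (1 : tpow A n) = 1.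
Proof. by rewrite -ptens1 tact_ptens. Qed.
Lemma tactK n (s t : 'S_n) (u : tpow A n) : tact s (tact t u) = tact (s * t)%g u.
Proof.
move: u; apply: linear_tpow_ext => [c u u'|c u u'|x].
- by rewrite !tact_linear.
- by rewrite tact_linear.
by rewrite pure_ptens !tact_ptens; apply: eq_ptens => i _; rewrite pnM.
Qed.

Definition flip (u : tpow A 2) : tpow A 2 := tact sw u.
Lemma flipK u : flip (flip u) = u.
Proof. by rewrite /flip tactK tperm2 tact1. Qed.
Lemma flip_linear : linear flip. Proof. exact: tact_linear. Qed.
Lemma flip_pure2 a b : flip (pure2 a b) = pure2 b a.
Proof.
rewrite /flip !pure2_ptens tact_ptens; apply: eq_ptens => i lt; rewrite pn_tperm01.
by case: i lt => [|[|i]].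
Qed.

(* e distinguishes the two crossings: the beads of \hat R_i and of its inverse *)
Definition rho (e : bool) : tpow A 2 := if e then xcR X else flip (xcRV X).
Definition rhoV (e : bool) : tpow A 2 := if e then xcRV X else flip (xcR X).
Definition rhat (e : bool) : amb 2 := (rho e, sw).
Definition swap2 : amb 2 := (1, sw).

(** The beads of a crossing are written to the right of the transposition, those of its inverse
    ([rhatVE]) to the left, so that in a conjugation all beads are outermost. *)
Lemma rhatE e : rhat e = swap2 ** (rho e, 1%g).
Proof. by rewrite /ambM /= tact1 mul1r mul1g. Qed.
Lemma rhatVE e : rhat (~~ e) = (rhoV e, 1%g) ** swap2.
Proof.
by rewrite /ambM /= mulr1 mulg1; case: e => //=; rewrite -/(flip _) flipK.
Qed.
Lemma rhoK e : rho e * rhoV e = 1.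
Proof.
case: e; rewrite /= ?xcRK //.
by rewrite /flip -tactM xcRVK tact1r.
Qed.
Lemma swap2K : swap2 ** swap2 = amb1 A 2.
Proof. by rewrite /ambM /= tact1r mul1r tperm2. Qed.
Lemma rhatK e : rhat e ** rhat (~~ e) = amb1 A 2.
Proof.
rewrite rhatE rhatVE ambA -(ambA swap2) [X in swap2 ** X]/ambM /= tact1 rhoK mulg1.
by rewrite [(1, 1%g)](_ : _ = amb1 A 2) // ambm1 swap2K.
Qed.

Lemma pureB (a b : A) N i : (i + 2 <= N)%N ->
  emb N i (pure2 a b, 1%g) = bead N i a ** bead N i.+1 b.
Proof.
move=> le; rewrite pure2_ptens embE // /bead ambME; apply: amb_eq => j lt; last first.
  by rewrite pn_elift // mulg1 !pn1; case: ifP => ?; lia.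
rewrite pn1; case: (j =P i) => [->|n1].
  by rewrite [i == i.+1]ltn_eqF // mulr1 leqnn subnn (_ : (i < i + 2)%N) //; lia.
case: (j =P i.+1) => [->|n2]; last by rewrite mul1r; case: ifP => // ?; lia.
by rewrite mul1r leqnSn subSnn (_ : (i.+1 < i + 2)%N) //; lia.
Qed.

Lemma beadM N i a b : bead N i a ** bead N i b = bead N i (a * b).
Proof.
rewrite /bead ambME; apply: amb_eq => j lt; last by rewrite mulg1.
by rewrite pn1; case: ifP; rewrite ?mulr1.
Qed.
Lemma bead_comm N i j a b : i != j ->
  bead N i a ** bead N j b = bead N j b ** bead N i a.
Proof.
move=> /eqP ij; rewrite /bead !ambME; apply: amb_eq => l lt //; rewrite pn1.
by case: (l =P i) => [->|]; rewrite ?mul1r ?mulr1 // (introF eqP ij) mul1r mulr1.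
Qed.
Lemma bead_emb_comm N i a n (f : amb n) : (n <= i)%N -> (n <= N)%N ->
  bead N i a ** emb N 0 f = emb N 0 f ** bead N i a.
Proof.
move=> le le'; have le2 : (0 + n <= N)%N by lia.
move: f; apply: amb_ext; try by lin_fst.
move=> x s; rewrite embE // /bead !ambME; apply: amb_eq => j lt;
  last by rewrite mulg1 mul1g.
rewrite pn1 pn_elift //= !subn0 !add0n.
case: (ltnP j n) => jn.
  by have := pnlt s jn => jn'; rewrite !ltn_eqF ?mul1r ?mulr1 //; lia.
by rewrite pn_out // mul1r mulr1.
Qed.
Lemma swp_bead N i a : (i + 2 <= N)%N ->
  swp A N i ** bead N i a = bead N i.+1 a ** swp A N i.
Proof.
move=> /(swpE A)[s sE ->]; rewrite /bead !ambME; apply: amb_eq => j lt;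
  last by rewrite mulg1 mul1g.
rewrite sE mul1r mulr1 /nswap; case: (j =P i) => [_|n1]; first by rewrite eqxx.
by case: (j =P i.+1) => [_|/eqP/negbTE ->]; rewrite // ltn_eqF.
Qed.
Lemma bead_swp N i a : (i + 2 <= N)%N ->
  bead N i a ** swp A N i = swp A N i ** bead N i.+1 a.
Proof.
move=> /(swpE A)[s sE ->]; rewrite /bead !ambME; apply: amb_eq => j lt;
  last by rewrite mulg1 mul1g.
rewrite sE mul1r mulr1 /nswap; case: (j =P i) => [->|n1];
  first by rewrite gtn_eqF ?ltn_eqF.
by case: (j =P i.+1) => [_|_]; [rewrite eqxx|rewrite (introF eqP n1)].
Qed.

Lemma pure2_linl b : linear (fun a : A => pure2 a b).
Proof.
move=> c x y.
have [y0 E] : exists y0, forall z, pair2 z b = upd y0 ord0 z.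
  by exists (pair2 0 b) => z; apply/ffunP => i; rewrite !ffunE; case: eqP.
by rewrite /pure2 !E pure_multilinear.
Qed.
Lemma pure2_linr a : linear (fun b : A => pure2 a b).
Proof.
move=> c x y.
have [y0 E] : exists y0, forall z, pair2 a z = upd y0 ord_max z.
  exists (pair2 a 0) => z; apply/ffunP => i; rewrite !ffunE -!val_eqE /=.
  by case: i => [[|[|i]] lt].
by rewrite /pure2 !E pure_multilinear.
Qed.

Section DoubleSum.
Variables (M : lmodType k) (G : A -> A -> A -> A -> M).
Hypotheses (G1 : forall b c d, linear (fun a => G a b c d))
  (G2 : forall a c d, linear (fun b => G a b c d))
  (G3 : forall a b d, linear (fun c => G a b c d))
  (G4 : forall a b c, linear (fun d => G a b c d)).

Definition dsum (u v : tpow A 2) : M :=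
  tsum2 (fun a b => tsum2 (fun c d => G a b c d) v) u.

Lemma tsum2_fun_linear (f g h : A -> A -> M) z v :
  (forall c d, f c d = z *: g c d + h c d) ->
  tsum2 f v = z *: tsum2 g v + tsum2 h v.
Proof.
move=> E; rewrite /tsum2 /teval scaler_sumr -big_split /=; apply: eq_bigr => p _.
by rewrite E scalerDr !scalerA mulrC.
Qed.

Lemma dsum_linl v : linear (fun u => dsum u v).
Proof.
by apply: (tsum2_pure2 _ _).1 => [b|a] z x y; apply: tsum2_fun_linear => c d;
  rewrite ?G1 ?G2.
Qed.
Lemma dsum_linr u : linear (dsum u).
Proof.
move=> z v w; apply: tsum2_fun_linear => a b.
by apply: (tsum2_pure2 _ _).1.
Qed.
Lemma dsum_pure2 a b c d : dsum (pure2 a b) (pure2 c d) = G a b c d.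
Proof.
rewrite /dsum (tsum2_pure2 _ _).2 ?(tsum2_pure2 _ _).2 // => [x z y y'|x z y y'];
  by apply: tsum2_fun_linear => c' d'; rewrite ?G1 ?G2.
Qed.
End DoubleSum.

(** At R and its inverse, [mix'] is the right-hand side of (XC2d). In [mix] the κ stands in the
    second factor, which is where superposing produces it. *)
Definition mix := dsum (fun a b c d => pure2 (c * a) (b * κ * d)).
Definition mix' := dsum (fun a b c d => pure2 (c * κ * a) (b * d)).

Lemma mix_linl v : linear (fun u => mix u v).
Proof. by apply: dsum_linl => ? ? ? z x y;
  rewrite ?(mulrDr, mulrDl) -?(kscalerAl, kscalerAr) ?pure2_linl ?pure2_linr. Qed.
Lemma mix_linr u : linear (mix u).
Proof. by apply: dsum_linr => ? ? ? z x y;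
  rewrite ?(mulrDr, mulrDl) -?(kscalerAl, kscalerAr) ?pure2_linl ?pure2_linr. Qed.
Lemma mix'_linl v : linear (fun u => mix' u v).
Proof. by apply: dsum_linl => ? ? ? z x y;
  rewrite ?(mulrDr, mulrDl) -?(kscalerAl, kscalerAr) ?pure2_linl ?pure2_linr. Qed.
Lemma mix'_linr u : linear (mix' u).
Proof. by apply: dsum_linr => ? ? ? z x y;
  rewrite ?(mulrDr, mulrDl) -?(kscalerAl, kscalerAr) ?pure2_linl ?pure2_linr. Qed.
Lemma mix_pure2 a b c d : mix (pure2 a b) (pure2 c d) = pure2 (c * a) (b * κ * d).
Proof. by rewrite /mix dsum_pure2 // => ? ? ? z x y;
  rewrite ?(mulrDr, mulrDl) -?(kscalerAl, kscalerAr) ?pure2_linl ?pure2_linr. Qed.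
Lemma mix'_pure2 a b c d : mix' (pure2 a b) (pure2 c d) = pure2 (c * κ * a) (b * d).
Proof. by rewrite /mix' dsum_pure2 // => ? ? ? z x y;
  rewrite ?(mulrDr, mulrDl) -?(kscalerAl, kscalerAr) ?pure2_linl ?pure2_linr. Qed.

Lemma pure2M (a b c d : A) : pure2 a b * pure2 c d = pure2 (a * c) (b * d).
Proof. by rewrite !pure2_ptens ptensM; apply: eq_ptens => i _; case: ifP. Qed.

Lemma mix'_R : mix' (xcR X) (xcRV X) = pure2 κ 1.
Proof. by rewrite [RHS]XC2d. Qed.

(** Conjugation by κ ⊗ κ, which fixes R by (XC0), carries κ from one tensor factor to the other and
    so turns (XC2d) into the identity for [mix]. *)
Lemma mix_conj u v : mix (pure2 κ κ * u * pure2 κV κV) v = pure2 1 κ * mix' u v *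
  pure2 κV 1.
Proof.
move: u; apply: tpow2_ext => [c u u'|c u u'|a b].
- by rewrite tmul_linDr tmul_linDl mix_linl.
- by rewrite mix'_linl tmul_linDr tmul_linDl.
move: v; apply: tpow2_ext => [c u u'|c u u'|c d].
- by rewrite mix_linr.
- by rewrite mix'_linr tmul_linDr tmul_linDl.
rewrite !(pure2M, mix_pure2, mix'_pure2).
by rewrite mulr1 mul1r !mulrA -(mulrA _ κV κ) xckVK mulr1.
Qed.

Lemma mix_R : mix (xcR X) (xcRV X) = pure2 1 κ.
Proof.
by rewrite XC0 mix_conj mix'_R !pure2M !mulr1 mul1r xckK.
Qed.

(** For the inverse crossing the required identity is (XC2d) itself with its two tensor factors
    exchanged. *)
Lemma mix_flip u v : mix (flip v) (flip u) = flip (mix' u v).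
Proof.
move: u; apply: tpow2_ext => [c u u'|c u u'|a b].
- by rewrite flip_linear mix_linr.
- by rewrite mix'_linl flip_linear.
move: v; apply: tpow2_ext => [c u u'|c u u'|c d].
- by rewrite flip_linear mix_linl.
- by rewrite mix'_linr flip_linear.
by rewrite !(flip_pure2, mix_pure2, mix'_pure2).
Qed.

Lemma mix_rho e : mix (rho e) (rhoV e) = pure2 1 κ.
Proof. by case: e; rewrite /= ?mix_R // mix_flip mix'_R flip_pure2. Qed.

Definition crossing (e : bool) N i : amb N := emb N i (rhat e).

(* The beads of the two crossings on the closed strand slide to its kappa, those on
   the other strand meet: both are collected in mix u v. *)
Lemma phi1_crossing_sub N (f : amb N.+1) u v :
  phi1 (emb N.+2 N (v, 1%g) ** (swp A N.+2 N ** emb N.+2 0 f ** swp A N.+2 N)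
     ** emb N.+2 N (u, 1%g)) =
  phi1 (swp A N.+2 N ** emb N.+2 0 f ** swp A N.+2 N
     ** emb N.+2 N ((mix u v, 1%g) ** (pure2 1 κV, 1%g))).
Proof.
have le : (N + 2 <= N.+2)%N by lia.
set g := swp A _ _ ** _ ** _.
move: u; apply: tens2_ext.
- by lin_phi.
- apply: lin_fst_phi1; apply: lin_fst_mulr; apply: lin_fst_emb; apply: lin_fst_mull.
  by apply: lin_fst_pair; apply: mix_linl.
move=> a b; move: v; apply: tens2_ext.
- by lin_phi.
- apply: lin_fst_phi1; apply: lin_fst_mulr; apply: lin_fst_emb; apply: lin_fst_mull.
  by apply: lin_fst_pair; apply: mix_linr.
move=> c d; rewrite mix_pure2.
have -> : @ambM k A 2 (pure2 (c * a) (b * κ * d), 1%g) (pure2 1 κV, 1%g) =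
    (pure2 (c * a) (b * κ * d * κV), 1%g).
  by rewrite /ambM /= tact1 pure2M mulr1 mulg1.
rewrite !pureB //.
(* Strand N of [g] is a straight open strand, so its beads pass through. *)
have gc z : bead N.+2 N z ** g = g ** bead N.+2 N z.
  rewrite /g -!ambA swp_bead // [emb _ 0 f ** (bead _ _ _ ** _)]ambA.
  rewrite -bead_emb_comm; [|lia|lia].
  by rewrite -!ambA [RHS]ambA -bead_swp // -!ambA.
rewrite (@bead_comm N.+2 N N.+1 c d); last lia.
rewrite -!ambA [X in phi1 (bead _ _ _ ** X)](_ : _ = bead N.+2 N c ** (g ** (bead
  N.+2 N a ** bead N.+2 N.+1 b))); last by rewrite /g -!ambA.
(* Going around the closed strand conjugates [d] by κ; the κ on the left of [d] is the one recorded
   in [mix], the inverse on its right is the last factor of the statement. *)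
rewrite (@phi1_bead _ _ X _ _ (κ * d * κV)); last by rewrite -mulrA xckVK mulr1.
rewrite [bead N.+2 N c ** _]ambA gc -!ambA beadM.
rewrite (ambA (bead N.+2 N c)) beadM.
by rewrite !mulrA.
Qed.

Lemma phi1_crossing e N (f : amb N.+1) :
  phi1 (crossing (~~ e) N.+2 N ** emb N.+2 0 f ** crossing e N.+2 N) = emb N.+1 0
    (phi1 f).
Proof.
have le : (N + 2 <= N.+2)%N by lia.
rewrite /crossing rhatVE rhatE !embM // -/(swp _ _ _).
have := phi1_crossing_sub f (rho e) (rhoV e); rewrite -!ambA => ->.
(* The κ left by [mix_rho] cancels the inverse that came from sliding. *)
rewrite mix_rho !ambA [X in emb _ N X](_ : _ = amb1 A 2); last first.
  by rewrite /ambM /= tact1 pure2M mulg1 mulr1 xckK pure2_ptens amb1E;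
    apply: amb_eq => // i; case: ifP.
by rewrite emb1 // ambm1 phi1_swp.
Qed.

End Crossings.

(** * Braid relations and the closure of a single crossing *)

Section Relations.
Variables (k : comPzRingType) (A : kalgebra k) (X : traced_XCalgebra A).
Local Notation amb := (amb A).
Local Infix "**" := (@ambM k A _) (at level 40, left associativity).
Local Notation phi1 := (@traced_phi1 k A X _).
Local Notation crossing := (@crossing k A X).
Local Notation "'κ'" := (xck X).
Local Notation κV := (xckV X).
Local Notation sw := (tperm ord0 ord_max : 'S_2).

Lemma crossingK e N i : (i + 2 <= N)%N -> crossing e N i ** crossing (~~ e) N i =
  amb1 A N.
Proof. by move=> le; rewrite /crossing -embM // rhatK emb1. Qed.
Lemma emb_crossing e N p M i : (i + 2 <= M)%N -> (p + M <= N)%N ->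
  emb N p (crossing e M i) = crossing e N (p + i).
Proof. by move=> le le'; rewrite /crossing emb_emb. Qed.

Lemma tlift_embed2 n (i j : 'I_n) (u : tpow A 2) : j = i.+1 :> nat ->
  embed2 i j u = tlift n i u /\ embed2 j i u = tlift n i (flip u).
Proof.
move=> ji; have le : (i + 2 <= n)%N by have := ltn_ord j; lia.
have nij : i != j by rewrite -val_eqE /= ji ltn_eqF.
have [l1 e1] := @embed2_pure2 k A n i j nij.
have [l2 e2] : linear (embed2 (A := A) j i) /\ forall a b,
  embed2 (A := A) j i (pure2 a b) =
    pure [ffun l => if l == j then a else if l == i then b else 1].
  by apply: embed2_pure2; rewrite eq_sym.
split; move: u; apply: tpow2_ext => // [|a b].
- exact: tlift_linear.
- rewrite e1 pure2_ptens tlift_ptens //; congr pure; apply/ffunP => l; rewrite !ffunE.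
  rewrite -!val_eqE /= ji; case: (l =P i :> nat) => [->|h].
    by rewrite leqnn subnn (_ : (i < i + 2)%N) //; lia.
  case: (l =P i.+1 :> nat) => [->|h']; last by case: ifP => // ?; lia.
  by rewrite leqnSn subSnn (_ : (i.+1 < i + 2)%N) //; lia.
- by move=> c u v; rewrite flip_linear tlift_linear.
rewrite e2 flip_pure2 pure2_ptens tlift_ptens //; congr pure; apply/ffunP => l;
  rewrite !ffunE.
rewrite -!val_eqE /= ji; case: (l =P i.+1 :> nat) => [->|h].
  by rewrite leqnSn subSnn (_ : (i.+1 < i + 2)%N) //; lia.
case: (l =P i :> nat) => [->|h']; last by case: ifP => // ?; lia.
by rewrite leqnn subnn (_ : (i < i + 2)%N) //; lia.
Qed.

Lemma elift_tperm n (i j : 'I_n) : j = i.+1 :> nat -> elift n i sw = tperm i j.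
Proof.
move=> ji; have le : (i + 2 <= n)%N by have := ltn_ord j; lia.
apply: pn_eq => l lt; rewrite pn_elift // pn_tperm01.
rewrite -[l in RHS]/(val (Ordinal lt)) pnE.
have := ltn_ord j; case: tpermP => [/(congr1 val)|/(congr1 val)|] /=;
  do ?case: ifP => ?; try lia.
all: by move=> h1 h2; move/eqP: h1; move/eqP: h2; rewrite -!val_eqE /=; lia.
Qed.

Lemma braid_genE n (f : amb n) :
  braid_gen X f <-> exists i e, (i + 2 <= n)%N /\ f = crossing e n i.
Proof.
split=> [[i [j [ji [->|->]]]]|[i [e [le ->]]]].
- exists i, true; split; first by have := ltn_ord j; lia.
  by rewrite /crossing /emb /= (elift_tperm ji) (tlift_embed2 _ ji).1.
- exists i, false; split; first by have := ltn_ord j; lia.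
  by rewrite /crossing /emb /= (elift_tperm ji) (tlift_embed2 _ ji).2.
have lti : (i < n)%N by lia.
have ltj : (i.+1 < n)%N by lia.
exists (Ordinal lti), (Ordinal ltj); split=> //.
have ji : Ordinal ltj = (Ordinal lti).+1 :> nat by [].
rewrite -(elift_tperm ji) (tlift_embed2 _ ji).1 (tlift_embed2 _ ji).2.
by case: e; [left|right].
Qed.

Lemma tact_embed2 n (s : 'S_n) (i j : 'I_n) (u : tpow A 2) : i != j ->
  tact s (embed2 i j u) = embed2 ((s^-1)%g i) ((s^-1)%g j) u.
Proof.
move=> ij; have ij' : (s^-1)%g i != (s^-1)%g j by rewrite (inj_eq perm_inj).
have [l1 e1] := @embed2_pure2 k A n i j ij.
have [l2 e2] := @embed2_pure2 k A n _ _ ij'.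
move: u; apply: tpow2_ext => // [c u v|a b]; first by rewrite l1 tact_linear.
rewrite e1 e2 /tact teval_pure; last exact: tact_multilinear.
congr pure; apply/ffunP => l; rewrite !ffunE.
by rewrite -!(inj_eq (@perm_inj _ s) l) !permKV.
Qed.

(** Collecting the permutations renumbers the tensor factors carrying R, and the two sides become
    those of (XC3). *)
Lemma YB3 : crossing true 3 0 ** crossing true 3 1 ** crossing true 3 0 =
  crossing true 3 1 ** crossing true 3 0 ** crossing true 3 1.
Proof.
pose i0 : 'I_3 := ord0; pose i1 : 'I_3 := inord 1; pose i2 : 'I_3 := ord_max.
have v1 : i1 = 1%N :> nat by rewrite inordK.
have E0 : crossing true 3 0 = (embed2 i0 i1 (xcR X), tperm i0 i1).
  have h : i1 = i0.+1 :> nat by rewrite v1.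
  by rewrite /crossing /emb /= (elift_tperm h) (tlift_embed2 _ h).1.
have E1 : crossing true 3 1 = (embed2 i1 i2 (xcR X), tperm i1 i2).
  have h : i2 = i1.+1 :> nat by rewrite v1.
  by rewrite -(elift_tperm h) (tlift_embed2 _ h).1 v1.
have [n01 n12 n02] : [/\ i0 != i1, i1 != i2 & i0 != i2] by rewrite -!val_eqE /= v1.
have D0 : tperm i0 i1 i2 = i2 by rewrite tpermD // eq_sym.
have D1 : tperm i1 i2 i0 = i0 by rewrite tpermD // eq_sym.
have := XC3 X; rewrite /= -/i0 -/i1 -/i2 => YB.
rewrite E0 E1 /ambM /=; congr pair; last first.
  apply/permP => i; rewrite !permM.
  have [->|[->|->]] : i = i0 \/ i = i1 \/ i = i2.
  - by case: i => -[|[|[|]]] // lt; [left|right;left|right;right]; apply: val_inj;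
      [|exact: esym v1|].
  - by do ?rewrite ?tpermL ?tpermR ?D0 ?D1.
  - by do ?rewrite ?tpermL ?tpermR ?D0 ?D1.
  - by do ?rewrite ?tpermL ?tpermR ?D0 ?D1.
rewrite !tactM !tact_embed2 ?tpermV // ?(inj_eq perm_inj) //.
by rewrite !(tpermL, tpermR, D0, D1) -YB.
Qed.

Lemma amb_inv_uniq n (f g h : amb n) : f ** g = amb1 A n -> g ** h = amb1 A n -> f = h.
Proof. by move=> fg gh; rewrite -[f]ambm1 -gh ambA fg amb1m. Qed.

(** For the inverse crossings, both sides are inverse to the same word in positive crossings, hence
    equal. *)
Lemma crossing_braid e N i : (i + 3 <= N)%N ->
  crossing e N i ** crossing e N i.+1 ** crossing e N i =
  crossing e N i.+1 ** crossing e N i ** crossing e N i.+1.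
Proof.
move=> le; have YB : crossing true N i ** crossing true N i.+1 ** crossing true N i =
  crossing true N i.+1 ** crossing true N i ** crossing true N i.+1.
  have := congr1 (@emb k A N i 3) YB3; rewrite !embM //; rewrite !emb_crossing //.
  by rewrite addn0 addn1.
case: e => //.
have [le1 le2] : (i + 2 <= N)%N /\ (i.+1 + 2 <= N)%N by lia.
have K e f j : (j + 2 <= N)%N -> f ** crossing e N j ** crossing (~~ e) N j = f.
  by move=> lej; rewrite -ambA crossingK // ambm1.
apply: (@amb_inv_uniq _ _ (crossing true N i ** crossing true N i.+1 ** crossing true
  N i)).
  by rewrite !ambA (K false) // (K false) // (@crossingK false).
by rewrite YB !ambA (K true) // (K true) // (@crossingK true).
Qed.

Lemma bead_linear N i : (i < N)%N -> linear (fun a : A => (bead N i a).1).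
Proof.
move=> lt c a b; pose y := [ffun j : 'I_N => 1 : A].
have E z : (bead N i z).1 = pure (upd y (Ordinal lt) z).
  by congr pure; apply/ffunP => j; rewrite !ffunE.
by rewrite !E pure_multilinear.
Qed.
Lemma emb_bead N p M i (a : A) : (p + M <= N)%N -> (i < M)%N -> emb N p (bead M i a)
  = bead N (p + i) a.
Proof.
move=> le lt; rewrite embE // /bead; apply: amb_eq => j jN; last first.
  by rewrite pn_elift // !pn1; case: ifP => // ?; lia.
case: (j =P (p + i)%N) => [->|ne]; last by do ?case: ifP => ?; try lia.
by rewrite leq_addr ltn_add2l lt addKn eqxx.
Qed.

(** Each bead goes around its own closed strand and is conjugated by κ. For the beads of a crossing
    (XC0) makes this invisible, see [rho_conj]. *)
Lemma phi1_phi1_bead N (f : amb N.+2) u :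
  phi1 (phi1 (emb N.+2 N (u, 1%g) ** f)) =
  phi1 (phi1 (f ** emb N.+2 N (pure2 κ κ * u * pure2 κV κV, 1%g))).
Proof.
have le : (N + 2 <= N.+2)%N by lia.
move: u; apply: tens2_ext; first by lin_phi.
  do 2!apply: lin_fst_phi1; apply: lin_fst_mulr; apply: lin_fst_emb;
    apply: lin_fst_pair.
  by move=> c u v; rewrite tmul_linDr tmul_linDl.
move=> a b; rewrite !pure2M !pureB //.
have be (z : A) : bead N.+2 N z = emb N.+2 0 (bead N.+1 N z) by rewrite emb_bead //;
  lia.
rewrite (@bead_comm _ _ N.+2 N N.+1 a b); last lia.
rewrite -ambA (@phi1_bead _ _ _ _ _ (κ * b * κV)); last by rewrite -mulrA xckVK mulr1.
rewrite -ambA be phi1_natl (@phi1_bead _ _ _ _ _ (κ * a * κV));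
  last by rewrite -mulrA xckVK mulr1.
rewrite -phi1_natr -be -ambA (@bead_comm _ _ N.+2 N N.+1) //; lia.
Qed.

Lemma rho_conj e : pure2 κ κ * rho X e * pure2 κV κV = rho X e.
Proof.
case: e => /=; first by rewrite -XC0.
by rewrite [in RHS]XC0V /flip !tactM -!/(flip _) !flip_pure2.
Qed.

Lemma crossing_swp e N i : (i + 2 <= N)%N ->
  crossing e N i = swp A N i ** emb N i (rho X e, 1%g).
Proof. by move=> le; rewrite /crossing rhatE embM. Qed.

Lemma phi1_phi1_crossing e N (f : amb N.+2) :
  phi1 (phi1 (crossing e N.+2 N ** f)) = phi1 (phi1 (f ** crossing e N.+2 N)).
Proof.
rewrite crossing_swp; last lia.
by rewrite -ambA phi1_phi1_swp -ambA phi1_phi1_bead rho_conj ambA.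
Qed.

Lemma lin_fst_bead (M : lmodType k) N i (T : M -> A) : (i < N)%N -> linear T ->
  lin_fst (fun u => bead N i (T u)).
Proof. by move=> lt lT; split=> // c u v; rewrite lT bead_linear. Qed.

Lemma phi1_swap2 (a b : A) :
  phi1 (ptens 2 (fun i => if i == 0%N then a else b), sw) = bead 1 0 (b * κ * a).
Proof.
rewrite phi1_ptens pn_tperm01 /= /bead; apply: amb_eq => -[|i] // _; last first.
  by rewrite pn_cut // !pn_tperm01 pn1.
by rewrite pn_tperm01.
Qed.

(** Closing produces the left-hand side of (XC1f); [xcnu] is its right-hand side. *)
Lemma phi1_rhat : phi1 (rhat X true) = bead 1 0 (xcnu X).
Proof.
have [f1 f2] : (forall b, linear (fun a : A =>
  b * κ * a)) /\ (forall a, linear (fun b : A => b * κ * a)).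
  by split=> [b|a] c x y; rewrite ?mulrDl ?mulrDr -?kscalerAl -?kscalerAr //
    -?kscalerAl // ?mulrDl.
have [l1 e1] := tsum2_pure2 f1 f2.
rewrite /xcnu -XC1f /rhat /=; move: (xcR X); apply: tens2_ext.
- by lin_phi.
- by apply: lin_fst_bead.
by move=> a b; rewrite e1 pure2_ptens phi1_swap2.
Qed.

(* x kappa^-1 y applied to (XC2d), with nu = \sum a kappa^-1 b *)
Lemma phi1_rhatV : phi1 (bead 2 1 (xcnu X) ** rhat X false) = amb1 A 1.
Proof.
pose f a b := a * κV * b : A.
have [f1 f2] : (forall b, linear (f^~ b)) /\ (forall a, linear (f a)).
  by split=> [b|a] c x y; rewrite /f ?mulrDl ?mulrDr -?kscalerAl -?kscalerAr //
    -?kscalerAl // ?mulrDl.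
have [l1 e1] := tsum2_pure2 f1 f2.
suff E u v : phi1 (bead 2 1 (tsum2 f u) ** ((v,
  1%g) ** swap2 A)) = bead 1 0 (tsum2 f (mix' X u v)).
  rewrite (@rhatVE _ _ X true) /xcnu E mix'_R e1 /f mulr1 xckK /bead amb1E.
  by apply: amb_eq => // i lt; case: ifP.
move: u; apply: tens2_ext.
- by apply: lin_fst_phi1; apply: lin_fst_mull; apply: lin_fst_bead.
- by apply: lin_fst_bead => // c u w; rewrite mix'_linl l1.
move=> a b; move: v; apply: tens2_ext.
- by lin_phi.
- by apply: lin_fst_bead => // c u w; rewrite mix'_linr l1.
move=> c d; rewrite mix'_pure2 !e1 /swap2 -ptens1 pure2_ptens ambME /bead ambME.
rewrite (_ : (_ * _)%g = sw); last by rewrite !mulg1.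
rewrite (_ : ptens 2 _ = ptens 2 (fun i => if i == 0%N then f a b * d else c));
  last first.
  apply: eq_ptens => -[|[|i]] // _; rewrite !pn_tperm01 /= ?mulr1 ?mul1r //.
by rewrite mulg1 phi1_swap2 /f /bead !mulrA.
Qed.

End Relations.

(** * Block braidings and closures of several strands *)

Section Braids.
Variables (k : comPzRingType) (A : kalgebra k) (X : traced_XCalgebra A).
Local Notation amb := (amb A).
Local Notation "f ** g" := (@ambM k A _ f g) (at level 40, left associativity).
Local Notation phi1 := (@traced_phi1 k A X _).
Local Notation crossing := (@crossing k A X).
Implicit Types (e : bool).
Local Open Scope nat_scope.

Fixpoint phi_rec m n : amb (m + n) -> amb n :=
  match m with
  | 0 => id
  | m'.+1 => fun f => @phi_rec m' n (phi1 f)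
  end.

(* closure of the last N - n strands *)
Definition phi N n (f : amb N) : amb n := phi_rec (emb (N - n + n) 0 f).

Lemma phi_id n (f : amb n) : phi n f = f.
Proof.
suff H m : m = 0 -> phi_rec (emb (m + n) 0 f) = f by apply: H; lia.
by move=> ->; rewrite /= emb_id.
Qed.
Lemma phiS N n (f : amb N.+1) : n <= N -> phi n f = phi n (phi1 f).
Proof.
move=> le; rewrite /phi; have e : N.+1 - n = (N - n).+1 by lia.
rewrite e; have e' : N = N - n + n by lia.
move: (N - n) e' => m e'; subst N => /=.
by rewrite !emb_id.
Qed.

(** Induction on the number of closed strands. The predicate ranges over all N because [phi1]
    changes the type of its argument. *)
Lemma phi_ind (P : forall N n, amb N -> Prop) :
  (forall n (f : amb n), P n n f) ->
  (forall N n (f : amb N.+1), n <= N -> P N n (phi1 f) -> P N.+1 n f) ->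
  forall N n (f : amb N), n <= N -> P N n f.
Proof.
move=> P0 PS N n; elim: N => [|N IH] f le; first by move: f; have -> : n = 0 by lia.
move: le; rewrite leq_eqVlt => /orP[/eqP e|le]; first by move: f; rewrite -e.
by apply: PS => //; apply: IH.
Qed.

Lemma phi_phi N m n (f : amb N) : n <= m -> m <= N -> phi n (phi m f) = phi n f.
Proof.
move=> nm le; move: N m f le nm; apply: phi_ind => [m f|N m f le IH] nm.
  by rewrite phi_id.
by rewrite phiS // IH // -phiS //; lia.
Qed.

Lemma phi_natl N n (u : amb n) (f : amb N) : n <= N ->
  phi n (emb N 0 u ** f) = u ** phi n f.
Proof.
move=> le; move: N n f le u; apply: phi_ind => [n f|N n f le IH] u.
  by rewrite !phi_id emb_id.
have -> : emb N.+1 0 u = emb N.+1 0 (emb N 0 u) by rewrite emb_emb.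
rewrite phiS //.
by rewrite phi1_natl IH -phiS.
Qed.
Lemma phi_natr N n (u : amb n) (f : amb N) : n <= N ->
  phi n (f ** emb N 0 u) = phi n f ** u.
Proof.
move=> le; move: N n f le u; apply: phi_ind => [n f|N n f le IH] u.
  by rewrite !phi_id emb_id.
have -> : emb N.+1 0 u = emb N.+1 0 (emb N 0 u) by rewrite emb_emb.
rewrite phiS //.
by rewrite phi1_natr IH -phiS.
Qed.
Lemma phi_emb N n p M m (f : amb M) : m <= M -> p + M = N -> p + m = n ->
  phi n (emb N p f) = emb n p (phi m f).
Proof.
move=> le; move: M m f le N n; apply: phi_ind => [m f|M m f le IH] N n eN en.
  by subst; rewrite !phi_id.
case: N eN => [|N] eN; first lia.
by rewrite phiS ?phi1_emb ?(@phiS M) ?(IH N n) //; lia.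
Qed.
Lemma phiZ N n c (f : amb N) : n <= N -> phi n (ambZ c f) = ambZ c (phi n f).
Proof.
move=> le; move: N n f le; apply: phi_ind => [n f|N n f le IH].
  by rewrite !phi_id.
by rewrite phiS // phi1Z IH -phiS.
Qed.
Lemma traced_phiE n m (f : amb (n + m)) : traced_phi X f = phi n f.
Proof.
elim: m f => [|m IH] f /=.
  rewrite amb_castE -[LHS]phi_id; move: f; move: (n + 0) (addn0 n) => N -> f.
  by rewrite emb_id.
rewrite IH amb_castE -phiS ?leq_addr //.
by move: f; move: (n + m.+1) (addnS n m) => N -> f; rewrite emb_id.
Qed.

(** Closing the strands after the crossing is a bimodule map, so the crossing may be assumed to lie
    on the last two strands, where [phi1_phi1_crossing] applies. *)
Lemma phi_slide2 e N n i (f : amb N) : n <= i -> i + 2 <= N ->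
  phi n (crossing e N i ** f) = phi n (f ** crossing e N i).
Proof.
move=> ni iN; have E : crossing e N i = emb N 0 (crossing e (i + 2) i).
  by rewrite emb_crossing.
rewrite E -(@phi_phi N (i + 2)) ?phi_natl //; last lia.
rewrite -[RHS](@phi_phi N (i + 2)) ?phi_natr //; last lia.
move: (phi (i + 2) f); rewrite addn2 => g.
rewrite !phiS; try lia.
by rewrite phi1_phi1_crossing.
Qed.

(* the crossing of one strand, at position p, over (e = true) or under the next m;
   locked, since unification would otherwise unfold br at 1 *)
Fixpoint br1_rec e N p m : amb N :=
  if m is m'.+1 then crossing e N (p + m') ** br1_rec e N p m' else amb1 A N.
Definition br1 e N p m : amb N := locked (br1_rec e N p m).
Fixpoint br_rec e N p n m : amb N :=
  if n is n'.+1 then br1 e N p m ** br_rec e N p.+1 n' m else amb1 A N.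
Definition br e N p n m : amb N := locked (br_rec e N p n m).

Lemma br10 e N p : br1 e N p 0 = amb1 A N. Proof. by rewrite /br1 -lock. Qed.
Lemma br1S e N p m : br1 e N p m.+1 = crossing e N (p + m) ** br1 e N p m.
Proof. by rewrite /br1 -!lock. Qed.
Lemma br0 e N p m : br e N p 0 m = amb1 A N. Proof. by rewrite /br -lock. Qed.
Lemma brS e N p n m : br e N p n.+1 m = br1 e N p m ** br e N p.+1 n m.
Proof. by rewrite /br -!lock. Qed.
Definition brE := (br10, br0, br1S, brS).

Lemma emb_br1 e N q M p m : p + m < M -> q + M <= N ->
  emb N q (br1 e M p m) = br1 e N (q + p) m.
Proof.
move=> lt le; elim: m lt => [|m IH] lt; rewrite !brE ?emb1 //.
rewrite embM // IH; last lia.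
by rewrite emb_crossing ?addnA //; lia.
Qed.
Lemma emb_br e N q M p n m : p + n + m <= M -> q + M <= N ->
  emb N q (br e M p n m) = br e N (q + p) n m.
Proof.
move=> lt le; elim: n p lt => [|n IH] p lt; rewrite !brE ?emb1 //.
by rewrite embM // IH ?emb_br1 ?addnS //; lia.
Qed.
Lemma br_emb e N p n m : p + n + m <= N -> br e N p n m = emb N p (br e (n + m) 0 n m).
Proof. by move=> le; rewrite emb_br ?addn0 //; lia. Qed.
Lemma br1_emb e N p m : p + m < N -> br1 e N p m = emb N p (br1 e m.+1 0 m).
Proof. by move=> le; rewrite emb_br1 ?addn0 //; lia. Qed.
Lemma br1E e N p m : br e N p 1 m = br1 e N p m.
Proof. by rewrite !brE ambm1. Qed.
Lemma br_0 e N p n : br e N p n 0 = amb1 A N.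
Proof. by elim: n p => [|n IH] p; rewrite !brE ?amb1m. Qed.

Lemma emb_br_comm e N p n (f : amb n) q a b :
    p + n <= q /\ q + a + b <= N \/ q + a + b <= p /\ p + n <= N ->
  emb N p f ** br e N q a b = br e N q a b ** emb N p f.
Proof.
move=> h; rewrite (@br_emb e N q a b); last lia.
by case: h => [[h1 h2]|[h1 h2]]; [|apply: esym]; apply: emb_comm; lia.
Qed.

Lemma brDl e N p n n' m : br e N p (n + n') m = br e N p n m ** br e N (p + n) n' m.
Proof.
elim: n p => [|n IH] p; first by rewrite brE addn0 amb1m.
by rewrite !brE IH addSnnS ambA.
Qed.
Lemma br1D e N p m m' : br1 e N p (m + m') = br1 e N (p + m) m' ** br1 e N p m.
Proof.
elim: m' => [|m' IH]; first by rewrite brE addn0 amb1m.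
by rewrite addnS !brE IH addnA ambA.
Qed.
Lemma brDr e N p n m m' : p + n + m + m' <= N ->
  br e N p n (m + m') = br e N (p + m) n m' ** br e N p n m.
Proof.
elim: n p => [|n IH] p le; rewrite !brE ?amb1m //.
rewrite IH ?br1D; last lia.
rewrite -!ambA; congr (_ ** _); rewrite !ambA; congr (_ ** _).
by rewrite (@br1_emb e N p m) ?emb_br_comm //; lia.
Qed.

Lemma br_K e N p n m : p + n + m <= N -> br e N p n m ** br (~~ e) N p m n = amb1 A N.
Proof.
have br1K q m' : q + m' < N -> br1 e N q m' ** br (~~ e) N q m' 1 = amb1 A N.
  elim: m' q => [|m' IH] q le; first by rewrite !brE amb1m.
  have -> : br1 e N q m'.+1 = br1 e N q.+1 m' ** crossing e N q.
    by rewrite -add1n br1D !brE ambm1 addn0 addn1.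
  rewrite brS !br1S br10 ambm1 addn0 -ambA (ambA (crossing _ _ _)).
  by rewrite crossingK ?amb1m ?IH //; lia.
elim: n p => [|n IH] p le; first by rewrite br0 br_0 amb1m.
have -> : br (~~ e) N p m n.+1 = br (~~ e) N p.+1 m n ** br (~~ e) N p m 1.
  by rewrite -add1n brDr ?addn1 //; lia.
rewrite brS -ambA (ambA (br _ _ _ _ _)) IH; last lia.
by rewrite amb1m br1K //; lia.
Qed.

(** Naturality of the block braiding in each variable separately, the other argument being an
    identity; naturality in both variables results by composition. *)
Definition natural n (f : amb n) : Prop := forall e m,
  br e (n + m) 0 n m ** emb (n + m) 0 f = emb (n + m) m f ** br e (n + m) 0 n m /\
  br e (m + n) 0 m n ** emb (m + n) m f = emb (m + n) 0 f ** br e (m + n) 0 m n.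

Lemma natural_l n (f : amb n) e N p m : natural f -> p + n + m <= N ->
  br e N p n m ** emb N p f = emb N (p + m) f ** br e N p n m.
Proof.
move=> nf le; have := congr1 (@emb k A N p _) (nf e m).1.
by rewrite !embM ?emb_emb ?emb_br ?addn0 //; lia.
Qed.
Lemma natural_r n (f : amb n) e N p m : natural f -> p + m + n <= N ->
  br e N p m n ** emb N (p + m) f = emb N p f ** br e N p m n.
Proof.
move=> nf le; have := congr1 (@emb k A N p _) (nf e m).2.
by rewrite !embM ?emb_emb ?emb_br ?addn0 //; lia.
Qed.

Lemma natural1 n : natural (amb1 A n).
Proof. by move=> e m; rewrite !emb1 ?amb1m ?ambm1 //; lia. Qed.
Lemma naturalM n (f g : amb n) : natural f -> natural g -> natural (f ** g).
Proof.
move=> nf ng e m; rewrite !embM ?ambA; try lia.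
by rewrite (nf e m).1 (nf e m).2 -!ambA (ng e m).1 (ng e m).2.
Qed.
Lemma naturalZ n c : natural (ambZ c (amb1 A n)).
Proof. by move=> e m; rewrite !embZ !emb1 ?ambZl ?ambZr ?amb1m ?ambm1 //; lia. Qed.

(** The braiding of p + n + q strands splits into three factors: [f] passes through the middle one
    and is disjoint from the other two when it meets them. *)
Lemma natural_emb N p n (f : amb n) : p + n <= N -> natural f -> natural (emb N p f).
Proof.
move=> le nf e m; have [q eN] : exists q, N = p + n + q by exists (N - (p + n)); lia.
subst N; split.
  rewrite !emb_emb ?add0n; try lia.
  rewrite !brDl add0n -!ambA.
  rewrite -emb_br_comm; last lia.
  rewrite (ambA (br _ _ p n m)) natural_l //; last lia.
  rewrite !ambA -emb_br_comm; last lia.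
  by rewrite [m + p]addnC.
rewrite !emb_emb ?add0n; try lia.
rewrite !brDr; try lia.
rewrite -!ambA -[X in _ ** (_ ** X)]emb_br_comm; last lia.
rewrite (ambA (br _ _ (0 + p) _ _)) add0n (addnC m p) natural_r //; last lia.
by rewrite !ambA -emb_br_comm //; lia.
Qed.

(** Induction on the number of added strands: the outermost pair of crossings cancels by
    [phi1_crossing]. *)
Lemma phi1_superpose e n m (f : amb n.+1) :
  phi1 (br1 (~~ e) (n + m).+1 n m ** emb (n + m).+1 0 f ** br e (n + m).+1 n m 1)
    = emb (n + m) 0 (phi1 f).
Proof.
elim: m f => [|m IH] f.
  by rewrite !brE ambm1 amb1m (@phi1_emb _ _ _ 0 (n + 0)) // addn0.
rewrite br1S.
have E0 N' : br e N' n m.+1 1 = br e N' n m 1 ** crossing e N' (n + m).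
  by rewrite -(addn1 m) brDl !brE !ambm1 addn0.
rewrite E0.
rewrite -[LHS]/(phi1 _) addnS.
have E e' p a b : p + a + b <= (n + m).+1 ->
    br e' (n + m).+2 p a b = emb (n + m).+2 0 (br e' (n + m).+1 p a b).
  by move=> le; rewrite emb_br.
have E1 : br1 (~~ e) (n + m).+2 n m = emb (n + m).+2 0 (br1 (~~ e) (n + m).+1 n m).
  by rewrite emb_br1 //; lia.
rewrite E1 !E; try lia.
have -> : emb (n + m).+2 0 f = emb (n + m).+2 0 (emb (n + m).+1 0 f).
  by rewrite emb_emb //; lia.
set b := br1 (~~ e) _ _ _; set b' := br e _ _ _ _.
rewrite !ambA -(ambA (crossing _ _ _)) -embM // -(ambA (crossing _ _ _)) -embM //.
rewrite phi1_crossing IH emb_emb //; lia.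
Qed.

(** The crossings of the strand closed first are innermost; the remaining ones do not touch it and
    leave [phi1] as left and right factors. *)
Lemma phi_superpose e N n m (f : amb N) : n <= N ->
  phi (n + m) (br (~~ e) (N + m) n (N - n) m ** emb (N + m) 0 f ** br e (N + m) n m
    (N - n))
    = emb (n + m) 0 (phi n f).
Proof.
move=> le; move: N n f le; apply: phi_ind => [n f|N n f le IH].
  by rewrite subnn br_0 brE amb1m ambm1 !phi_id.
have [U eN] : exists U, N = n + U by exists (N - n); lia.
have eU : N.+1 - n = U + 1 by lia.
have eU' : N - n = U by lia.
rewrite eU eU' in IH *.
rewrite brDl brDr -?eN ?br1E; last lia.
rewrite (@phiS (N + m)); last lia.
have E e' p a b : p + a + b <= N + m ->
    br e' (N + m).+1 p a b = emb (N + m).+1 0 (br e' (N + m) p a b).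
  by move=> le'; rewrite emb_br.
rewrite (E _ n U m) ?(E _ n m U); try lia.
rewrite -!ambA phi1_natl !ambA phi1_natr phi1_superpose.
rewrite ambA IH.
by rewrite -phiS.
Qed.

(** Superposing writes [phi1 f] beside m strands as the closure of [f] conjugated by the braiding of
    its last strand. With the braiding of the other n strands this makes up the braiding of n + 1
    strands, through which [f] passes. *)
Lemma natural_phi1 n (f : amb n.+1) : natural f -> natural (phi1 f).
Proof.
move=> nf e m; split.
  have := phi1_superpose (~~ e) m f; rewrite negbK => <-.
  rewrite -phi1_natl emb_br ?add0n; try lia.
  have E0 N' : br e N' 0 n.+1 m = br e N' 0 n m ** br1 e N' n m.
    by rewrite -(addn1 n) brDl br1E.
  rewrite !ambA -E0 natural_l //.
  (* Once [f] has passed, the braiding of the last strand meets its inverse. *)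
  rewrite E0 -!ambA -br1E br_K ?ambm1; last lia.
  rewrite -[X in _ ** X](@emb_br _ _ 0 (n + m)) ?phi1_natr; try lia.
  by rewrite add0n phi1_emb // addnC.
have E0 N' : m + n.+1 <= N' -> br e N' 0 m n.+1 = br e N' n m 1 ** br e N' 0 m n.
  by move=> le; rewrite -(addn1 n) brDr //; lia.
rewrite (addnC m n) -(phi1_superpose e) -phi1_natr emb_br ?add0n; try lia.
rewrite -!ambA -E0; last lia.
rewrite -[m]/(0 + m) -natural_r //; last lia.
rewrite E0 ?ambA -?br1E; last lia.
have := @br_K (~~ e) (n + m).+1 n 1 m; rewrite negbK => ->; last lia.
rewrite amb1m -[br e _ 0 m n](@emb_br _ _ 0 (n + m)) ?phi1_natl; try lia.
by rewrite (@phi1_emb _ _ _ m (n + m)) // addnC.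
Qed.

Lemma natural_phi N n (f : amb N) : n <= N -> natural f -> natural (phi n f).
Proof.
move=> le; move: N n f le; apply: phi_ind => [n f|N n f le IH] nf.
  by rewrite phi_id.
by rewrite phiS //; apply: IH; apply: natural_phi1.
Qed.

(** Induction on m: moving the crossing past one more strand is a braid relation. *)
Lemma br2_crossing e N p m : p + 2 + m <= N ->
  br e N p 2 m ** crossing e N p = crossing e N (p + m) ** br e N p 2 m.
Proof.
elim: m p => [|m IH] p le; first by rewrite br_0 ambm1 amb1m addn0.
rewrite -(addn1 m) brDr; last lia.
rewrite -ambA IH; last lia.
rewrite !ambA; congr (_ ** _).
rewrite !brE !ambm1 !addn0 crossing_braid ?addn1 ?addnS ?ambA //; lia.
Qed.
Lemma br_crossing2 e N p m : p + 2 + m <= N ->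
  br e N p m 2 ** crossing e N (p + m) = crossing e N p ** br e N p m 2.
Proof.
elim: m p => [|m IH] p le; first by rewrite brE ambm1 amb1m addn0.
have E : br e N p m.+1 2 = br e N p m 2 ** br1 e N (p + m) 2.
  by rewrite -(addn1 m) brDl br1E.
rewrite E -[LHS]ambA.
have -> : br1 e N (p + m) 2 ** crossing e N (p + m.+1) = crossing e N (p + m) ** br1
  e N (p + m) 2.
  rewrite !brE !ambm1 !addn0 addn1 addnS -crossing_braid ?ambA //; last lia.
by rewrite !ambA IH //; lia.
Qed.

Lemma intertwine_inv n (b x x' y y' : amb n) : b ** x = y ** b ->
  x ** x' = amb1 A n -> y' ** y = amb1 A n -> b ** x' = y' ** b.
Proof. by move=> h xx yy; rewrite -[LHS]amb1m -yy -ambA (ambA y) -h -ambA xx ambm1. Qed.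

(** The braid relation covers crossings of the same sign as the braiding. Those of opposite sign are
    their inverses, and intertwining passes to inverses. *)
Lemma natural_crossing2 e' : natural (crossing e' 2 0).
Proof.
suff H e : (forall m, br e (2 + m) 0 2 m ** emb (2 + m) 0 (crossing e 2 0) =
     emb (2 + m) m (crossing e 2 0) ** br e (2 + m) 0 2 m) /\
   (forall m, br e (m + 2) 0 m 2 ** emb (m + 2) m (crossing e 2 0) =
     emb (m + 2) 0 (crossing e 2 0) ** br e (m + 2) 0 m 2).
  move=> e m; have [/(_ m) h1 /(_ m) h2] := H e.
  have [->|->] : e' = e \/ e' = ~~ e by case: e' e {h1 h2} => -[]; auto.
    by [].
  have K N p : p + 2 <= N -> emb N p (crossing e 2 0) ** emb N p (crossing (~~ e) 2
    0) = amb1 A N.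
    by move=> le; rewrite !emb_crossing // crossingK //; lia.
  have K' N p : p + 2 <= N -> emb N p (crossing (~~ e) 2 0) ** emb N p (crossing e 2
    0) = amb1 A N.
    by move=> le; have := @crossingK _ _ X (~~ e);
      rewrite negbK !emb_crossing // => -> //; lia.
  by split; [apply: (intertwine_inv h1)|apply: (intertwine_inv h2)];
    rewrite ?K ?K' //; lia.
split=> m; rewrite !emb_crossing ?add0n ?addn0; try lia.
  by rewrite br2_crossing //; lia.
by rewrite (@br_crossing2 e _ 0 m) //; lia.
Qed.
Lemma natural_crossing e N i : i + 2 <= N -> natural (crossing e N i).
Proof.
move=> le; rewrite -[i]addn0 -(@emb_crossing _ _ _ e N i 2) //.
by apply: natural_emb => //; apply: natural_crossing2.
Qed.

End Braids.

(** * Twists *)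

Section Twists.
Variables (k : comPzRingType) (A : kalgebra k) (X : traced_XCalgebra A).
Local Notation amb := (amb A).
Local Notation "f ** g" := (@ambM k A _ f g) (at level 40, left associativity).
Local Notation phi1 := (@traced_phi1 k A X _).
Local Notation phi := (@phi k A X _).
Local Notation crossing := (@crossing k A X).
Local Notation br := (@br k A X).
Local Notation natural := (@natural k A X _).
Implicit Types (e : bool).
Local Open Scope nat_scope.

(** Naturality of the trace in the closed strands, required for all surrounding elements [g] so that
    it survives products and closures. *)
Definition slides n (f : amb n) : Prop := forall N r (g : amb N), r + n = N ->
  phi r (emb N r f ** g) = phi r (g ** emb N r f).

Lemma slides1 n : slides (amb1 A n).
Proof. by move=> N r g e; rewrite emb1 ?amb1m ?ambm1 //; lia. Qed.
Lemma slidesM n (f g : amb n) : slides f -> slides g -> slides (f ** g).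
Proof.
move=> sf sg N r h e; rewrite embM; last lia.
by rewrite -ambA sf // -ambA sg // ambA.
Qed.
Lemma slidesZ n c : slides (ambZ c (amb1 A n)).
Proof. by move=> N r g e; rewrite embZ emb1 ?ambZl ?ambZr ?amb1m ?ambm1 //; lia. Qed.
Lemma slides_crossing e n i : i + 2 <= n -> slides (crossing e n i).
Proof. by move=> le N r g eN; rewrite emb_crossing ?phi_slide2 //; lia. Qed.
(** The strand closed in [phi1 f] joins the r + n strands as one more closed strand, and [f] itself
    is slid. *)
Lemma slides_phi1 n (f : amb n.+1) : slides f -> slides (phi1 f).
Proof.
move=> sf N r g e; rewrite -phi1_emb // -phi1_natr -phi1_natl -!phiS; try lia.
by rewrite sf //; lia.
Qed.
Lemma slides_phi N n (f : amb N) : n <= N -> slides f -> slides (phi n f).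
Proof.
move=> le; move: N n f le; apply: phi_ind => [n f|N n f le IH] sf.
  by rewrite phi_id.
by rewrite phiS //; apply: IH; apply: slides_phi1.
Qed.

Definition Jmon_closed (P : forall n, amb n -> Prop) :=
  [/\ forall n, P n (amb1 A n), forall n f g, P n f -> P n g -> P n (f ** g)
    & forall e n i, i + 2 <= n -> P n (crossing e n i)].

Lemma Jmon_ind (P : forall n, amb n -> Prop) : Jmon_closed P ->
  forall n (f : amb n), Jmon X f -> P n f.
Proof.
move=> [P1 PM Px] n f; elim=> {f} [f /braid_genE[i [e [le ->]]]||f g _ Pf _ Pg].
- exact: Px.
- exact: P1.
- exact: PM.
Qed.

Lemma Jmon_natural n (f : amb n) : Jmon X f -> natural f.
Proof.
move: n f; apply: Jmon_ind; split=> [n|n f g|e n i].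
- exact: natural1.
- exact: naturalM.
- exact: natural_crossing.
Qed.
Lemma Jmon_slides n (f : amb n) : Jmon X f -> slides f.
Proof.
move: n f; apply: Jmon_ind; split=> [n|n f g|e n i].
- exact: slides1.
- exact: slidesM.
- exact: slides_crossing.
Qed.
Lemma Jmon1 n : Jmon X (amb1 A n). Proof. exact: submonoid_1. Qed.
Lemma JmonM n (f g : amb n) : Jmon X f -> Jmon X g -> Jmon X (f ** g).
Proof. exact: submonoid_M. Qed.
Lemma Jmon_crossing e n i : i + 2 <= n -> Jmon X (crossing e n i).
Proof. by move=> le; apply: submonoid_gen; apply/braid_genE; exists i, e. Qed.
Lemma Jmon_emb N p n (f : amb n) : p + n <= N -> Jmon X f -> Jmon X (emb N p f).
Proof.
move=> le Jf; move: n f Jf p N le.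
apply: (@Jmon_ind (fun n f => forall p N, p + n <= N -> Jmon X (emb N p f))).
split=> [n p N le|n f g Jf Jg p N le|e n i le p N le'].
- by rewrite emb1 //; apply: Jmon1.
- by rewrite embM //; apply: JmonM; [apply: Jf|apply: Jg].
- by rewrite emb_crossing //; apply: Jmon_crossing; lia.
Qed.
Lemma Jmon_br1 e N p m : p + m < N -> Jmon X (br1 X e N p m).
Proof.
elim: m => [|m IH] le; rewrite !brE; first exact: Jmon1.
by apply: JmonM; [apply: Jmon_crossing; lia|apply: IH; lia].
Qed.
Lemma Jmon_br e N p n m : p + n + m <= N -> Jmon X (br e N p n m).
Proof.
elim: n p => [|n IH] p le; rewrite !brE; first exact: Jmon1.
by apply: JmonM; [apply: Jmon_br1; lia|apply: IH; lia].
Qed.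

Definition theta e n : amb n := phi n (br e (n + n) 0 n n).

Lemma natural_theta e n : natural (theta e n).
Proof. by apply: natural_phi; [lia|apply: Jmon_natural; apply: Jmon_br; lia]. Qed.

Lemma natural_l0 n (f : amb n) e N m : natural f -> n + m <= N ->
  br e N 0 n m ** emb N 0 f = emb N m f ** br e N 0 n m.
Proof. by move=> nf le; rewrite natural_l. Qed.
Lemma natural_r0 n (f : amb n) e N m : natural f -> m + n <= N ->
  br e N 0 m n ** emb N m f = emb N 0 f ** br e N 0 m n.
Proof. by move=> nf le; have := @natural_r _ _ X _ _ e N 0 m nf le. Qed.

(* f goes through the braiding onto the closed strands, slides around them and
   comes back on the other side. *)
Lemma theta_natural e n (f : amb n) : natural f -> slides f ->
  theta e n ** f = f ** theta e n.
Proof.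
move=> nf sf; rewrite /theta -phi_natr; last lia.
rewrite natural_l ?add0n //; try lia.
rewrite sf //.
by rewrite (@natural_r _ _ X _ f e _ 0 n) ?phi_natl //; lia.
Qed.

Lemma dbraid_comm e p q (f : amb p) (g : amb q) : natural f -> natural g ->
  br e (p + q) 0 q p ** br e (p + q) 0 p q ** (emb (p + q) 0 f ** emb (p + q) p g) =
  emb (p + q) 0 f ** emb (p + q) p g ** (br e (p + q) 0 q p ** br e (p + q) 0 p q).
Proof.
move=> nf ng; rewrite !ambA -(ambA _ _ (emb _ 0 f)) natural_l0 //.
rewrite !ambA natural_r0 //; last lia.
rewrite -!ambA natural_r0 // (ambA (br e _ 0 q p)) natural_l0 ?ambA //; lia.
Qed.

(** The braiding of p + q with p + q strands splits into four blocks. Only one of them involves the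
    last q strands, and closing these turns it into the twist of q. A block Yang-Baxter relation
    then leaves a single block on the last p strands, whose closure is the twist of p. *)
Lemma theta_add e p q : theta e (p + q) =
  emb (p + q) 0 (theta e p) ** emb (p + q) p (theta e q)
    ** (br e (p + q) 0 q p ** br e (p + q) 0 p q).
Proof.
set N := (p + q) + (p + q).
have nt := natural_theta e.
have -> : theta e (p + q) = phi (p + q) (phi (p + q + p) (br e N p p q ** br e N 0 p p
    ** (br e N (p + p) q q ** br e N p q p))).
  rewrite phi_phi; try (rewrite /N; lia).
  by rewrite /theta brDl !brDr ?add0n // /N; lia.
have E a b c : a + b + c <= p + q + p -> br e N a b c = emb N 0 (br e (p + q + p) a b
  c).
  by move=> le; rewrite emb_br // /N; lia.
rewrite (E p p q) ?(E 0 p p) ?(E p q p); try lia.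
rewrite -embM ?phi_natl; try (rewrite /N; lia).
rewrite phi_natr; last (rewrite /N; lia).
have -> : phi (p + q + p) (br e N (p + p) q q) = emb (p + q + p) (p + p) (theta e q).
  by rewrite br_emb ?(@phi_emb _ _ _ _ _ _ _ q) //; rewrite /N; lia.
rewrite -(@natural_l _ _ X _ _ e (p + q + p) p p) //; try lia.
have -> : br e (p + q + p) p p q ** br e (p + q + p) 0 p p ** (br e (p + q + p) p q p **
    emb (p + q + p) p (theta e q)) =
  emb (p + q + p) 0 (br e (p + q) 0 q p) ** br e (p + q + p) q p p
    ** emb (p + q + p) 0 (br e (p + q) 0 p q ** emb (p + q) p (theta e q)).
  rewrite embM; last lia.
  rewrite !emb_br ?emb_emb ?add0n; try lia.
  rewrite !ambA; congr (_ ** _).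
  have -> : br e (p + q + p) p p q ** br e (p + q + p) 0 p p = br e (p + q + p) 0 p
    (p + q).
    by rewrite brDr ?add0n //; lia.
  (* Block Yang-Baxter relation: naturality of the braiding at a braiding. *)
  have J : natural (br e (q + p) 0 q p) by apply: Jmon_natural; apply: Jmon_br; lia.
  have := @natural_r _ _ X _ _ e (p + q + p) 0 p J.
  rewrite !emb_br ?add0n ?addn0 ?(addnC q p); try lia.
  move=> ->; last lia.
  by rewrite -!ambA; congr (_ ** _); rewrite (addnC p q) brDr ?add0n ?ambA //; lia.
rewrite phi_natr ?phi_natl; try lia.
have -> : phi (p + q) (br e (p + q + p) q p p) = emb (p + q) q (theta e p).
  by rewrite br_emb ?(@phi_emb _ _ _ _ _ _ _ p) //; lia.
have -> : br e (p + q) 0 q p ** emb (p + q) q (theta e p) = emb (p + q) 0 (theta e p)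
  ** br e (p + q) 0 q p.
  by rewrite natural_r0 //; lia.
rewrite -!ambA; congr (_ ** _).
rewrite natural_r0 // !ambA natural_l0 //; lia.
Qed.

Lemma theta1 e : theta e 1 = phi1 (rhat X e).
Proof.
rewrite /theta !brE !ambm1 phiS // phi_id; congr traced_phi1.
by rewrite /crossing emb_id.
Qed.

Lemma theta0 e : theta e 0 = amb1 A 0.
Proof. by rewrite /theta phi_id br0. Qed.

Lemma theta1_true : theta true 1 = bead 1 0 (xcnu X).
Proof. by rewrite theta1 phi1_rhat. Qed.

Lemma br11 e N p : br e N p 1 1 = crossing e N p.
Proof.
by rewrite !brE !ambm1 addn0.
Qed.

Lemma slides_theta e n : slides (theta e n).
Proof. by apply: slides_phi; [lia|apply: Jmon_slides; apply: Jmon_br; lia]. Qed.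

(** In [theta_add] the double braidings of opposite signs cancel and commute with the twists of the
    summands, which reduces the claim to one strand. *)
Lemma theta_K e n : theta e n ** theta (~~ e) n = amb1 A n.
Proof.
have K1 e' : theta e' 1 ** theta (~~ e') 1 = amb1 A 1.
  (* The positive twist enters the closure and moves by naturality onto the closed strand, as the
     bead of [phi1_rhatV]; the other order of the factors follows since twists commute. *)
  have h : theta false 1 ** theta true 1 = amb1 A 1.
    rewrite (theta1 false) -phi1_natr.
    have := @natural_l0 _ (theta true 1) false 2 1 (natural_theta _ _) isT.
    rewrite br11 /crossing emb_id => ->.
    rewrite theta1_true emb_bead //.
    exact: phi1_rhatV.
  case: e'; last exact: h.
  by rewrite theta_natural ?h //; [apply: natural_theta|apply: slides_theta].
elim: n => [|n IH]; first by rewrite !theta0 amb1m.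
rewrite -addn1 !theta_add.
rewrite -ambA (ambA (br e _ 0 1 n ** _)) dbraid_comm; [|exact: natural_theta..].
rewrite -!ambA (ambA (br e _ 0 n 1)) br_K ?amb1m; last lia.
rewrite br_K ?ambm1; last lia.
rewrite (ambA (emb _ n _)) -(@emb_comm _ _ (n + 1) 0 n) -?ambA; try lia.
rewrite -embM ?K1 ?emb1 ?ambm1; try lia.
by rewrite -embM ?IH ?emb1 //; lia.
Qed.

End Twists.

(** * The endomorphism monoids *)

Section Escape.
Variables (k : comPzRingType) (A : kalgebra k) (X : traced_XCalgebra A).
Local Notation amb := (amb A).
Local Notation "f ** g" := (@ambM k A _ f g) (at level 40, left associativity).
Local Notation phi1 := (@traced_phi1 k A X _).
Local Notation phi := (@phi k A X _).
Local Notation crossing := (@crossing k A X).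
Local Notation br := (@br k A X).
Local Open Scope nat_scope.

(** Admissibility in terms of iterates: no orbit stays among the strands from n on. It makes sense
    for any n and N, without writing N as n + m. *)
Definition escapes n N (s : 'S_N) : Prop :=
  forall i, i < N -> exists j, iter j (perm_nat s) i < n.

Lemma pn_amb n (f g : amb n) i :
  perm_nat (f ** g).2 i = perm_nat f.2 (perm_nat g.2 i).
Proof. exact: pnM. Qed.
Lemma pn_emb N p n (f : amb n) i : p + n <= N ->
  perm_nat (emb N p f).2 i = if p <= i then p + perm_nat f.2 (i - p) else i.
Proof. exact: pn_elift. Qed.
Lemma phi1_perm n (f : amb n.+1) : (phi1 f).2 = cut f.2.
Proof. by rewrite /traced_phi1; case: ifP. Qed.

(** The bound on the length in [admissible] is automatic for a cycle contained in a set of m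
    elements. *)
Lemma escapesP n m (s : 'S_(n + m)) : reflect (escapes n s) (admissible s).
Proof.
have it j (x : 'I_(n + m)) : iter j (perm_nat s) x = (s ^+ j)%g x.
  by elim: j => [|j IH] /=; rewrite ?perm1 // IH pnE expgSr permM.
apply: (iffP forallP) => [h i lt|h c].
  pose x := Ordinal lt; have /implyP/(_ (imset_f _ _)) := h (porbit s x).
  rewrite inE => /(_ isT); rewrite negb_and => /orP[/subsetPn[y]|].
    move/porbitP=> [j ->] nt; exists j; rewrite -[i]/(val x) it ltnNge.
    apply: contra nt; case: (split_ordP ((s ^+ j)%g x)) => l -> /= le;
      last exact: imset_f.
    by have := ltn_ord l; lia.
  move=> big; have [sub|/subsetPn[y]] := boolP (porbit s x \subset [set rshift n j |
    j : 'I_m]).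
    case/negP: big; apply: leq_trans (subset_leq_card sub) _.
    by apply: leq_trans (leq_imset_card _ _) _; rewrite card_ord.
  move/porbitP=> [j ->] nt; exists j; rewrite -[i]/(val x) it ltnNge.
  apply: contra nt; case: (split_ordP ((s ^+ j)%g x)) => l -> /= le;
    last exact: imset_f.
  by have := ltn_ord l; lia.
apply/implyP=> /imsetP[x _ ->]; apply/negP => /andP[/subsetP sub _].
have [j] := h x (ltn_ord x); rewrite it.
by have /sub/imsetP[l _ ->] := mem_porbit s j x; rewrite /= ltnNge leq_addr.
Qed.

Lemma escapes_id N (s : 'S_N) : escapes N s.
Proof. by move=> i lt; exists 0. Qed.

(** The orbits of [cut s] are those of [s] with N left out, so that they reach the first n strands
    together; N itself escapes exactly when its image is not N and escapes. *)
Lemma escapes_cut n N (s : 'S_N.+1) : n <= N ->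
  escapes n s <-> perm_nat s N <> N /\ escapes n (cut s).
Proof.
move=> le; split=> [h|[sN h] i lt].
  have sN : perm_nat s N <> N.
    move=> e; have [j] := h N (ltnSn N).
    have -> : iter j (perm_nat s) N = N by elim: j => //= j ->.
    by rewrite ltnNge le.
  have sN' : perm_nat s N < N by have := pnlt s (ltnSn N); lia.
  split=> // i lt; have [j] := h i (ltnW lt).
  (* A passage through N takes two steps of [s] for one of [cut s], hence the strong induction. *)
  elim/ltn_ind: j i lt => -[|j] IH i lt; first by exists 0.
  rewrite iterSr; have lt' : perm_nat s i < N.+1 by apply: pnlt; lia.
  have [e|ne] := eqVneq (perm_nat s i) N.
    rewrite e; case: j IH => [|j] IH; first by rewrite /= ltnNge le.
    rewrite iterSr => /IH []// l hl; exists l.+1.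
    by rewrite iterSr pn_cut // e eqxx.
  move/IH => []//; first by move/eqP: ne; lia.
  by move=> l hl; exists l.+1; rewrite iterSr pn_cut // (negbTE ne).
have sN' : perm_nat s N < N by have := pnlt s (ltnSn N); lia.
have it l i' : i' < N -> exists2 j,
  iter l (perm_nat (cut s)) i' = iter j (perm_nat s) i' &
    iter l (perm_nat (cut s)) i' < N.
  move=> lt'; elim: l => [|l [j e lt2]]; first by exists 0.
  rewrite iterS pn_cut //; case: eqP => eN; first by exists j.+2; rewrite //= -e eN.
  exists j.+1; first by rewrite e.
  by have : perm_nat s (iter l (perm_nat (cut s)) i') < N.+1 by [apply: pnlt; lia]; lia.
have H i' : i' < N -> exists j, iter j (perm_nat s) i' < n.
  by move=> lt'; have [l hl] := h i' lt'; have [j e _] := it l i' lt'; exists j;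
    rewrite -e.
have [e|ne] := eqVneq i N; last by apply: H; move/eqP: ne; lia.
by have [j hj] := H _ sN'; exists j.+1; rewrite iterSr e.
Qed.

Lemma escapes_phi N n m (f : amb N) : n <= m -> m <= N ->
  escapes n f.2 <-> escapes m f.2 /\ escapes n (phi m f).2.
Proof.
move=> nm le; move: N m f le nm; apply: phi_ind => [m f|N m f le IH] nm.
  rewrite phi_id; split=> [h|[] //]; split=> // i lt; exists 0; exact: lt.
have [h1 h2] := IH nm; rewrite phiS // !escapes_cut // -?phi1_perm; last lia.
by split=> [[a /h1[]]|[[a b] c]]; split=> //; apply: h2.
Qed.

Lemma escapes_natl n N (f : amb N) (u : amb n) : n <= N ->
  escapes n f.2 -> escapes n (emb N 0 u ** f).2.
Proof.
move=> le h i /h [j]; elim: j i => [|j IH] i; first by exists 0.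
have lt0 : 0 + n <= N by [].
rewrite iterSr; have [lt _|ge] := ltnP (perm_nat f.2 i) n.
  by exists 1; rewrite iterS pn_amb pn_emb //= add0n subn0 pn_lt.
move=> /IH[l hl]; exists l.+1.
by rewrite iterSr pn_amb pn_emb //= add0n subn0 pn_out.
Qed.
Lemma escapes_natr n N (f : amb N) (u : amb n) : n <= N ->
  escapes n f.2 -> escapes n (f ** emb N 0 u).2.
Proof.
move=> le h i /h [j]; have lt0 : 0 + n <= N by [].
elim: j i => [|j IH] i; first by exists 0.
have [lt _|ge] := ltnP i n; first by exists 0.
rewrite iterSr => /IH[l hl]; exists l.+1.
rewrite iterSr pn_amb pn_emb //= add0n subn0 (pn_out u.2) //.
Qed.
Lemma escapes_emb N p n M (f : amb M) : p + M = N ->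
  escapes n f.2 -> escapes (p + n) (emb N p f).2.
Proof.
move=> e h i lt; have le : p + M <= N by lia.
have [pi|ip] := leqP p i; last by exists 0; rewrite /=; lia.
have [|j hj] := h (i - p); first lia.
exists j; have -> : iter j (perm_nat (emb N p f).2) i = p + iter j (perm_nat f.2) (i
  - p).
  by elim: {hj} j => [|j IH] /=; rewrite ?subnKC // IH pn_emb // leq_addr addKn.
by rewrite ltn_add2l.
Qed.
(** The two permutations are conjugate under that of [emb N r u], which preserves the first r
    strands. *)
Lemma escapes_slide N r n (u : amb n) (f : amb N) : r + n = N ->
  escapes r (emb N r u ** f).2 <-> escapes r (f ** emb N r u).2.
Proof.
move=> e; have le : r + n <= N by lia.
set U := perm_nat (emb N r u).2; set F := perm_nat f.2.
have Ur i : (U i < r) = (i < r).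
  by rewrite /U pn_emb //; case: (leqP r i) => ri; lia.
have E1 j i : iter j (perm_nat (emb N r u ** f).2) (U i) = U (iter j (perm_nat (f **
  emb N r u).2) i).
  by elim: j => [|j IH] //; rewrite !iterS IH !pn_amb.
split=> h i lt.
  have [|j] := h (U i); first exact: pnlt.
  by rewrite E1 Ur; exists j.
have [i0 lt0 ->] : exists2 i0, i0 < N & i = U i0.
  exists (perm_nat ((emb N r u).2^-1)%g i); first exact: pnlt.
  by rewrite /U -pnM mulVg pn1.
by have [j hj] := h i0 lt0; exists j; rewrite E1 Ur.
Qed.

Lemma pn_crossing e N i j : i + 2 <= N -> perm_nat (crossing e N i).2 j = nswap i j.
Proof.
move=> le; rewrite /crossing pn_emb // pn_tperm01 /nswap.
by do ?case: ifP => ?; lia.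
Qed.
Lemma pn_br e N p n m i : p + n + m <= N -> perm_nat (br e N p n m).2 i =
  if p <= i < p + n then i + m else if p + n <= i < p + n + m then i - n else i.
Proof.
have H1 q m' l : q + m' < N -> perm_nat (br1 X e N q m').2 l =
    if l == q then q + m' else if q < l <= q + m' then l.-1 else l.
  elim: m' => [|m' IH] lt; rewrite !brE; first by rewrite pn1; do ?case: ifP => ?; lia.
  rewrite pn_amb pn_crossing ?IH /nswap; try lia.
  case: (l =P q) => ?; first by do ?case: ifP => ?; lia.
  by case: (boolP (q < l <= q + m')) => ?; do ?case: ifP => ?; lia.
elim: n p i => [|n IH] p i le; rewrite !brE.
  by rewrite pn1; do ?case: ifP => ?; lia.
rewrite pn_amb H1 ?IH; try lia.
case: (boolP (p.+1 <= i < p.+1 + n)) => ?; first by do ?case: ifP => ?; lia.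
by case: (boolP (p.+1 + n <= i < p.+1 + n + m)) => ?; do ?case: ifP => ?; lia.
Qed.

Definition superposed e N n m (f : amb N) : amb (N + m) :=
  br (~~ e) (N + m) n (N - n) m ** emb (N + m) 0 f ** br e (N + m) n m (N - n).

(** The permutation is conjugate to that of [f] with m fixed points added; the conjugation takes the
    closed strand i - m to i, and the added strands lie among the first n + m. *)
Lemma escapes_superposed e N n m (f : amb N) : n <= N ->
  escapes n f.2 -> escapes (n + m) (superposed e n m f).2.
Proof.
move=> le h i lt; have [small|big] := ltnP i (n + m); first by exists 0.
have [|j hj] := h (i - m); first lia.
exists j; set B := perm_nat (br (~~ e) (N + m) n (N - n) m).2.
suff E l : iter l (perm_nat (superposed e n m f).2) i = B (iter l (perm_nat f.2) (i -
  m)).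
  by rewrite E /B pn_br; [do ?case: ifP => ?; lia|lia].
elim: l => [|l IH]; first by rewrite /= /B pn_br; [do ?case: ifP => ?; lia|lia].
rewrite !iterS IH /superposed !pn_amb -/B.
have -> y : perm_nat (br e (N + m) n m (N - n)).2 (B y) = y.
  rewrite /B -pn_amb.
  by have := @br_K _ _ X e (N + m) n m (N - n) => ->; rewrite ?pn1 //; lia.
by rewrite pn_emb ?leq_addr //= add0n subn0.
Qed.

End Escape.

(** * Endomorphism monoids for an abstract domain of closure *)

Section ElementFamily.
Variables (k : comPzRingType) (A : kalgebra k) (X : traced_XCalgebra A).
Variables (K : k -> Prop) (dm : forall n N : nat, 'S_N -> Prop).
Local Notation amb := (amb A).
Local Notation "f ** g" := (@ambM k A _ f g) (at level 40, left associativity).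
Local Notation phi1 := (@traced_phi1 k A X _).
Local Notation phi := (@phi k A X _).
Local Notation crossing := (@crossing k A X).
Local Notation br := (@br k A X).
Local Notation D n s := (@dm n _ s).
Local Open Scope nat_scope.

(* D n s: the last strands may be closed, down to n, when the permutation is s *)
Record closure_domain : Prop := ClosureDomain {
  dom_id : forall N (s : 'S_N), D N s;
  dom_phi : forall N n m (f : amb N), n <= m -> m <= N ->
    D n f.2 <-> D m f.2 /\ D n (phi m f).2;
  dom_natl : forall n N (f : amb N) (u : amb n), n <= N ->
    D n f.2 -> D n (emb N 0 u ** f).2;
  dom_natr : forall n N (f : amb N) (u : amb n), n <= N ->
    D n f.2 -> D n (f ** emb N 0 u).2;
  dom_emb : forall N p n M (f : amb M), p + M = N ->
    D n f.2 -> D (p + n) (emb N p f).2;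
  dom_superposed : forall e N n m (f : amb N), n <= N ->
    D n f.2 -> D (n + m) (superposed X e n m f).2;
  dom_br : forall e n, D n (br e (n + n) 0 n n).2 }.

(** The generators of [open_I] and [traced_I] in one form, with N and n <= N in place of n + m so
    that no cast appears. *)
Definition element_gen n (g : amb n) : Prop := scalar_gen K g \/
  exists N (h : amb N), [/\ n <= N, Jmon X h, D n h.2 & phi n h = g].

Definition element n : amb n -> Prop := submonoid (@element_gen n).

Hypothesis dom : closure_domain.

Lemma element_natural n (f : amb n) : element f -> natural X f.
Proof.
elim=> {f} [f [[c _ ->]|[N [h [le J _ <-]]]]||f g _ nf _ ng].
- exact: naturalZ.
- by apply: natural_phi => //; apply: Jmon_natural.
- exact: natural1.
- exact: naturalM.
Qed.
Lemma element_slides n (f : amb n) : element f -> slides X f.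
Proof.
elim=> {f} [f [[c _ ->]|[N [h [le J _ <-]]]]||f g _ nf _ ng].
- exact: slidesZ.
- by apply: slides_phi => //; apply: Jmon_slides.
- exact: slides1.
- exact: slidesM.
Qed.

Lemma element_phi_Jmon N n (h : amb N) : n <= N -> Jmon X h -> D n h.2 -> element
  (phi n h).
Proof. by move=> le J Dh; apply: submonoid_gen; right; exists N, h. Qed.
Lemma element_Jmon n (h : amb n) : Jmon X h -> element h.
Proof. by move=> J; rewrite -(phi_id X h); apply: element_phi_Jmon => //;
  apply: (dom_id dom). Qed.

Lemma Jmon_superposed e N n m (f : amb N) : n <= N -> Jmon X f -> Jmon X (superposed
  X e n m f).
Proof.
move=> le J; apply: JmonM; [apply: JmonM|]; try by apply: Jmon_br; lia.
by apply: Jmon_emb => //; lia.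
Qed.

(** Strands on the left are added directly under the closure, strands on the right by
    superposing. *)
Lemma element_emb N p n (f : amb n) : p + n <= N -> element f -> element (emb N p f).
Proof.
move=> le Ef; have le2 := le; elim: Ef le2 =>
  {f} [f [[c Kc ->]|[M [h [leM J Dh <-]]]] _|_|f g _ Ef _ Eg _].
- apply: submonoid_gen; left; exists c => //.
  by rewrite -[(_, _)]/(ambZ c (amb1 A n)) embZ emb1.
- have [q eN] : exists q, N = p + n + q by exists (N - (p + n)); lia.
  have -> : emb N p (phi n h) = emb N 0 (emb (p + n) p (phi n h)).
    by rewrite emb_emb ?add0n //; lia.
  rewrite -(@phi_emb _ _ X (p + M)) // eN -(@phi_superpose _ _ X true); last lia.
  apply: element_phi_Jmon; first lia.
    by apply: Jmon_superposed; [lia|apply: Jmon_emb].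
  by apply: dom_superposed => //; [lia|apply: dom_emb].
- by rewrite emb1 //; apply: submonoid_1.
- by rewrite embM //; apply: submonoid_M; [apply: Ef|apply: Eg].
Qed.

Inductive scalar_monoid : k -> Prop :=
| scalar_gen1 c : K c -> scalar_monoid c
| scalar_one : scalar_monoid 1%R
| scalar_mul c d : scalar_monoid c -> scalar_monoid d -> scalar_monoid (c * d)%R.

Lemma ambZZ n c d (f : amb n) : ambZ c (ambZ d f) = ambZ (c * d)%R f.
Proof. by rewrite /ambZ /= GRing.scalerA. Qed.
Lemma ambZ1 n (f : amb n) : ambZ 1%R f = f.
Proof. by case: f => u s; rewrite /ambZ /= GRing.scale1r. Qed.

Lemma element_ambZ n c (f : amb n) : scalar_monoid c -> element f -> element (ambZ c f).
Proof.
move=> Mc Ef; rewrite -[f]amb1m -ambZl; apply: submonoid_M => //.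
elim: Mc => {c} [c Kc||c d _ Ec _ Ed].
- by apply: submonoid_gen; left; exists c.
- by rewrite ambZ1; apply: submonoid_1.
- by rewrite -ambZZ -[ambZ d _]amb1m -ambZl; apply: submonoid_M.
Qed.

Lemma elementE n (f : amb n) : element f -> exists c N (h : amb N),
  [/\ scalar_monoid c, n <= N, Jmon X h, D n h.2 & f = ambZ c (phi n h)].
Proof.
elim=> {f} [f [[c Kc ->]|[N [h [le J Dh <-]]]]||f g _].
- exists c, n, (amb1 A n); split=> //;
  [exact: scalar_gen1|exact: Jmon1|exact: (dom_id dom)|].
  by rewrite phi_id.
- by exists 1%R, N, h; split=> //; [exact: scalar_one|rewrite ambZ1].
- exists 1%R, n, (amb1 A n); split=> //;
  [exact: scalar_one|exact: Jmon1|exact: (dom_id dom)|].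
  by rewrite phi_id ambZ1.
move=> [c [N [h [Mc le J Dh ->]]]] _ [d [N' [h' [Md le' J' Dh' ->]]]].
(* The m strands closed in the left factor are added to the right factor by superposing. Then [h]
   acts on its first n + m strands, and all closures are made at the end. *)
have [m eN] : exists m, N = n + m by exists (N - n); lia.
subst N; pose s := superposed X true n m h'.
have sE : phi (n + m) s = emb (n + m) 0 (phi n h') by apply: phi_superpose.
have Ds : D (n + m) s.2 by apply: dom_superposed.
have E : phi (n + m) (emb (N' + m) 0 h ** s) = h ** emb (n + m) 0 (phi n h').
  by rewrite phi_natl ?sE //; lia.
exists (c * d)%R, (N' + m), (emb (N' + m) 0 h ** s); split; [exact: scalar_mul|lia|..].
- by apply: JmonM; [apply: Jmon_emb => //; lia|apply: Jmon_superposed].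
- apply/(dom_phi dom (m := n + m)); try lia; split.
    by apply: (dom_natl dom) => //; lia.
  by rewrite E; apply: (dom_natr dom); rewrite ?leq_addr.
by rewrite ambZl ambZr ambZZ -[phi n (_ ** s)](@phi_phi _ _ _ _ (n + m)) ?E ?phi_natr
  //; lia.
Qed.

Lemma element_phi N n (f : amb N) : n <= N -> element f -> D n f.2 -> element (phi n f).
Proof.
move=> le /elementE[c [M [h [Mc leM J Dh ->]]]] Df.
rewrite phiZ //; apply: element_ambZ => //; rewrite phi_phi //.
by apply: element_phi_Jmon => //; [lia|apply/(dom_phi dom (m := N))].
Qed.

Lemma element_br e N p n m : p + n + m <= N -> element (br e N p n m).
Proof. by move=> le; apply: element_Jmon; apply: Jmon_br. Qed.

Lemma element_theta e n : element (theta X e n).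
Proof.
apply: element_phi_Jmon; [lia|by apply: Jmon_br; lia|exact: (dom_br dom)].
Qed.

End ElementFamily.

Section Domains.
Variables (k : comPzRingType) (A : kalgebra k) (X : traced_XCalgebra A).

Lemma full_domain : closure_domain X (fun _ _ _ => True).
Proof. by []. Qed.

Lemma escapes_domain : closure_domain X escapes.
Proof.
split.
- exact: escapes_id.
- exact: escapes_phi.
- exact: escapes_natl.
- exact: escapes_natr.
- exact: escapes_emb.
- exact: escapes_superposed.
(* The braiding exchanges the first n strands with the last n, so one step suffices. *)
move=> e n i lt; have [|ge] := ltnP i n; first by exists 0%N.
by exists 1%N; rewrite /= pn_br //; do ?case: ifP => ?; lia.
Qed.
End Domains.

(** * The categories of elements *)

Section Categories.
Variables (k : comPzRingType) (A : kalgebra k) (X : traced_XCalgebra A).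
Variables (K : k -> Prop) (dm : forall n N : nat, 'S_N -> Prop).
Hypothesis dom : closure_domain X dm.
Local Notation amb := (amb A).
Local Notation "f ** g" := (@ambM k A _ f g) (at level 40, left associativity).
Local Notation phi := (@phi k A X _).
Local Notation crossing := (@crossing k A X).
Local Notation br := (@br k A X).
Local Notation E := (@element k A X K dm).
Local Notation Hom := (elemHom (@element k A X K dm)).
Local Open Scope nat_scope.

Lemma hom_eq n m (f g : Hom n m) : sval f = sval g -> f = g.
Proof.
case: f g => f hf [g hg] /= e; subst g; congr exist; exact: Prop_irrelevance.
Qed.

(** Turns the transports of the strict axioms into embeddings at position 0. *)
Lemma sval_castH n n' m m' (e : n = n') (e' : m = m') (f : Hom n m) :
  sval (castH e e' f) = emb n' 0 (sval f).
Proof. by case: n' / e; case: m' / e'; rewrite emb_id. Qed.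

Definition hom_id n : Hom n n := exist _ (amb1 A n) (conj erefl (submonoid_1 _)).

(** [g] lives on m strands and m = n holds only propositionally, so [emb n 0] plays the part of a
    cast. *)
Fact hom_comp_subproof n m p (g : Hom m p) (f : Hom n m) :
  n = p /\ E (emb n 0 (sval g) ** sval f).
Proof.
case: f g => f [e Ef] [g [e' Eg]] /=; subst m p; split=> //.
by rewrite emb_id; apply: submonoid_M.
Qed.
Definition hom_comp n m p (g : Hom m p) (f : Hom n m) : Hom n p :=
  exist _ (emb n 0 (sval g) ** sval f) (hom_comp_subproof g f).

Fact hom_tens_subproof n n' m m' (f : Hom n m) (g : Hom n' m') :
  n + n' = m + m' /\ E (amb_tens (sval f) (sval g)).
Proof.
case: f g => f [e Ef] [g [e' Eg]] /=; subst m m'; split=> //.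
by rewrite amb_tensE; apply: submonoid_M; apply: (element_emb dom) => //; lia.
Qed.
Definition hom_tens n n' m m' (f : Hom n m) (g : Hom n' m') : Hom (n + n') (m + m') :=
  exist _ (amb_tens (sval f) (sval g)) (hom_tens_subproof f g).

Lemma emb_tens N p n m (f : amb n) (g : amb m) : p + (n + m) <= N ->
  emb N p (amb_tens f g) = emb N p f ** emb N (p + n) g.
Proof. by move=> le; rewrite amb_tensE embM // !emb_emb ?addn0 //; lia. Qed.

Definition elements_category : category Hom.
Proof.
refine (@Category _ _ hom_id hom_comp _ _ _).
- move=> n m [f [e Ef]]; subst m; apply: hom_eq.
  by rewrite /= emb_id amb1m.
- by move=> n m [f [e Ef]]; subst m; apply: hom_eq; rewrite /= ambm1 emb_id.
- move=> n m p q [h [e1 Eh]] [g [e2 Eg]] [f [e3 Ef]]; subst m p q; apply: hom_eq.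
  by rewrite /= !emb_id ambA.
Defined.

Lemma amb_tens1 n m : amb_tens (amb1 A n) (amb1 A m) = amb1 A (n + m).
Proof. by rewrite amb_tensE !emb1 ?ambm1 ?leq_addr. Qed.

Definition elements_monoidal : monoidal Hom 0 addn.
Proof.
refine (@Monoidal _ _ _ _ elements_category hom_tens addnA add0n addn0 _ _ _ _ _).
- by move=> n m; apply: hom_eq; rewrite /= amb_tens1.
- move=> n m p n' m' p' [g [e1 Eg]] [f [e2 Ef]] [g' [e3 Eg']] [f' [e4 Ef']].
  subst m p m' p'; apply: hom_eq; rewrite /= !emb_id !amb_tensE !embM ?leq_addr //.
  rewrite -!ambA; congr (_ ** _); rewrite !ambA; congr (_ ** _).
  by rewrite emb_comm //; lia.
- move=> n m p n' m' p' [f [e1 Ef]] [g [e2 Eg]] [h [e3 Eh]].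
  subst n' m' p'; apply: hom_eq; rewrite sval_castH /= emb_tens; last lia.
  rewrite emb_tens ?add0n ?ambA; last lia.
  by rewrite amb_tensE emb_tens ?add0n //; lia.
- move=> n m [f [e Ef]]; subst m; apply: hom_eq; rewrite sval_castH /=.
  by rewrite emb_tens ?emb1 ?add0n ?amb1m ?emb_id.
- move=> n m [f [e Ef]]; subst m; apply: hom_eq; rewrite sval_castH /=.
  by rewrite emb_tens ?emb1 ?addn0 ?ambm1 ?emb_id //; lia.
Defined.

Definition hom_braid n m : Hom (n + m) (m + n) :=
  exist _ (br true (n + m) 0 n m) (conj (addnC n m) (@element_br k A X K dm dom true
    (n + m) 0 n m (leqnn (n + m)))).
Definition hom_braidV n m : Hom (m + n) (n + m) :=
  exist _ (br false (m + n) 0 m n) (conj (addnC m n) (@element_br k A X K dm dom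
    false (m + n) 0 m n (leqnn (m + n)))).


Definition hom_twist e n : Hom n n :=
  exist _ (theta X e n) (conj erefl (element_theta K dom e n)).

Lemma br_addC e n m p q : br e (n + m) 0 p q = emb (n + m) 0 (br e (m + n) 0 p q).
Proof. by rewrite (addnC m n) emb_id. Qed.

Definition elements_cat : balanced Hom 0 addn.
Proof.
refine (@Balanced _ _ _ _ elements_monoidal hom_braid hom_braidV _ _ _ _ _
  (hom_twist true) (hom_twist false) _ _ _ _).
- move=> n m; apply: hom_eq; rewrite /= -br_addC.
  by rewrite (@br_K _ _ X false) //; lia.
- move=> n m; apply: hom_eq; rewrite /= -br_addC.
  by rewrite (@br_K _ _ X true) //; lia.
- move=> n n' m m' [f [e1 Ef]] [g [e2 Eg]]; subst n' m'; apply: hom_eq.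
  have [nf ng] := (element_natural Ef, element_natural Eg).
  rewrite /= emb_id emb_tens ?add0n ?amb_tensE; last lia.
  rewrite ambA natural_l0 // -ambA natural_r0 // !ambA; congr (_ ** _).
  by rewrite [RHS]emb_comm //; lia.
- move=> n m p; apply: hom_eq; rewrite sval_castH /= sval_castH /=.
  rewrite !emb_tens ?emb1 ?add0n ?amb1m ?ambm1; try lia.
  by rewrite !emb_br ?add0n ?addn0 ?brDl ?add0n //; lia.
- move=> n m p; apply: hom_eq; rewrite sval_castH /= sval_castH /=.
  rewrite !emb_tens ?emb1 ?add0n ?amb1m ?ambm1; try lia.
  by rewrite !emb_br ?add0n ?addn0 ?brDr ?add0n //; lia.
- by move=> n; apply: hom_eq; rewrite /= emb_id (@theta_K _ _ X false).
- by move=> n; apply: hom_eq; rewrite /= emb_id theta_K.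
- move=> n m [f [e Ef]]; subst m; apply: hom_eq; rewrite /= !emb_id.
  by rewrite theta_natural //; [exact: (element_natural Ef)|exact: (element_slides Ef)].
- move=> n m; apply: hom_eq; rewrite /= theta_add -br_addC amb_tensE.
  by rewrite emb_id.
Defined.

Section TraceAxioms.
Local Notation C := elements_cat.

(** This and the next trace axioms concern underlying elements and the total map [phi], so they
    serve both versions; the conditions on domains are separate lemmas. *)
Lemma trace_nat X1 X2 Y1 Y2 U (u : Hom X2 X1) (v : Hom Y1 Y2) (f : Hom (X1 + U) (Y1 +
  U)) :
  phi X2 (sval (Defs.comp C (tensm C v (Defs.idm C U)) (Defs.comp C f (tensm C u
    (Defs.idm C U))))) =
  emb X2 0 (sval v) ** (emb X2 0 (phi X1 (sval f)) ** sval u).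
Proof.
case: u v f => u [eu Eu] [v [ev Ev]] [f [ef Ef]] /=.
have e : X1 = Y1 by lia.
subst Y1 X1 Y2; rewrite !emb_id !amb_tensE !emb1 ?ambm1 //.
by rewrite phi_natl ?phi_natr ?leq_addr.
Qed.

Lemma trace_slide X1 Y1 U V (u : Hom V U) (f : Hom (X1 + U) (Y1 + V)) :
  phi X1 (sval (Defs.comp C (tensm C (Defs.idm C Y1) u) f)) =
  phi X1 (sval (Defs.comp C f (tensm C (Defs.idm C X1) u))).
Proof.
case: u f => u [eu Eu] [f [ef Ef]] /=; subst U.
have e : X1 = Y1 by lia.
subst Y1; rewrite !emb_id !amb_tensE !emb1 ?amb1m ?leq_addr //.
by apply: (element_slides Eu).
Qed.

Lemma trace_unit X1 Y1 (f : Hom (X1 + 0) (Y1 + 0)) : phi X1 (sval f) = emb X1 0 (sval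
  f).
Proof.
case: f => f [e Ef] /=; rewrite -[RHS](phi_id X) (@phi_emb _ _ _ _ X1 0 _ X1) ?addn0 //.
by rewrite emb_id.
Qed.

Lemma trace_tens X1 U V (g : amb (X1 + (U + V))) :
  phi X1 g = phi X1 (phi (X1 + U) (emb (X1 + U + V) 0 g)).
Proof.
rewrite phi_phi ?leq_addr // (@phi_emb _ _ _ _ X1 0 _ X1) ?addnA ?emb_id //.
by rewrite -addnA leq_addr.
Qed.

(** By naturality [g] leaves the conjugation to the right and arrives on strands that are not
    closed. *)
Lemma superposedE e n U m (f : amb (n + U)) (g : amb m) : E g ->
  br (~~ e) (n + m + U) n U m ** (emb (n + m + U) 0 f ** emb (n + m + U) (n + U) g)
     ** br e (n + m + U) n m U
  = emb (n + m + U) 0 (superposed X e n m f) ** emb (n + m + U) 0 (emb (n + m) n g).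
Proof.
move=> Eg; rewrite -!ambA -natural_l; [|exact: (element_natural Eg)|lia].
rewrite emb_emb // ?leq_addr // /superposed addKn !embM ?emb_br ?emb_emb ?add0n ?ambA
  //; lia.
Qed.

Lemma phi_superposed e n U m (f : amb (n + U)) (g : amb m) : E g ->
  phi (n + m) (br (~~ e) (n + m + U) n U m ** (emb (n + m + U) 0 f ** emb (n + m + U)
    (n + U) g)
     ** br e (n + m + U) n m U) = amb_tens (phi n f) g.
Proof.
move=> Eg; rewrite superposedE // phi_natr ?leq_addr // amb_tensE; congr (_ ** _).
rewrite (@phi_emb _ _ X _ _ 0 (n + U + m) (n + m)) ?emb_id //; try lia.
by rewrite phi_superpose ?leq_addr.
Qed.

Lemma dom_superposed_emb e n U m (f : amb (n + U)) (g : amb m) : E g -> dm n f.2 ->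
  dm (n + m) (br (~~ e) (n + m + U) n U m ** (emb (n + m + U) 0 f ** emb (n + m + U)
    (n + U) g)
     ** br e (n + m + U) n m U).2.
Proof.
move=> Eg df; rewrite superposedE //; apply: (dom_natr dom); first exact: leq_addr.
apply: (@dom_emb _ _ _ _ dom (n + m + U) 0 (n + m)); first lia.
by apply: (dom_superposed dom) => //; exact: leq_addr.
Qed.

Lemma superpose1_sval n1 m2 n2 U (f : Hom (n1 + U) (n1 + U)) (g : Hom n2 m2) :
  sval (superpose1 C f g) = br false (n1 + n2 + U) n1 U n2 **
   (emb (n1 + n2 + U) 0 (sval f) ** emb (n1 + n2 + U) (n1 + U) (sval g))
     ** br true (n1 + n2 + U) n1 n2 U.
Proof.
case: f g => f [ef Ef] [g [eg Eg]]; subst m2; rewrite sval_castH /= sval_castH /=.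
rewrite !embM ?emb_tens ?emb1 ?amb1m ?emb_emb ?add0n ?amb1m; try lia.
rewrite !emb_br ?addn0 ?add0n ?ambA; try lia.
by rewrite embM ?emb_emb ?add0n ?ambA //; lia.
Qed.

Lemma superpose2_sval n1 m2 n2 U (f : Hom (n1 + U) (n1 + U)) (g : Hom n2 m2) :
  sval (superpose2 C f g) = br true (n1 + n2 + U) n1 U n2 **
   (emb (n1 + n2 + U) 0 (sval f) ** emb (n1 + n2 + U) (n1 + U) (sval g))
     ** br false (n1 + n2 + U) n1 n2 U.
Proof.
case: f g => f [ef Ef] [g [eg Eg]]; subst m2; rewrite sval_castH /= sval_castH /=.
rewrite !embM ?emb_tens ?emb1 ?amb1m ?emb_emb ?add0n ?amb1m; try lia.
rewrite !emb_br ?addn0 ?add0n ?ambA; try lia.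
by rewrite embM ?emb_emb ?add0n ?ambA //; lia.
Qed.

Lemma hom_add X1 Y1 U (f : Hom (X1 + U) (Y1 + U)) : X1 = Y1.
Proof. by have [] := svalP f; lia. Qed.

Lemma trace_superpose1 X1 Y1 X2 Y2 U (f : Hom (X1 + U) (Y1 + U)) (g : Hom X2 Y2) :
  amb_tens (phi X1 (sval f)) (sval g) = phi (X1 + X2) (sval (superpose1 C f g)).
Proof.
have e := hom_add f; subst Y1; rewrite superpose1_sval (phi_superposed true) //.
exact: (svalP g).2.
Qed.
Lemma trace_superpose2 X1 Y1 X2 Y2 U (f : Hom (X1 + U) (Y1 + U)) (g : Hom X2 Y2) :
  amb_tens (phi X1 (sval f)) (sval g) = phi (X1 + X2) (sval (superpose2 C f g)).
Proof.
have e := hom_add f; subst Y1; rewrite superpose2_sval (phi_superposed false) //.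
exact: (svalP g).2.
Qed.
Lemma dom_superpose1 X1 Y1 X2 Y2 U (f : Hom (X1 + U) (Y1 + U)) (g : Hom X2 Y2) :
  dm X1 (sval f).2 -> dm (X1 + X2) (sval (superpose1 C f g)).2.
Proof.
have e := hom_add f; subst Y1; rewrite superpose1_sval;
  apply: (dom_superposed_emb true).
exact: (svalP g).2.
Qed.
Lemma dom_superpose2 X1 Y1 X2 Y2 U (f : Hom (X1 + U) (Y1 + U)) (g : Hom X2 Y2) :
  dm X1 (sval f).2 -> dm (X1 + X2) (sval (superpose2 C f g)).2.
Proof.
have e := hom_add f; subst Y1; rewrite superpose2_sval;
  apply: (dom_superposed_emb false).
exact: (svalP g).2.
Qed.
Lemma dom_trace_nat X1 X2 Y1 Y2 U (u : Hom X2 X1) (v : Hom Y1 Y2) (f : Hom (X1 + U)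
  (Y1 + U)) :
  dm X1 (sval f).2 ->
  dm X2 (sval (Defs.comp C (tensm C v (Defs.idm C U)) (Defs.comp C f (tensm C u
    (Defs.idm C U))))).2.
Proof.
have e := hom_add f; subst Y1.
case: u v f => u [eu Eu] [v [ev Ev]] [f [ef Ef]]; subst X1 Y2 => df.
rewrite [sval _]/= !emb_id !amb_tensE !emb1 ?ambm1 //.
by apply: (dom_natl dom); [|apply: (dom_natr dom)]; rewrite ?leq_addr.
Qed.

End TraceAxioms.

Fact hom_trace_subproof n m U (f : Hom (n + U) (m + U)) : dm n (sval f).2 ->
  n = m /\ E (phi n (sval f)).
Proof.
case: f => f [e Ef] /= h; split; first lia.
by apply: (element_phi dom) => //; apply: leq_addr.
Qed.
Definition hom_trace n m U (f : Hom (n + U) (m + U)) (h : dm n (sval f).2) : Hom n m :=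
  exist _ (phi n (sval f)) (hom_trace_subproof h).

Lemma elements_catP : elements_balanced X elements_cat.
Proof.
split=> //=.
- by move=> n f g; rewrite emb_id.
- by rewrite br0.
- by rewrite br_0.
- by rewrite br0.
- by rewrite br11 /crossing emb_id.
- by rewrite theta0.
rewrite theta1_true /bead; congr (pure _, _).
by apply/ffunP => i; rewrite !ffunE; case: i => -[].
Qed.

End Categories.

(** * The traced version *)

Section TracedCategory.
Variables (k : comPzRingType) (A : kalgebra k) (K : k -> Prop) (X : traced_XCalgebra A).
Local Notation dom := (full_domain X).

Definition traced_elements_cat : traced (elemHom (@element k A X K (fun _ _ _ =>
  True))) 0%N addn.
Proof.
refine (@Traced _ _ _ _ (elements_cat K dom)
  (fun n m U f => hom_trace dom (f := f) I) _ _ _ _ _ _ _ _).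
- by move=> X1 X2 Y1 Y2 U u v f; apply: hom_eq; exact: trace_nat.
- by move=> X1 Y1 U V u f; apply: hom_eq; exact: trace_slide.
- by move=> X1 Y1 f; apply: hom_eq; rewrite sval_castH; exact: trace_unit.
- by move=> X1 Y1 U V g; apply: hom_eq; rewrite /= sval_castH; exact: trace_tens.
- by move=> X1 Y1 X2 Y2 U f g; apply: hom_eq; exact: trace_superpose1.
- by move=> X1 Y1 X2 Y2 U f g; apply: hom_eq; exact: trace_superpose2.
(* The twist and its inverse were defined as the closures of the braiding and its inverse. *)
- by move=> U; apply: hom_eq.
- by move=> U; apply: hom_eq.
Defined.

Lemma traced_IE : @traced_I k A K X = @element k A X K (fun _ _ _ => True).
Proof.
apply/functional_extensionality_dep => n; rewrite /traced_I /element.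
congr submonoid; apply/funext => g; apply/propext; split=> -[?|]; try by left.
  move=> [m [f [J <-]]]; right; exists (n + m)%N, f; split=> //; first exact: leq_addr.
  by rewrite traced_phiE.
move=> [N [h [le J _ <-]]]; right;
  have [m eN] : exists m, N = (n + m)%N by exists (N - n)%N; lia.
by subst N; exists m, h; rewrite traced_phiE.
Qed.

Lemma traced_elements_catP : traced_elements X traced_elements_cat.
Proof.
split; first exact: elements_catP.
by move=> n m f; rewrite traced_phiE.
Qed.

End TracedCategory.

(** * The open version *)

Section OpenCategory.
Variables (k : comPzRingType) (A : kalgebra k) (K : k -> Prop) (Y : XCalgebra A).

(* On morphisms with admissible permutation no loop is ever closed, so that the
   zero trace gives the open closure maps. *)
Definition zero_trace : {linear A -> k^o} := \0.
Fact zero_traceC (a b : A) : zero_trace (a * b) = zero_trace (b * a).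
Proof. by []. Qed.
Definition zero_traced : traced_XCalgebra A :=
  @TracedXCAlgebra k A Y zero_trace zero_traceC.
Local Notation X := zero_traced.
Local Notation dom := (escapes_domain X).
Local Notation Hom := (elemHom (@element k A X K escapes)).

Lemma escapes_cast n N M (e : N = M) (f : amb A N) :
  escapes n (amb_cast e f).2 <-> escapes n f.2.
Proof. by case: M / e. Qed.

(** [open_phi] fails exactly when some strand to be closed is fixed at its turn, which by
    [escapes_cut] means that the permutation is not admissible; otherwise the trace is never
    evaluated. *)
Lemma open_phi_traced n m (f : amb A (n + m)) :
  open_phi Y f = if admissible f.2 then Some (traced_phi X f) else None.
Proof.
elim: m f => [|m IH] f /=.
  case: escapesP => // -[] i lt; exists 0%N; rewrite /=; lia.
set f' := amb_cast _ f; have Ef := escapes_cast n (addnS n m) f.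
have cutE : escapes n f'.2 <-> _ := escapes_cut f'.2 (leq_addr m n).
rewrite /open_phi1 /traced_phi1; case: ifP => h /=.
  case: escapesP => // /Ef/cutE[]; move: h; rewrite pn_max => /eqP //.
rewrite IH; move: h; rewrite pn_max => /eqP h.
case: escapesP => h1; case: escapesP => h2 //.
  by case: h2; apply/Ef/cutE.
by case: h1; have [_] := cutE.1 (Ef.2 h2).
Qed.

Lemma open_IE : @open_I k A K Y = @element k A X K escapes.
Proof.
apply/functional_extensionality_dep => n; rewrite /open_I /element.
congr submonoid; apply/funext => g; apply/propext; split=> -[?|]; try by left.
  move=> [m [f [J adm fg]]]; right; exists (n + m)%N, f; split=> //.
  - exact: leq_addr.
  - exact/escapesP.
  - by move: fg; rewrite open_phi_traced adm -traced_phiE => -[].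
move=> [N [h [le J esc <-]]]; right.
have [m eN] : exists m, N = (n + m)%N by exists (N - n)%N; lia.
subst N; exists m, h; split=> //; first exact/escapesP.
by rewrite open_phi_traced -traced_phiE; case: escapesP.
Qed.

(** By [theta_add] and induction: double braidings induce the trivial permutation, and the symmetric
    group on one point is trivial. *)
Lemma theta_perm e n : (theta X e n).2 = 1%g.
Proof.
elim: n => [|n IH]; first by rewrite theta0.
apply: pn_eq => i lt; move: i lt; rewrite -addn1 theta_add => i lt.
rewrite !pn_amb.
have -> : perm_nat (br X e (n + 1) 0 1 n).2 (perm_nat (br X e (n + 1) 0 n 1).2 i) = i.
  rewrite (@pn_br _ _ X e (n + 1) 0 n 1); last lia.
  case: (boolP (0 <= i < 0 + n)%N) => hi /=.
    by rewrite pn_br; do ?case: ifP => ?; lia.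
  case: (boolP (0 + n <= i < 0 + n + 1)%N) => hi' /=; last lia.
  by rewrite pn_br; do ?case: ifP => ?; lia.
have S1 (s : 'S_1) : s = 1%g.
  by apply: pn_eq => j j1; have := pnlt s j1; rewrite pn1; lia.
rewrite !pn_emb ?IH ?(S1 (theta X e 1).2); try lia.
by rewrite !pn1 /=; case: (leqP n i); lia.
Qed.

Definition strand_functor :
  balanced_functor (elements_cat K dom) sym_balanced (fun n : nat => n).
Proof.
refine (@BalancedFunctor _ _ _ _ _ _ _ _ (elements_cat K dom) sym_balanced (fun n => n)
  (fun n m (f : Hom n m) => exist _ (sval f).2 (proj1 (svalP f)))
  erefl (fun _ _ => erefl) _ _ _ _ _).
- by move=> n; apply: symHom_eq.
- move=> n m p [g [e1 Eg]] [f [e2 Ef]]; subst m p; apply: symHom_eq => i.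
  by rewrite pn_comp -[LHS]/(perm_nat (ambM (emb n 0 g) f).2 i) emb_id pn_amb.
- by move=> n m n' m' f g; apply: symHom_eq => i; rewrite pn_castH.
- move=> n m; apply: symHom_eq => i; rewrite pn_castH /= pn_br // pn_swap.
  by do ?case: ifP => ?; lia.
- by move=> n; apply: symHom_eq => i; rewrite /= theta_perm.
Defined.

Lemma omap_sval_inj n m (f g : option (Hom n m)) : omap sval f = omap sval g -> f = g.
Proof. by case: f g => [f|] [g|] //= [/hom_eq ->]. Qed.

(** Matching on [escapesP] yields, besides the truth value, the proof that [hom_trace] requires. *)
Definition open_trace n m U (f : Hom (n + U) (m + U)) : option (Hom n m) :=
  if @escapesP n U (sval f).2 is ReflectT h then Some (hom_trace dom h) else None.

Lemma omap_open_trace n m U (f : Hom (n + U) (m + U)) :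
  omap sval (open_trace f) = if admissible (sval f).2 then Some (phi X n (sval f))
    else None.
Proof. by rewrite /open_trace; case: escapesP. Qed.


Lemma open_traceP n m U (f : Hom (n + U) (m + U)) : escapes n (sval f).2 ->
  exists2 h, open_trace f = Some h & sval h = phi X n (sval f).
Proof.
rewrite /open_trace; case: escapesP => // h _.
by exists (hom_trace dom h).
Qed.

Lemma open_traceE n m U (f : Hom (n + U) (m + U)) (h : Hom n m) : escapes n (sval
  f).2 ->
  phi X n (sval f) = sval h -> open_trace f = Some h.
Proof. by move=> /open_traceP[h' -> e'] e; congr Some; apply: hom_eq; rewrite e' e. Qed.

Lemma admissible_homE n m U (f : Hom (n + U) (m + U)) :
  admissible_hom strand_functor f = admissible (sval f).2.
Proof. by rewrite /admissible_hom; congr admissible; apply: cast_perm_id. Qed.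

Definition open_elements_cat : open_traced Hom 0%N addn (fun n : nat => n).
Proof.
refine (@OpenTraced _ _ _ _ _ (elements_cat K dom) strand_functor open_trace
  _ _ _ _ _ _ _ _ _).
- by move=> n m U f; rewrite admissible_homE /open_trace; case: escapesP.
- move=> n n' m m' U u v f; rewrite admissible_homE => /escapesP df.
  have [h -> hE] := open_traceP df.
  apply: open_traceE; first exact: (dom_trace_nat dom u v df).
  by rewrite trace_nat -hE.
- move=> n m U V u f; apply: omap_sval_inj; rewrite !omap_open_trace trace_slide.
  (* The values agree by [trace_slide]; it remains to see that both sides are defined at the same
     time. *)
  congr (if _ then _ else _); case: u f => u [eu Eu] [f [ef Ef]]; subst U.
  have e : n = m by lia.
  subst m; rewrite [sval _]/= [sval (Defs.comp _ _ _)]/= !emb_id !amb_tensE.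
  rewrite !emb1 ?amb1m ?leq_addr //.
  by apply/escapesP/escapesP => /escapes_slide; apply.
- move=> n m f; apply: open_traceE; last by rewrite sval_castH trace_unit.
  by move=> i lt; exists 0%N; rewrite /=; lia.
- move=> n m U V g; rewrite admissible_homE => /escapesP dg.
  have e := hom_add g; subst m.
  set g' := castH _ _ g.
  have g'E : sval g' = emb _ 0 (sval g) by apply: sval_castH.
  have dg' : escapes n (sval g').2.
    by rewrite g'E; apply: (@escapes_emb _ _ _ 0 n); first lia.
  have [h hg hE] := open_traceP dg.
  (* Admissibility of the whole closure gives that of the first closure and, for its result, that of
     the second. *)
  have [d1 d2] := (escapes_phi X (sval g') (leq_addr U n) (leq_addr V (n + U))).1 dg'.
  have [h' hg' hE'] := open_traceP d1.
  rewrite hg hg' /=; apply/esym/open_traceE; first by rewrite hE'.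
  by rewrite hE' g'E -trace_tens hE.
- move=> n m n' m' U f g; rewrite admissible_homE => /escapesP df.
  have [h -> hE] := open_traceP df; apply/esym/open_traceE.
    exact: (dom_superpose1 dom g df).
  by rewrite -trace_superpose1 -hE.
- move=> n m n' m' U f g; rewrite admissible_homE => /escapesP df.
  have [h -> hE] := open_traceP df; apply/esym/open_traceE.
    exact: (dom_superpose2 dom g df).
  by rewrite -trace_superpose2 -hE.
- by move=> n; apply: open_traceE => //; apply: (dom_br dom).
- by move=> n; apply: open_traceE => //; apply: (dom_br dom).
Defined.

Lemma open_elements_catP : open_elements Y open_elements_cat.
Proof.
split=> //; first exact: (elements_catP K dom).
move=> n m f; rewrite omap_open_trace open_phi_traced -traced_phiE.
by case: escapesP.
Qed.

End OpenCategory.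

Theorem theorem1p2 (k : comPzRingType) (A : kalgebra k) (K : k -> Prop) :
  (forall X : XCalgebra A,
     exists C : open_traced (elemHom (open_I K X)) 0%N addn id,
       open_elements X C)
  /\
  (forall X : traced_XCalgebra A,
     exists C : traced (elemHom (traced_I K X)) 0%N addn,
       traced_elements X C).
Proof.
split=> X; first by rewrite open_IE; exists (open_elements_cat K X);
  apply: open_elements_catP.
by rewrite traced_IE; exists (traced_elements_cat K X); apply: traced_elements_catP.
Qed.
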